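(* Let $n\ge 2$ be an integer and let $s,r,\alpha,\gamma$ be real numbers with $0<s<\frac{n}{2}$, $2<r<\infty$, $0<\alpha<\frac{n}{2}$, $-\frac{n}{r}<\gamma<\alpha$, and $$\frac1r-\frac12=\frac{\alpha-\gamma-s}{n}.$$ Let $$S=\sup\left\{\frac{\||x|^\gamma(-\Delta)^{-s/2}f\|_{L^r}}{\||x|^\alpha f\|_{L^2}}\ :\ f\in L^2(\mathbb{R}^n,|x|^{2\alpha}),\ f\not\equiv 0\right\}.$$ Then there exists a maximizer for $S$, that is, there exists $g\in L^2(\mathbb{R}^n,|x|^{2\alpha})$, $g\not\equiv0$, such that $$\||x|^\gamma(-\Delta)^{-s/2}g\|_{L^r}=S\,\||x|^\alpha g\|_{L^2}.$$
   Context: All $L^q$ norms are over $\mathbb{R}^n$ with Lebesgue measure, and $L^2(\mathbb{R}^n,|x|^{2\alpha})$ is the space of measurable $f$ with $\||x|^\alpha f\|_{L^2}<\infty$. For $0<s<n$, $(-\Delta)^{-s/2}$ denotes the Riesz potential $$(-\Delta)^{-s/2}f(x)=c(n,s)\int_{\mathbb{R}^n}\frac{f(y)}{|x-y|^{n-s}}\,dy,$$ with the standard normalizing constant $c(n,s)>0$. *)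

(* Defs.v *)
From HB Require Import structures.
From mathcomp Require Import all_boot all_order all_algebra.
From mathcomp Require Import all_classical all_reals all_analysis.

Set Implicit Arguments.
Unset Strict Implicit.
Unset Printing Implicit Defensive.
Import Order.TTheory GRing.Theory Num.Theory.
Import numFieldNormedType.Exports.

Local Open Scope classical_set_scope.
Local Open Scope ring_scope.
Local Open Scope ereal_scope.

(* [measurableTypeR R] is convertible to [R]; it is the type that carries the
   measurable structure underlying [lebesgue_measure]. *)
Notation euclid R n := (n.-tuple (measurableTypeR R)).

(* Lebesgue measure on R^n, for R^n represented by [euclid R n] with its
   product (Borel) sigma-algebra: the n-fold product of [lebesgue_measure],
   transported along (x, v) |-> x :: v at each step, starting from the unit
   point mass on R^0. *)
Section lebesgue_tuple.
Variable R : realType.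

Definition cons_pair n (p : measurableTypeR R * euclid R n) : euclid R n.+1 :=
  [tuple of p.1 :: p.2].

Definition uncons n (t : euclid R n.+1) : measurableTypeR R * euclid R n :=
  (thead t, [tuple of behead t]).

Lemma cons_pairK n : cancel (@cons_pair n) (@uncons n).
Proof. by case=> x t; congr pair; apply/val_inj. Qed.

Lemma unconsK n : cancel (@uncons n) (@cons_pair n).
Proof. by move=> t; rewrite [RHS]tuple_eta; apply/val_inj. Qed.

Lemma measurable_cons_pair n :
  measurable_fun [set: measurableTypeR R * euclid R n] (@cons_pair n).
Proof. by apply: measurable_cons. Qed.

Lemma measurable_uncons n : measurable_fun [set: euclid R n.+1] (@uncons n).
Proof.
apply/measurable_fun_pairP; split; first exact: measurable_tnth.
exact: measurable_behead.
Qed.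

Section step.
Variables (n : nat) (mu : {sigma_finite_measure set (euclid R n) -> \bar R}).

Definition lebesgue_cons : set (euclid R n.+1) -> \bar R :=
  pushforward (lebesgue_measure \x mu) (@cons_pair n).

Let mcons := @measurable_cons_pair n.

Let lebesgue_cons0 : lebesgue_cons set0 = 0.
Proof. by rewrite /lebesgue_cons /pushforward preimage_set0 measure0. Qed.

Let lebesgue_cons_ge0 A : 0 <= lebesgue_cons A.
Proof. exact: measure_ge0. Qed.

Let lebesgue_cons_sigma_additive : semi_sigma_additive lebesgue_cons.
Proof.
exact: (@measure_semi_sigma_additive _ _ _
  (pushforward (lebesgue_measure \x mu) (@cons_pair n))).
Qed.

HB.instance Definition _ := isMeasure.Build _ _ _ lebesgue_cons
  lebesgue_cons0 lebesgue_cons_ge0 lebesgue_cons_sigma_additive.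

Let lebesgue_cons_sigma_finite : sigma_finite setT lebesgue_cons.
Proof.
have /sigma_finiteP[F [TF ndF Foo]] := sigma_finiteT (@lebesgue_measure R).
have /sigma_finiteP[G [TG ndG Goo]] := sigma_finiteT mu.
exists (fun i => @uncons n @^-1` (F i `*` G i)).
  rewrite -preimage_bigcup (_ : \bigcup_i _ = setT) ?preimage_setT//.
  rewrite -setXTT TF TG; apply/seteqP; split=> -[x t] /=.
    by move=> [i _ [? ?]]; split; exists i.
  move=> [[i _ Fx] [j _ Gt]]; exists (maxn i j) => //; split.
    by move: x Fx; exact/subsetPset/ndF/leq_maxl.
  by move: t Gt; exact/subsetPset/ndG/leq_maxr.
move=> i; have [mF Fi] := Foo i; have [mG Gi] := Goo i; split.
  by rewrite -[X in measurable X]setTI; apply: measurable_uncons => //;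
    exact: measurableX.
rewrite /lebesgue_cons /pushforward -comp_preimage.
rewrite (_ : _ \o _ = id); last by apply/funext => p; exact: cons_pairK.
by rewrite preimage_id product_measure1E// lte_mul_pinfty// ge0_fin_numE.
Qed.

HB.instance Definition _ := Measure_isSigmaFinite.Build _ _ _ lebesgue_cons
  lebesgue_cons_sigma_finite.

End step.

Fixpoint lebesgue_tuple (n : nat) :
    {sigma_finite_measure set (euclid R n) -> \bar R} :=
  match n with
  | 0 => \d_ [tuple]
  | n'.+1 => lebesgue_cons (lebesgue_tuple n')
  end.

Lemma lebesgue_tuple_box n (A : 'I_n -> set (measurableTypeR R)) :
  (forall i, measurable (A i)) ->
  lebesgue_tuple n [set x | forall i, A i (tnth x i)] =
  \prod_(i < n) lebesgue_measure (A i).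
Proof.
elim: n A => [|n IH] A mA.
  by rewrite big_ord0 /= diracE mem_set// => -[].
rewrite big_ord_recl -IH//= /lebesgue_cons /pushforward.
rewrite -product_measure1E//; last first.
  rewrite (_ : [set _ | _] =
      \bigcap_(i in [set: 'I_n]) ((@tnth n (measurableTypeR R))^~ i @^-1` A (lift ord0 i))).
    apply: fin_bigcap_measurable => // i _; rewrite -[X in measurable X]setTI.
    by apply: measurable_tnth => //; exact: mA.
  by apply/seteqP; split=> x /= H i; [move=> _|]; exact: H.
congr (_ _); apply/seteqP; split=> -[x t] /=.
  move=> H; split=> [|i]; first exact: (H ord0).
  by have := H (lift ord0 i); rewrite tnthS.
move=> [Ax At] i; case: (unliftP ord0 i) => [j ->|->//].
by rewrite tnthS; exact: At.
Qed.

End lebesgue_tuple.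

Section stein_weiss.
Variable R : realType.

Definition edist n (x y : euclid R n) : R :=
  Num.sqrt (\sum_(i < n) ((tnth x i : R) - tnth y i) ^+ 2)%R.

Definition enorm n (x : euclid R n) : R :=
  Num.sqrt (\sum_(i < n) (tnth x i : R) ^+ 2)%R.

Definition Gamma (z : R) : R :=
  (\int[lebesgue_measure]_(t in `]0, +oo[) (t `^ (z - 1) * expR (- t)))%R.

(* The constant for which [riesz] is the Fourier multiplier by |xi|^(-s), with
   frequencies taken with respect to exp(i x.xi). *)
Definition riesz_const (n : nat) (s : R) : R :=
  (Gamma ((n%:R - s) / 2) / (pi `^ (n%:R / 2) * 2 `^ s * Gamma (s / 2)))%R.

(* On the diagonal x = y the quotient below is 0 (division by zero); this is a
   null set for the integration. *)
Definition riesz n (s : R) (f : euclid R n -> R) (x : euclid R n) : \bar R :=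
  (riesz_const n s)%:E *
  \int[lebesgue_tuple R n]_y (f y / edist x y `^ (n%:R - s))%:E.

Definition wnorm n (a p : R) (F : euclid R n -> \bar R) : \bar R :=
  'N[lebesgue_tuple R n]_(p%:E)[(fun x => (enorm x `^ a)%:E * F x)].

Definition wL2 n (a : R) : set (euclid R n -> R) :=
  [set f | measurable_fun [set: euclid R n] f /\ wnorm a 2 (EFin \o f) < +oo].

Definition nonzero n (f : euclid R n -> R) : Prop :=
  ~ {ae lebesgue_tuple R n, forall x, f x = 0%R}.

Definition best_const n (s r alpha gamma : R) : \bar R :=
  ereal_sup [set wnorm gamma r (riesz s f) / wnorm alpha 2 (EFin \o f)
            | f in [set f : euclid R n -> R | wL2 alpha f /\ nonzero f]].

End stein_weiss.

(* Main.v *)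
Require Import Defs.
From HB Require Import structures.
From mathcomp Require Import all_boot all_order all_algebra.
From mathcomp Require Import all_classical all_reals all_analysis.
From mathcomp Require Import measurable_realfun ring lra.

Set Implicit Arguments.
Unset Strict Implicit.
Unset Printing Implicit Defensive.
Import Order.TTheory GRing.Theory Num.Theory.
Import numFieldNormedType.Exports.

Local Open Scope classical_set_scope.
Local Open Scope ring_scope.

(**
Put A = gamma + n/r > 0 and B = n/2 - alpha > 0, so that A + B = n - s.  The
substitution f = |y|^(-alpha) u turns the problem into maximizing
E(u) = int (K u)^r over the unit ball of L^2, where
  K(x, y) = |x|^(-n/r) |x|^A |x-y|^(-(A+B)) |y|^B |y|^(-n/2),
and since K >= 0 one may assume u >= 0.  The dilations
u |-> rho^(n/2) u(rho .) preserve both E and the L^2 norm.  As q (A + B) < n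
for 1/q = 1/2 + 1/r, a Schur test with respect to dy/|y|^n bounds K from L^2 to
L^r, and makes the operator norm of K small outside the region where
k(x, y) = |x|^A |x-y|^(-(A+B)) |y|^B is at most L and |x|/L <= |y| <= L |x|.
Inside this region the energy is controlled by the averages of u over annuli;
so along a maximizing sequence some annulus carries a fixed amount of mass,
and a dilation moves it to a fixed annulus.  A weak limit v is therefore
nonzero.  The rows of the truncated kernels are in L^2, so weak convergence of
u_j gives pointwise convergence of the truncated K u_j, and the Brezis-Lieb
inequality yields sup E <= E(v) + lim E(|u_j - v|), while the L^2 norm squared
splits as |v|^2 + |u_j - v|^2 in the limit.  Because r > 2, t |-> t^(r/2) is
strictly superadditive, which forces |v| = 1 and E(v) = sup E.
*)

(** * Weak sequential compactness in Hilbert spaces and in L^2 *)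

(** The condition gamma < alpha makes the problem compact up to dilations. Indeed A + B = n/q -
    (alpha - gamma), so gamma < alpha says exactly that q (A + B) < n: the power k^q is integrable
    across the diagonal with room to spare, and cutting k at a large height costs little.
    Concentration at a point away from the origin is thereby excluded, and dilations remain as the
    only loss of compactness. With respect to dy/|y|^n, which dilations preserve, k is homogeneous
    of degree 0, and the Schur test is a form of Young's inequality for the dilation group. The
    error of the truncation is uniform over the unit ball of L^2. Hence pointwise convergence is
    needed only for truncated kernels K', while the splitting of the energy holds for K up to an
    arbitrarily small eta. The weak limit v is not shown to be nonnegative, so energies are taken at
    |v|; this is harmless since |K' v| <= K' |v|. *)

Lemma ler_of_sqr (R : realDomainType) (a b : R) :
  0 <= b -> a ^+ 2 <= b ^+ 2 -> a <= b.
Proof. by move=> b0 ab; rewrite leNgt; apply/negP => lt; nra. Qed.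

(** * Weak compactness for a complete symmetric form that may be degenerate *)

Section hilbert.
Variables (R : realType) (V : lmodType R) (B : V -> V -> R).
Hypothesis BC : forall u v, B u v = B v u.
Hypothesis BD : forall u v w, B (u + v) w = B u w + B v w.
Hypothesis BZ : forall a u v, B (a *: u) v = a * B u v.
Hypothesis B_ge0 : forall u, 0 <= B u u.
Hypothesis B_complete : forall u : nat -> V,
  (forall e : R, 0 < e -> exists N, forall m k, (N <= m)%N -> (N <= k)%N ->
    B (u m - u k) (u m - u k) < e) ->
  exists v, B (u k - v) (u k - v) @[k --> \oo] --> 0.

Lemma formDr w u v : B w (u + v) = B w u + B w v.
Proof. by rewrite BC BD !(BC w). Qed.

Lemma formZr a u v : B v (a *: u) = a * B v u.
Proof. by rewrite BC BZ BC. Qed.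

Lemma formNl u v : B (- u) v = - B u v.
Proof. by rewrite -scaleN1r BZ mulN1r. Qed.

Lemma formNr u v : B v (- u) = - B v u.
Proof. by rewrite BC formNl BC. Qed.

Definition formE := (BD, formDr, BZ, formZr, formNl, formNr).

Lemma form_cauchy_schwarz u v : B u v ^+ 2 <= B u u * B v v.
Proof.
have h t : 0 <= B u u + t * B u v *+ 2 + t ^+ 2 * B v v.
  by have := B_ge0 (u + t *: v); rewrite !formE (BC v u); lra.
(* The form may vanish at a nonzero [v]. Then the quadratic in [t] is affine, and a nonzero slope
   would make it equal to -1 at the chosen [t]. Otherwise [t] is the minimizer. *)
have := B_ge0 v; rewrite le0r => /orP[/eqP v0|v0].
  rewrite v0 mulr0 -[leRHS](expr0n _ 2) ; have [->//|uv0] := eqVneq (B u v) 0.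
  have := h (- (B u u + 1) / (B u v *+ 2)); rewrite v0 mulr0 addr0.
  rewrite -mulrnAr mulfVK ?mulrn_eq0 ?negb_or//; lra.
have := h (- B u v / B v v).
have -> : B u u + - B u v / B v v * B u v *+ 2 + (- B u v / B v v) ^+ 2 * B v v
   = (B u u * B v v - B u v ^+ 2) / B v v by field; rewrite gt_eqF.
by rewrite pmulr_lge0 ?invr_gt0// subr_ge0.
Qed.

Lemma form_cvgl u v w : B (u k - v) (u k - v) @[k --> \oo] --> 0 ->
  B (u k) w @[k --> \oo] --> B v w.
Proof.
move=> /cvgrPdist_lt uv; apply/cvgrPdist_lt => e e0.
have b0 : 0 < B w w + 1 by rewrite ltr_wpDl// B_ge0.
have := uv (e ^+ 2 / (B w w + 1)); rewrite divr_gt0 ?exprn_gt0//.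
move=> /(_ isT); apply: filterS => k /=.
rewrite sub0r normrN ger0_norm ?B_ge0// ltr_pdivlMr// => h.
rewrite -(ltr_pXn2r (_ : (0 < 2)%N)) ?nnegrE ?(ltW e0)//.
rewrite real_normK ?num_real//.
have := form_cauchy_schwarz (u k - v) w; rewrite !formE => cs.
apply: le_lt_trans h; rewrite !formE.
have := B_ge0 (u k - v); rewrite !formE; lra.
Qed.

(** The representative is the limit of a minimizing sequence of [J], whose Euler equation is
    [l = B h]. Continuity of [J] is avoided by reading an approximate Euler equation off each term
    of the sequence. *)
Lemma form_riesz (l : V -> R) (C : R) :
  (forall u v, l (u + v) = l u + l v) -> (forall a u, l (a *: u) = a * l u) ->
  (forall u, l u ^+ 2 <= C * B u u) -> exists h, forall u, l u = B h u.
Proof.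
move=> lD lZ lC.
pose J g := B g g - 2 * l g.
have Jge g : - (C ^+ 2 + 1) <= J g.
  have b0 := B_ge0 g; have lg := lC g; rewrite /J.
  suff : 2 * l g <= B g g + C ^+ 2 + 1 by lra.
  have [|l0] := lerP (l g) 0; first by nra.
  apply: ler_of_sqr; first by have := sqr_ge0 C; lra.
  suff : 4 * (C * B g g) <= (B g g + C ^+ 2 + 1) ^+ 2 by lra.
  have h1 := sqr_ge0 (B g g - C ^+ 2 - 1).
  have h2 : C * B g g <= (C ^+ 2 + 1) * B g g.
    by apply: ler_wpM2r => //; have := sqr_ge0 (C - 2^-1); lra.
  lra.
pose E := [set J g | g in [set: V]].
have E0 : E !=set0 by exists (J 0), 0.
have hE : has_inf E by split => //; exists (- (C ^+ 2 + 1)) => _ [g _ <-].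
have Jinf g : inf E <= J g by apply: ge_inf; [exact: hE.2|exists g].
have /choice[g gP] : forall m, exists g, J g < inf E + m.+1%:R^-1.
  move=> m; have [||_ [g _ <-] ?] := @inf_adherent _ E m.+1%:R^-1 => //.
  by exists g.
have [|h hP] := @B_complete g.
  move=> e e0; have e4 : 0 < e / 4 by lra.
  have [N _ NP] := near_infty_natSinv_lt (PosNum e4).
  exists N => m k Nm Nk.
  have hm := NP m Nm; have hk := NP k Nk; rewrite /= in hm hk.
  have h1 := gP m; have h2 := gP k; have h3 := Jinf (2^-1 *: (g m + g k)).
  (* Parallelogram law: J(g_m) + J(g_k) - 2 J((g_m + g_k)/2) is half of B(g_m - g_k, g_m - g_k). *)
  move: h1 h2 h3; rewrite /J !(lD,lZ,formE) (BC (g k) (g m)).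
  by move: hm hk; move: (m.+1%:R^-1) (k.+1%:R^-1) => p q /=; lra.
exists h => w; apply/eqP; rewrite -subr_eq0; apply/eqP.
have b0 : 0 < B w w + 1 by rewrite ltr_wpDl// B_ge0.
(* Moving [g m] along [w] can lower [J] by less than 1/(m+1). The step is the optimal one, except
   that [B w w + 1] replaces [B w w], which may be 0. *)
have key m : (l w - B (g m) w) ^+ 2 <= m.+1%:R^-1 * (B w w + 1).
  set x := l w - B (g m) w; rewrite -ler_pdivrMr//.
  have := Jinf (g m + (x / (B w w + 1)) *: w); have := gP m.
  rewrite /J !(lD,lZ,formE) (BC w (g m)).
  set y := x / (B w w + 1).
  have -> : x ^+ 2 / (B w w + 1) = 2 * y * x - y * (y * (B w w + 1)).
    by rewrite /y; field; rewrite gt_eqF.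
  by move: (m.+1%:R^-1) => p; rewrite /x; have := sqr_ge0 y; rewrite expr2; lra.
have c1 : (l w - B (g m) w) ^+ 2 @[m --> \oo] --> (l w - B h w) ^+ 2.
  have c : l w - B (g m) w @[m --> \oo] --> l w - B h w.
    by apply: cvgB; [exact: cvg_cst|exact: form_cvgl].
  by under eq_fun do rewrite expr2; rewrite expr2; exact: cvgM.
have c2 : m.+1%:R^-1 * (B w w + 1) @[m --> \oo] --> 0 * (B w w + 1).
  apply: cvgM; [|exact: cvg_cst].
  exact: cvg_harmonic.
have : (l w - B h w) ^+ 2 <= 0 * (B w w + 1).
  rewrite -(cvg_lim _ c1)// -(cvg_lim _ c2)//; apply: ler_lim.
  - by apply/cvg_ex; eexists; exact: c1.
  - by apply/cvg_ex; eexists; exact: c2.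
  - by near=> m; exact: key.
rewrite mul0r => le0; apply/eqP; rewrite -sqrf_eq0; apply/eqP/le_anti.
by rewrite le0 sqr_ge0.
Unshelve. all: by end_near. Qed.

Lemma ultra_bounded_cvg (U : set_system nat) (a : nat -> R) (M : R) :
  UltraFilter U -> (forall k, `|a k| <= M) ->
  exists l : R, a @ U --> l.
Proof.
move=> UU aM.
have UP := @ultra_proper _ _ UU.
have aI : (a @ U) `[- M, M]%classic.
  suff -> : (a @ U) `[- M, M]%classic = U setT by exact: filterT.
  congr U; apply/seteqP; split => // k _.
  by rewrite /= in_itv/= -ler_norml.
have [l [lM cl]] := @segment_compact R (- M) M (a @ U) _ aI.
exists l.
move=> A lA; have [//|nA] := in_ultra_setVsetC (a @^-1` A) UU.
by have [y [nAy Ay]] := cl (~` A) A nA lA.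
Qed.

(** Along an ultrafilter finer than \oo the limits of B (u k) w exist for all w at once and are
    represented by some h; this replaces a diagonal extraction and requires no separability. A
    genuine subsequence is then picked greedily: each new u (s i) - h is almost orthogonal to all
    the earlier ones. *)
Lemma form_greedy_subsequence (M : R) (u : nat -> V) :
  (forall k, B (u k) (u k) <= M) ->
  exists (h : V) (s : nat -> nat),
    (forall i j, (j < i)%N -> (s j < s i)%N /\
       `|B (u (s i) - h) (u (s j) - h)| <= (2 ^+ i * i.+1%:R)^-1).
Proof.
move=> uM.
have M0 : 0 <= M by apply: le_trans (uM 0); exact: B_ge0.
have [U [UU sU]] := @ultraFilterLemma nat \oo _.
have UP := @ultra_proper _ _ UU.
have bnd w k : `|B (u k) w| <= M + B w w + 1.
  have := form_cauchy_schwarz (u k) w; have := uM k; have := B_ge0 w.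
  have := B_ge0 (u k) => b0 w0 kM cs.
  apply: ler_of_sqr; first by lra.
  by rewrite real_normK ?num_real//; nra.
have /choice[l lP] : forall w, exists l : R, B (u k) w @[k --> U] --> l.
  by move=> w; exact: ultra_bounded_cvg UU (bnd w).
have lC w : l w ^+ 2 <= M * B w w.
  have c1 : B (u k) w ^+ 2 @[k --> U] --> l w ^+ 2 by under eq_fun do rewrite expr2; rewrite expr2; apply: cvgM; exact: (lP w).
  rewrite -(cvg_lim _ c1)//; apply: limr_le; first by apply/cvg_ex; eexists; exact: c1.
  near=> k; apply: le_trans (form_cauchy_schwarz _ _) _.
  by apply: ler_wpM2r => //; exact: uM.
have lD v w : l (v + w) = l v + l w.
  have c1 : B (u k) v + B (u k) w @[k --> U] --> l v + l w.
    exact: (cvgD (lP v) (lP w)).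
  have c2 := lP (v + w).
  rewrite (_ : (fun k => _) = (fun k => B (u k) v + B (u k) w)) in c2.
    exact: cvg_unique c2 c1.
  by apply/funext => k; rewrite formDr.
have lZ a v : l (a *: v) = a * l v.
  have c1 : a * B (u k) v @[k --> U] --> a * l v.
    exact: (cvgM (cvg_cst a) (lP v)).
  have c2 := lP (a *: v).
  rewrite (_ : (fun k => _) = (fun k => a * B (u k) v)) in c2.
    exact: cvg_unique c2 c1.
  by apply/funext => k; rewrite formZr.
have [h hP] := form_riesz lD lZ lC.
have near_sel (t : seq nat) (e : R) : 0 < e -> \forall k \near U,
    forall j, j \in t -> (j < k)%N /\ `|B (u k - h) (u j - h)| <= e.
  move=> e0; elim: t => [|i t t0]; first by apply: filterE.
  have c0 := lP (u i - h); rewrite hP in c0.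
  move/cvgrPdist_le : c0 => /(_ e e0) c0.
  have i0 : \forall k \near U, (i < k)%N by apply: sU; exact: nbhs_infty_gt.
  near=> k => j; rewrite inE => /orP[/eqP ->|jt]; last by apply: (near t0 k).
  split; first exact: (near i0 k).
  by rewrite BD formNl distrC; exact: (near c0 k).
have sel (t : seq nat) : exists k, forall j, j \in t -> (j < k)%N /\
    `|B (u k - h) (u j - h)| <= (2 ^+ size t * (size t).+1%:R)^-1.
  by apply: (@filter_ex _ U); apply: near_sel; rewrite invr_gt0 mulr_gt0// exprn_gt0.
have /choice[f fP] := sel.
(* [st i] lists the first i chosen indices; its size is i, which turns the tolerance of [sel] into
   the one of the statement. *)
pose st := fix st i := if i is i'.+1 then rcons (st i') (f (st i')) else [::].
have sst i : size (st i) = i by elim: i => //= i IH; rewrite size_rcons IH.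
have mst i j : (j < i)%N -> f (st j) \in st i.
  elim: i => //= i IH; rewrite ltnS leq_eqVlt => /orP[/eqP ->|/IH h'].
    by rewrite mem_rcons mem_head.
  by rewrite mem_rcons inE h' orbT.
exists h, (f \o st) => i j ji /=.
by have := fP _ _ (mst _ _ ji); rewrite sst.
Unshelve. all: end_near. Qed.

(* Bessel's inequality for an almost orthogonal sequence. *)
Lemma form_almost_orthogonal_cvg0 (M : R) (e : nat -> V) (w : V) :
  (forall i, B (e i) (e i) <= M) ->
  (forall i j, (j < i)%N -> `|B (e i) (e j)| <= (2 ^+ i * i.+1%:R)^-1) ->
  B (e i) w @[i --> \oo] --> 0.
Proof.
move=> eM eo.
have M0 : 0 <= M by apply: le_trans (eM 0); exact: B_ge0.
have w0 := B_ge0 w.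
pose c i := B (e i) w; pose K := M + B w w + 1.
have K0 : 0 <= K by rewrite /K !addr_ge0.
have cK i : `|c i| <= K.
  have := form_cauchy_schwarz (e i) w; have := eM i; have := B_ge0 (e i).
  move=> b0 kM cs; apply: ler_of_sqr => //.
  rewrite real_normK ?num_real//; apply: le_trans cs _.
  apply: (le_trans (ler_wpM2r w0 kM)).
  by have := mulr_ge0 M0 w0; rewrite /K; nra.
pose S N := \sum_(i < N) c i ^+ 2.
pose W N := \sum_(i < N) c i *: e i.
have WE N : B (W N) w = S N.
  rewrite /W /S; elim: N => [|N IH]; first by rewrite !big_ord0 -(scale0r 0) BZ mul0r.
  by rewrite !big_ord_recr/= BD IH BZ -expr2.
have We N m : (N <= m)%N -> `|B (W N) (e m)| <= N%:R * K * (2 ^+ m * m.+1%:R)^-1.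
  elim: N => [|N IH] Nm.
    by rewrite /W big_ord0 -(scale0r 0) BZ !mul0r normr0.
  rewrite /W big_ord_recr/= BD BZ (le_trans (ler_normD _ _))//.
  rewrite -natr1 mulrDl mul1r mulrDl lerD//; first exact: IH (ltnW _).
  by rewrite normrM ler_pM// BC eo.
(* The diagonal terms give M S_N. In the tolerance 1/(2^i (i+1)) the factor i+1 absorbs the number
   of cross terms with earlier vectors, and the sum of the 2^-i is 2 - 2/2^N. *)
have WW N : B (W N) (W N) <= M * S N + 2 * K ^+ 2 * (2 - 2 * (2 ^+ N)^-1).
  elim: N => [|N IH].
    rewrite /W /S !big_ord0 -(scale0r 0) BZ mul0r mulr0 expr0 invr1; lra.
  rewrite /W /S !big_ord_recr/= -/(W N) -/(S N) !formE (BC (e N)).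
  have h1 : c N * B (W N) (e N) <= K ^+ 2 * (2 ^+ N)^-1.
    apply: le_trans (ler_norm _) _; rewrite normrM expr2 -mulrA ler_pM//.
    apply: le_trans (We _ _ (leqnn N)) _.
    rewrite invfM (_ : _ * _ = K / 2 ^+ N * (N%:R / N.+1%:R)); last by ring.
    rewrite -[leRHS]mulr1 ler_wpM2l ?divr_ge0 ?exprn_ge0//.
    by rewrite ler_pdivrMr// mul1r ler_nat.
  have h2 : c N * (c N * B (e N) (e N)) <= M * c N ^+ 2.
    by rewrite mulrA -expr2 mulrC ler_wpM2r// sqr_ge0.
  have -> : (2 ^+ N.+1 : R)^-1 = (2 ^+ N)^-1 / 2 by rewrite exprS invfM mulrC.
  by move: h1 h2 IH; move: (_^-1) => q; lra.
have S0 N : 0 <= S N by apply: sumr_ge0 => i _; exact: sqr_ge0.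
(* As S_N = B (W N) w, Cauchy-Schwarz bounds S_N^2 by a constant times S_N. The case S_N > 1 lets
   the additive constant 4 K^2 be absorbed into 4 K^2 S_N. *)
have SN N : S N <= (M + 4 * K ^+ 2) * B w w + 1.
  have [?|S1] := lerP (S N) 1; first by nra.
  have : B (W N) (W N) <= (M + 4 * K ^+ 2) * S N.
    apply: le_trans (WW N) _.
    have : 0 <= (2 ^+ N : R)^-1 by rewrite invr_ge0 exprn_ge0.
    by move: (_^-1) => q; have := sqr_ge0 K; nra.
  have := form_cauchy_schwarz (W N) w; rewrite WE => cs h.
  have h1 : S N ^+ 2 <= (M + 4 * K ^+ 2) * S N * B w w.
    by apply: le_trans cs _; exact: ler_wpM2r.
  suff : S N <= (M + 4 * K ^+ 2) * B w w by lra.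
  by rewrite -(ler_pM2r (_ : 0 < S N)); lra.
have cS : cvgn (series (fun i => c i ^+ 2)).
  apply: nondecreasing_is_cvgn.
    by apply/nondecreasing_seqP => n; rewrite /series/= big_nat_recr//= lerDl sqr_ge0.
  exists ((M + 4 * K ^+ 2) * B w w + 1) => _ [N _ <-].
  by rewrite /series/= big_mkord; exact: SN.
move/cvg_series_cvg_0 : cS => /cvgrPdist_lt c0; apply/cvgrPdist_lt => d d0.
have := c0 (d ^+ 2); rewrite exprn_gt0// => /(_ isT); apply: filterS => i.
rewrite !sub0r !normrN ger0_norm ?sqr_ge0// => h.
by rewrite -(ltr_pXn2r (_ : (0 < 2)%N)) ?nnegrE ?(ltW d0)// real_normK ?num_real.
Qed.

Lemma form_weak_compactness (M : R) (u : nat -> V) :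
  (forall k, B (u k) (u k) <= M) ->
  exists (h : V) (s : nat -> nat),
    (forall i j, (j < i)%N -> (s j < s i)%N) /\
    (forall w, B (u (s i)) w @[i --> \oo] --> B h w).
Proof.
move=> uM; have [h [s hs]] := form_greedy_subsequence uM.
exists h, s; split=> [i j /hs[]//|w].
have -> : (fun i => B (u (s i)) w) = (fun i => B (u (s i) - h) w + B h w).
  by apply/funext => i; rewrite BD formNl subrK.
rewrite -[X in _ --> X]add0r; apply: cvgD; last exact: cvg_cst.
apply: (@form_almost_orthogonal_cvg0 (2 * M + 2 * B h h)) => [i|i j /hs[]//].
have := B_ge0 (u (s i) + h); have := uM (s i); rewrite !formE (BC h); lra.
Qed.

End hilbert.

Lemma nneseries_geometric_le (R : realType) (a z : R) : 0 <= a -> 0 < z < 1 ->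
  (\sum_(j <oo) (a * z ^+ j)%:E <= (a / (1 - z))%:E)%E.
Proof.
move=> a0 /andP[z0 z1]; apply: lime_le.
  by apply: is_cvg_nneseries => j _ _; rewrite lee_fin mulr_ge0// exprn_ge0// ltW.
near=> m; rewrite sumEFin lee_fin.
apply: geometric_le_lim => //; by rewrite ger0_norm// ltW.
Unshelve. all: by end_near. Qed.

Lemma limn_einf_le (R : realType) (v : nat -> \bar R) (e : \bar R) :
  (\forall j \near \oo, v j <= e)%E -> (limn_einf v <= e)%E.
Proof.
move=> ve; rewrite limn_einf_lim; apply: lime_le; first exact: is_cvg_einfs.
near=> j; apply: (@le_trans _ _ (v j)); last by near: j.
by apply: ereal_inf_lbound; exists j => //=.
Unshelve. all: by end_near. Qed.

(** * Square-integrable functions: completeness and weak compactness *)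

Section square_integrable.
Context d (T : measurableType d) (R : realType).
Variable mu : {measure set T -> \bar R}.
Implicit Types f g : T -> R.

Definition sqint f : \bar R := (\int[mu]_x ((f x) ^+ 2)%:E)%E.

Definition L2 f := measurable_fun [set: T] f /\ (sqint f < +oo)%E.

Definition ip f g : R := \int[mu]_x (f x * g x).

Lemma sqint_ge0 f : (0 <= sqint f)%E.
Proof. by apply: integral_ge0 => x _; rewrite lee_fin sqr_ge0. Qed.

Lemma measurable_sqr f : measurable_fun [set: T] f ->
  measurable_fun [set: T] (fun x => ((f x) ^+ 2)%:E).
Proof. by move=> mf; apply/measurable_EFinP; exact: measurable_funX. Qed.

Lemma Lnorm2E f : ('N[mu]_(2%:E)[EFin \o f] = (sqint f) `^ 2^-1)%E.
Proof.
rewrite unlock; congr poweR; apply: eq_integral => x _ /=.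
by rewrite powR_mulrn// real_normK ?num_real.
Qed.

Lemma L2_Lfun f : L2 f <-> f \in Lfun mu 2%:E.
Proof.
rewrite inE; split.
  move=> [mf f2]; apply/andP; split; rewrite inE//=.
  by rewrite /finite_norm Lnorm2E poweR_lty.
move=> /andP[]; rewrite !inE/= /finite_norm => mf f2; split => //.
by move: f2; rewrite Lnorm2E; apply: lty_poweRy; rewrite invr_neq0.
Qed.

Lemma L2_mulr_integrable f g : L2 f -> L2 g ->
  mu.-integrable [set: T] (EFin \o (fun x => f x * g x)).
Proof.
move=> /L2_Lfun lf /L2_Lfun lg; apply/Lfun1_integrable.
exact: Lfun2_mul_Lfun1.
Qed.

Lemma L2D f g : L2 f -> L2 g -> L2 (fun x => f x + g x).
Proof.
move=> /L2_Lfun lf /L2_Lfun lg; apply/L2_Lfun.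
have p1 : (1 <= 2%:E :> \bar R)%E by rewrite lee_fin ler1n.
exact: ((Lfun_addr_closed mu p1).2 _ _ lf lg).
Qed.

Lemma L2Z a f : L2 f -> L2 (fun x => a * f x).
Proof.
move=> [mf f2]; split; first exact: measurable_funM.
rewrite /sqint; under eq_integral do rewrite exprMn EFinM.
rewrite ge0_integralZl//.
- by rewrite lte_mul_pinfty// lee_fin sqr_ge0.
- exact: measurable_sqr.
- by move=> x _; rewrite lee_fin sqr_ge0.
- by rewrite lee_fin sqr_ge0.
Qed.

Lemma L2B f g : L2 f -> L2 g -> L2 (fun x => f x - g x).
Proof.
move=> lf lg; have -> : (fun x => f x - g x) = (fun x => f x + (-1) * g x).
  by apply/funext => x; rewrite mulN1r.
by apply: L2D => //; exact: L2Z.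
Qed.

Lemma ipC f g : ip f g = ip g f.
Proof. by apply: eq_Rintegral => x _; rewrite mulrC. Qed.

Lemma ipDl f g h : L2 f -> L2 g -> L2 h ->
  ip (fun x => f x + g x) h = ip f h + ip g h.
Proof.
move=> lf lg lh; rewrite -RintegralD//; last 2 first.
- exact: L2_mulr_integrable.
- exact: L2_mulr_integrable.
by apply: eq_Rintegral => x _; rewrite mulrDl.
Qed.

Lemma ipZl a f g : L2 f -> L2 g -> ip (fun x => a * f x) g = a * ip f g.
Proof.
move=> lf lg; rewrite -RintegralZl//; last exact: L2_mulr_integrable.
by apply: eq_Rintegral => x _; rewrite mulrA.
Qed.

Lemma ipBl f g h : L2 f -> L2 g -> L2 h ->
  ip (fun x => f x - g x) h = ip f h - ip g h.
Proof.
move=> lf lg lh; rewrite -RintegralB//; last 2 first.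
- exact: L2_mulr_integrable.
- exact: L2_mulr_integrable.
by apply: eq_Rintegral => x _; rewrite mulrBl.
Qed.

Lemma ip_ge0 f : 0 <= ip f f.
Proof. by apply: Rintegral_ge0 => x _; rewrite -expr2 sqr_ge0. Qed.

Lemma sqint_ip f : L2 f -> sqint f = (ip f f)%:E.
Proof.
move=> lf; have := lf.2; rewrite /ip /Rintegral.
under eq_integral do rewrite -expr2.
by move=> foo; rewrite fineK// ge0_fin_numE// sqint_ge0.
Qed.

(** Riesz-Fischer, with squares only. Along a subsequence whose increments have squared norm below
    16^-j, the series G of 4^j |f_(j+1) - f_j|^2 is integrable. Where G is finite, the increments
    are at most sqrt(G) 2^-j, so f_j converges there. *)
Lemma L2_complete (u : nat -> T -> R) : (forall k, L2 (u k)) ->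
  (forall e : R, 0 < e -> exists N, forall m k, (N <= m)%N -> (N <= k)%N ->
    (sqint (fun x => u m x - u k x)%R < e%:E)%E) ->
  exists f, L2 f /\ forall e : R, 0 < e -> exists N, forall k, (N <= k)%N ->
    (sqint (fun x => u k x - f x)%R <= e%:E)%E.
Proof.
move=> Lu Cu.
have /choice[N NP] : forall j, exists N, forall m k, (N <= m)%N -> (N <= k)%N ->
    (sqint (fun x => u m x - u k x)%R < ((16^-1) ^+ j)%:E)%E.
  by move=> j; apply: Cu; rewrite exprn_gt0.
(* Summing the thresholds makes [n] nondecreasing with n j >= N j; the successors give n j >= j. *)
pose n j := (\sum_(i < j.+1) (N i).+1)%N.
have nN j : (N j <= n j)%N.
  by rewrite /n big_ord_recr/= (leq_trans (leqnSn _))// leq_addl.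
have nS j : (n j <= n j.+1)%N by rewrite /n [leqRHS]big_ord_recr/= leq_addr.
have nj j : (j <= n j)%N.
  elim: j => // j IH; rewrite /n big_ord_recr/= -/(n j) addnS ltnS.
  exact: leq_trans IH (leq_addr _ _).
pose f j := u (n j).
have mf j : measurable_fun [set: T] (f j) by exact: (Lu _).1.
pose t j x : \bar R := (4 ^+ j * (f j.+1 x - f j x) ^+ 2)%:E.
have mt j : measurable_fun [set: T] (t j).
  apply/measurable_EFinP; apply: measurable_funM => //.
  by apply: measurable_funX; exact: measurable_funB.
have t0 j x : (0 <= t j x)%E by rewrite /t lee_fin mulr_ge0 ?sqr_ge0 ?exprn_ge0.
pose G x := (\sum_(j <oo) t j x)%E.
have mG : measurable_fun [set: T] G.
  by apply: ge0_emeasurable_sum.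
have G0 x : (0 <= G x)%E by apply: nneseries_ge0.
have iG : (\int[mu]_x G x < +oo)%E.
  rewrite integral_nneseries//.
  apply: (@le_lt_trans _ _ (\sum_(j <oo) (1 * (2^-1) ^+ j)%:E)%E).
    apply: lee_nneseries => [j _ _|j _].
      by apply: integral_ge0.
    rewrite /t; under eq_integral do rewrite EFinM.
    rewrite ge0_integralZl_EFin//; last 2 first.
    - by move=> x _; rewrite lee_fin sqr_ge0.
    - by apply: measurable_sqr; exact: measurable_funB.
    apply: (@le_trans _ _ ((4 ^+ j)%:E * ((16^-1) ^+ j)%:E)%E).
      rewrite lee_wpmul2l ?lee_fin ?exprn_ge0//; apply: ltW; apply: NP => //.
      exact: leq_trans (nN j) (nS j).
    rewrite -EFinM lee_fin mul1r -exprMn.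
    by rewrite lerXn2r ?nnegrE//; lra.
  apply: le_lt_trans (ltry (1 / (1 - 2^-1))).
  by apply: nneseries_geometric_le => //; lra.
pose E := [set x | (G x < +oo)%E].
have mE : measurable E.
  rewrite /E -[X in measurable X]setTI.
  by apply: (@measurable_lte _ T R _ measurableT G (cst +oo%E)) => //; exact: measurable_cst.
have nE : mu (~` E) = 0.
  have iGT : mu.-integrable [set: T] G.
    apply/integrableP; split => //.
    by under eq_integral do rewrite gee0_abs//.
  have [A [mA A0 sA]] := integrable_ae measurableT iGT.
  apply: (subset_measure0 _ mA) => //; first exact: measurableC.
  move=> x nEx; apply: sA => /= /(_ I) Gfin; apply: nEx.
  by rewrite /E/= -ge0_fin_numE.
have fG j x : E x -> `|f j.+1 x - f j x| <= Num.sqrt (fine (G x)) * (2^-1) ^+ j.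
  move=> Ex; have Gfin : G x \is a fin_num by rewrite ge0_fin_numE.
  have : (t j x <= G x)%E.
    apply: (@le_trans _ _ (\sum_(0 <= i < j.+1) t i x)%E).
      by rewrite big_nat_recr//= leeDr// sume_ge0.
    by apply: nneseries_lim_ge.
  have G0' : 0 <= fine (G x) by exact: fine_ge0.
  rewrite -[G x]fineK// /t lee_fin => h.
  apply: ler_of_sqr; first by rewrite mulr_ge0 ?sqrtr_ge0 ?exprn_ge0.
  rewrite real_normK ?num_real// exprMn sqr_sqrtr//.
  have e4 : (2^-1) ^+ 2 = 4^-1 :> R by field.
  by rewrite -exprM mulnC exprM e4 exprVn ler_pdivlMr ?exprn_gt0// mulrC.
(* Cutting to E makes the sequence converge at every point, so that the pointwise limit is
   measurable. *)
pose g j x := f j x * \1_E x.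
have gE : forall i y, E y -> g i y = f i y.
  by move=> i y Ey; rewrite /g indicE mem_set// mulr1.
have gcv x : cvgn (g ^~ x).
  have [Ex|nEx] := pselect (E x); last first.
    rewrite (_ : g ^~ x = cst 0); first exact: is_cvg_cst.
    by apply/funext => j; rewrite /g indicE memNset// mulr0.
  rewrite (_ : g ^~ x = f ^~ x); last by apply/funext => j; rewrite gE.
  rewrite (_ : f ^~ x = (fun j => f 0 x + series (telescope (f ^~ x)) j)); last first.
    by apply/funext => j; rewrite -(eq_sum_telescope (f ^~ x)).
  apply: is_cvgD; first exact: is_cvg_cst.
  apply: normed_cvg.
  apply: (@series_le_cvg _ _ (geometric (Num.sqrt (fine (G x))) (2^-1))).
  - by move=> j; exact: normr_ge0.
  - by move=> j; rewrite geometric_ge0// sqrtr_ge0.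
  - by move=> j; exact: fG.
  - by apply: is_cvg_geometric_series; rewrite ger0_norm//; lra.
pose l x := lim (g ^~ x @ \oo).
have ml : measurable_fun [set: T] l.
  apply: (@measurable_fun_cvg _ _ _ _ g) => // m.
  by apply: measurable_funM.
(* Fatou's lemma in j, on the set E of full measure. *)
have key k (e : R) : (\forall j \near \oo,
    sqint (fun x => u k x - f j x)%R <= e%:E)%E ->
    (sqint (fun x => u k x - l x)%R <= e%:E)%E.
  move=> He.
  have mkl : measurable_fun [set: T] (fun x => u k x - l x).
    by apply: measurable_funB => //; exact: (Lu k).1.
  rewrite /sqint (@ge0_negligible_integral _ _ _ mu setT (~` E))//; last 3 first.
  - exact: measurableC.
  - exact: measurable_sqr.
  - by move=> x _; rewrite lee_fin sqr_ge0.
  rewrite setTD setCK.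
  apply: (@le_trans _ _
    (\int[mu]_(x in E) limn_einf (fun j => ((u k x - f j x) ^+ 2)%:E))%E).
    rewrite le_eqVlt; apply/orP; left; apply/eqP.
    apply: eq_integral => x /[!inE] Ex; apply/esym.
    suff fl : ((u k x - f j x) ^+ 2)%:E @[j --> \oo] --> ((u k x - l x) ^+ 2)%:E.
      exact: (cvg_limn_einf_sup fl).1.
    apply: cvg_EFin; first exact: nearW.
    have c : u k x - f j x @[j --> \oo] --> u k x - l x.
      apply: cvgB; first exact: cvg_cst.
      have -> : (fun j => f j x) = g ^~ x by apply/funext => j; rewrite gE.
      exact: gcv.
    by under eq_fun do rewrite expr2; rewrite expr2; exact: cvgM.
  apply: le_trans; first apply: fatou => //.
  + move=> j; apply: measurable_funTS; apply: measurable_sqr.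
    by apply: measurable_funB => //; exact: (Lu k).1.
  + by move=> j x _; rewrite lee_fin sqr_ge0.
  apply: limn_einf_le; apply: filterS He => j; apply: le_trans.
  apply: ge0_subset_integral => //.
    by apply: measurable_sqr; apply: measurable_funB => //; exact: (Lu k).1.
  by move=> x _; rewrite lee_fin sqr_ge0.
have conv (e : R) : 0 < e -> exists N, forall k, (N <= k)%N ->
    (sqint (fun x => u k x - l x)%R <= e%:E)%E.
  move=> /Cu[M MP]; exists M => k Mk; apply: key.
  near=> j; apply: ltW; apply: MP => //; apply: leq_trans (nj j).
  by near: j; exact: nbhs_infty_ge.
exists l; split => //.
have [M MP] := conv 1 ltr01.
rewrite (_ : l = (fun x => u M x - (u M x - l x))); last first.
  by apply/funext => x; rewrite opprB addrCA subrr addr0.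
apply: L2B => //; split.
  by apply: measurable_funB => //; exact: (Lu M).1.
by apply: le_lt_trans (MP M (leqnn M)) _; rewrite ltry.
Unshelve. all: by end_near. Qed.

Lemma L2_weak_compactness (M : R) (u : nat -> T -> R) :
  (forall k, L2 (u k)) -> (forall k, (sqint (u k) <= M%:E)%E) ->
  exists (h : T -> R) (s : nat -> nat),
    [/\ L2 h, forall i j, (j < i)%N -> (s j < s i)%N &
    forall w, L2 w -> ip (u (s i)) w @[i --> \oo] --> ip h w].
Proof.
move=> Lu uM.
have p1 : (1 <= 2%:E :> \bar R)%E by rewrite lee_fin ler1n.
(* The elements of V are functions, not classes modulo null sets, so the form is only semidefinite
   here. *)
pose V := LfunType mu p1.
have LV (f : V) : L2 f by apply/L2_Lfun; exact: LfunP.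
pose B (f g : V) := ip f g.
have BC (f g : V) : B f g = B g f by exact: ipC.
have VD (f g : V) : (f + g : V) = (fun x => f x + g x) :> (T -> R) by [].
have VZ a (f : V) : (a *: f : V) = (fun x => a * f x) :> (T -> R) by [].
have BD (f g h : V) : B (f + g) h = B f h + B g h.
  by rewrite /B VD; apply: ipDl; exact: LV.
have BZ a (f g : V) : B (a *: f) g = a * B f g.
  by rewrite /B VZ; apply: ipZl; exact: LV.
have B0 (f : V) : 0 <= B f f by exact: ip_ge0.
have toV f : L2 f -> exists v : V, v = f :> (T -> R).
  by move=> /L2_Lfun lf; exists (Lfun_Sub p1 lf).
have Bcomplete (v : nat -> V) : (forall e : R, 0 < e -> exists N, forall m k,
    (N <= m)%N -> (N <= k)%N -> B (v m - v k) (v m - v k) < e) ->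
    exists w, B (v k - w) (v k - w) @[k --> \oo] --> 0.
  move=> Cv; have [k|e e0|f [Lf fP]] := @L2_complete (fun k => v k).
  - exact: LV.
  - have [N NP] := Cv e e0; exists N => m k Nm Nk.
    by have := sqint_ip (LV (v m - v k)) => /= ->; rewrite lte_fin NP.
  - have [w wf] := toV _ Lf; exists w; apply/cvgrPdist_le => e e0.
    have [N NP] := fP e e0; near=> k.
    rewrite sub0r normrN ger0_norm; last exact: B0.
    rewrite -lee_fin.
    have -> : (B (v k - w) (v k - w))%:E = sqint (fun x => v k x - f x).
      by rewrite -wf; apply/esym; exact: (sqint_ip (LV (v k - w))).
    by apply: NP; near: k; exact: nbhs_infty_ge.
have /choice[v vu] : forall k, exists v : V, v = u k :> (T -> R).
  by move=> k; exact: toV.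
have [|h [s [sP hP]]] := @form_weak_compactness _ _ _ BC BD BZ B0 Bcomplete M v.
  by move=> k; rewrite -lee_fin /B -sqint_ip// vu.
exists h, s; split => // w Lw; have [w' <-] := toV _ Lw.
by have := hP w'; rewrite /B; under eq_fun do rewrite vu.
Unshelve. all: by end_near. Qed.

End square_integrable.

(** * The Brezis-Lieb inequality and a Schur test *)

(** With c such that (1 + c)^r = 1 + eta, either b <= c a and the first term suffices, or a < b / c
    and the second one does. *)
Lemma powRD_le (R : realType) (r eta : R) : 0 < r -> 0 < eta ->
  exists2 C : R, 0 < C & forall a b : R, 0 <= a -> 0 <= b ->
    (a + b) `^ r <= (1 + eta) * a `^ r + C * b `^ r.
Proof.
move=> r0 eta0; pose c := (1 + eta) `^ r^-1 - 1.
have c1 : 1 < (1 + eta) `^ r^-1.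
  rewrite -[ltLHS](_ : 1 `^ r^-1 = 1); last by rewrite powR1.
  by apply: gt0_ltr_powR; rewrite ?invr_gt0 ?nnegrE//; lra.
have c0 : 0 < c by rewrite subr_gt0.
exists ((1 + c^-1) `^ r); first by rewrite powR_gt0// addr_gt0// invr_gt0.
move=> a b a0 b0; have [bc|cb] := lerP b (c * a).
  apply: (@le_trans _ _ ((1 + eta) * a `^ r)); last first.
    by rewrite lerDl mulr_ge0 ?powR_ge0.
  have -> : (1 + eta) * a `^ r = (((1 + eta) `^ r^-1) * a) `^ r.
    by rewrite powRM ?powR_ge0// -powRrM mulVf ?gt_eqF// powRr1//; lra.
  apply: ge0_ler_powR; rewrite ?nnegrE ?addr_ge0 ?mulr_ge0 ?powR_ge0 ?(ltW r0)//.
  by move: bc; rewrite /c; lra.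
apply: (@le_trans _ _ ((1 + c^-1) `^ r * b `^ r)); last first.
  by rewrite lerDr mulr_ge0 ?powR_ge0//; lra.
rewrite -powRM//; last by rewrite addr_ge0// invr_ge0 ltW.
have c10 : 0 <= 1 + c^-1 by rewrite addr_ge0// invr_ge0 ltW.
apply: ge0_ler_powR; rewrite ?nnegrE ?addr_ge0 ?mulr_ge0 ?(ltW r0)//.
rewrite mulrDl mul1r addrC lerD2l mulrC ler_pdivlMr// mulrC.
exact: ltW.
Qed.

Lemma lee_poweR (R : realType) (r : R) (x y : \bar R) :
  0 <= r -> (0 <= x -> x <= y -> x `^ r <= y `^ r)%E.
Proof.
move=> r0 x0 xy; apply: gt0_ler_poweR => //; rewrite in_itv/= ?x0 leey// andbT.
exact: le_trans xy.
Qed.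

Section nonneg_integral.
Context d (T : measurableType d) (R : realType).
Variable mu : {measure set T -> \bar R}.
Implicit Types f g : T -> \bar R.
Local Open Scope ereal_scope.

Lemma ge0_intD f g : measurable_fun [set: T] f -> measurable_fun [set: T] g ->
  (forall x, 0 <= f x) -> (forall x, 0 <= g x) ->
  \int[mu]_x (f x + g x) = \int[mu]_x f x + \int[mu]_x g x.
Proof. by move=> mf mg f0 g0; rewrite ge0_integralD. Qed.

Lemma ge0_intZ (c : R) f : measurable_fun [set: T] f ->
  (0 <= c)%R -> (forall x, 0 <= f x) ->
  \int[mu]_x (c%:E * f x) = c%:E * \int[mu]_x f x.
Proof. by move=> mf c0 f0; rewrite ge0_integralZl_EFin. Qed.

Lemma ge0_int_le f g : measurable_fun [set: T] f -> measurable_fun [set: T] g ->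
  (forall x, 0 <= f x) -> (forall x, f x <= g x) ->
  \int[mu]_x f x <= \int[mu]_x g x.
Proof. by move=> mf mg f0 fg; apply: ge0_le_integral. Qed.

End nonneg_integral.

Section brezis_lieb.
Context d (T : measurableType d) (R : realType).
Variable mu : {measure set T -> \bar R}.

(** The positive part [w k] of |a_k|^r - (1 + eta) |a_k - a|^r - |a|^r is at most C |a|^r and tends
    to 0 pointwise, so dominated convergence applies. Being one-sided, the inequality asks for
    integrability of the limit alone. *)
Lemma brezis_lieb_le (r eta e : R) (a_ : nat -> T -> R) (a : T -> R) :
  0 < r -> 0 < eta -> 0 < e ->
  (forall k, measurable_fun [set: T] (a_ k)) ->
  (forall x, a_ ^~ x @ \oo --> a x) ->
  (\int[mu]_x (`|a x| `^ r)%:E < +oo)%E ->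
  \forall k \near \oo,
  (\int[mu]_x (`|a_ k x| `^ r)%:E <=
   (1 + eta)%:E * \int[mu]_x (`|a_ k x - a x| `^ r)%:E
   + \int[mu]_x (`|a x| `^ r)%:E + e%:E)%E.
Proof.
move=> r0 eta0 e0 ma_ aa ia.
have ma : measurable_fun [set: T] a by apply: measurable_fun_cvg ma_ _ => x _.
have [C C0 CP] := powRD_le r0 eta0.
have mpow (f : T -> R) : measurable_fun [set: T] f ->
    measurable_fun [set: T] (fun x => `|f x| `^ r).
  move=> mf; apply: (measurableT_comp (measurable_powR _)).
  exact: measurableT_comp.
pose w k x : R := Num.max 0
  (`|a_ k x| `^ r - (1 + eta) * `|a_ k x - a x| `^ r - `|a x| `^ r).
have mw k : measurable_fun [set: T] (w k).
  apply: measurable_maxr => //; apply: measurable_funB; last exact: mpow.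
  apply: measurable_funB; first exact: mpow.
  by apply: measurable_funM => //; apply: mpow; exact: measurable_funB.
have w0 k x : 0 <= w k x by rewrite le_max lexx.
have wle k x : w k x <= C * `|a x| `^ r.
  rewrite ge_max mulr_ge0 ?powR_ge0 ?(ltW C0)//=.
  have h1 : `|a_ k x| `^ r <= (`|a_ k x - a x| + `|a x|) `^ r.
    apply: ge0_ler_powR; rewrite ?nnegrE ?addr_ge0 ?(ltW r0)//.
    by rewrite -[in leLHS](subrK (a x) (a_ k x)) ler_normD.
  have h2 := CP _ _ (normr_ge0 (a_ k x - a x)) (normr_ge0 (a x)).
  have h3 := powR_ge0 `|a x| r.
  lra.
have wcv x : w k x @[k --> \oo] --> (0 : R).
  apply/cvgrPdist_le => d0 d0_gt0.
  have p0 := powR_ge0 `|a x| r.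
  (* Now the roles are exchanged: the factor close to 1 falls on |a x|^r and the large constant on
     |a_k x - a x|^r, which tends to 0. Each of the two errors is at most d0/2. *)
  have eta'0 : 0 < d0 / 2 / (`|a x| `^ r + 1) by rewrite !divr_gt0//; lra.
  have [C' C'0 C'P] := powRD_le r0 eta'0.
  have z0 : 0 < (d0 / 2 / C') `^ r^-1 by rewrite powR_gt0// !divr_gt0.
  have /cvgrPdist_le/(_ _ z0) := aa x; apply: filterS => k.
  rewrite distrC => akz; rewrite sub0r normrN ger0_norm//.
  have h2 : C' * `|a_ k x - a x| `^ r <= d0 / 2.
    rewrite mulrC -ler_pdivlMr//.
    have -> : d0 / 2 / C' = ((d0 / 2 / C') `^ r^-1) `^ r.
      by rewrite -powRrM mulVf ?gt_eqF// powRr1// ltW// !divr_gt0.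
    by apply: ge0_ler_powR; rewrite ?nnegrE ?powR_ge0 ?(ltW r0).
  have h1 : `|a_ k x| `^ r <= (`|a x| + `|a_ k x - a x|) `^ r.
    apply: ge0_ler_powR; rewrite ?nnegrE ?addr_ge0 ?(ltW r0)//.
    by rewrite -[in leLHS](subrKC (a x) (a_ k x)) ler_normD.
  have h3 := C'P _ _ (normr_ge0 (a x)) (normr_ge0 (a_ k x - a x)).
  have h4 : d0 / 2 / (`|a x| `^ r + 1) * `|a x| `^ r <= d0 / 2.
    rewrite mulrAC ler_pdivrMr; last by lra.
    by rewrite ler_wpM2l//; lra.
  have h5 : 0 <= (1 + eta) * `|a_ k x - a x| `^ r.
    by rewrite mulr_ge0 ?powR_ge0//; lra.
  rewrite /w ge_max ltW//=.
  move: h1 h2 h3 h4 h5; rewrite mulrDl mul1r.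
  lra.
have wint : (\int[mu]_x (w k x)%:E)%E @[k --> \oo] --> 0%E.
  pose W k x : \bar R := (w k x)%:E.
  pose g x : \bar R := (C * `|a x| `^ r)%:E.
  have mW k : measurable_fun [set: T] (W k) by apply/measurable_EFinP.
  have W_cvg : {ae mu, forall x, [set: T] x -> W ^~ x @ \oo --> cst 0%E x}.
    by apply: aeW => x _; apply: cvg_EFin; [exact: nearW|exact: wcv].
  have ig : mu.-integrable [set: T] g.
    apply/integrableP; split.
      by apply/measurable_EFinP; apply: measurable_funM => //; exact: mpow.
    rewrite /g; under eq_integral do
      rewrite gee0_abs ?lee_fin ?mulr_ge0 ?powR_ge0 ?(ltW C0)// EFinM.
    rewrite ge0_integralZl_EFin ?(ltW C0)//.
    - by rewrite lte_mul_pinfty// lee_fin ltW.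
    - by apply/measurable_EFinP; exact: mpow.
  have W_g : {ae mu, forall x k, [set: T] x -> (`|W k x| <= g x)%E}.
    by apply: aeW => x k _; rewrite gee0_abs /W ?lee_fin.
  have [_ _] := dominated_convergence measurableT mW (measurable_cst _) W_cvg ig W_g.
  by rewrite integral0.
have : \forall k \near \oo, (\int[mu]_x (w k x)%:E < e%:E)%E.
  by have := wint _ (@open_ereal_lt' R 0%E e%:E _); apply; rewrite lte_fin.
apply: filterS => k /ltW wk.
have mB : measurable_fun [set: T] (fun x => `|a_ k x - a x| `^ r).
  by apply: mpow; exact: measurable_funB.
have mA := mpow _ ma.
apply: (@le_trans _ _ (\int[mu]_x (((1 + eta)%:E * (`|a_ k x - a x| `^ r)%:E
   + (`|a x| `^ r)%:E) + (w k x)%:E))%E).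
  apply: ge0_le_integral => //.
  - by apply/measurable_EFinP; exact: mpow.
  - apply: emeasurable_funD; last exact/measurable_EFinP.
    apply: emeasurable_funD; last exact/measurable_EFinP.
    by apply: emeasurable_funM; [exact: measurable_cst|exact/measurable_EFinP].
  - move=> x _; rewrite -!(EFinM,EFinD) lee_fin.
    have : `|a_ k x| `^ r - (1 + eta) * `|a_ k x - a x| `^ r - `|a x| `^ r <= w k x.
      by rewrite /w le_max lexx orbT.
    by lra.
have e1 : 0 <= 1 + eta by lra.
rewrite ge0_integralD//; last 4 first.
- by move=> x _; rewrite -!(EFinM,EFinD) lee_fin addr_ge0 ?mulr_ge0 ?powR_ge0.
- apply: emeasurable_funD; last exact/measurable_EFinP.
  by apply: emeasurable_funM; [exact: measurable_cst|exact/measurable_EFinP].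
- by move=> x _; rewrite lee_fin.
- exact/measurable_EFinP.
rewrite ge0_integralD//; last 3 first.
- by move=> x _; rewrite -!(EFinM,EFinD) lee_fin mulr_ge0 ?powR_ge0.
- by apply: emeasurable_funM; [exact: measurable_cst|exact/measurable_EFinP].
- exact/measurable_EFinP.
rewrite ge0_integralZl_EFin//; last first.
- exact/measurable_EFinP.
by rewrite leeD2l.
Qed.

End brezis_lieb.

(** * Integral operators with nonnegative kernels, and the Schur test *)

Section schur.
Context d (T : measurableType d) (R : realType).
Variable mu : {sigma_finite_measure set T -> \bar R}.

Lemma ge0_hoelder (F G : T -> R) (a : R) : 0 < a < 1 ->
  measurable_fun [set: T] F -> measurable_fun [set: T] G ->
  (forall x, 0 <= F x) -> (forall x, 0 <= G x) ->
  (\int[mu]_x (F x `^ a * G x `^ (1 - a))%:E <=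
   (\int[mu]_x (F x)%:E) `^ a * (\int[mu]_x (G x)%:E) `^ (1 - a))%E.
Proof.
move=> /andP[a0 a1] mF mG F0 G0.
have a1' : 0 < 1 - a by lra.
have := @hoelder _ _ _ mu (fun x => F x `^ a) (fun x => G x `^ (1 - a)) a^-1 (1 - a)^-1.
rewrite !invr_gt0 !invrK subrKC.
move=> /(_ (measurableT_comp (measurable_powR _) mF)
           (measurableT_comp (measurable_powR _) mG) a0 a1' erefl).
rewrite Lnorm1 unlock !invrK.
under eq_integral => x _ do rewrite /= ger0_norm ?mulr_ge0 ?powR_ge0//.
under [in X in (_ <= X * _ -> _)%E]eq_integral => x _ do
  rewrite /= ger0_norm ?powR_ge0// -powRrM mulfV ?gt_eqF// powRr1//.
under [in X in (_ <= _ * X -> _)%E]eq_integral => x _ do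
  rewrite /= ger0_norm ?powR_ge0// -powRrM mulfV ?gt_eqF// powRr1//.
by [].
Qed.

Definition op (k : T -> T -> R) (u : T -> R) (x : T) : \bar R :=
  (\int[mu]_y (k x y * u y)%:E)%E.

Definition energy (r : R) (k : T -> T -> R) (u : T -> R) : \bar R :=
  (\int[mu]_x (op k u x `^ r))%E.

Definition kern (k : T -> T -> R) :=
  measurable_fun [set: T * T] (fun z => k z.1 z.2) /\ forall x y, 0 <= k x y.

Definition nng (u : T -> R) := measurable_fun [set: T] u /\ forall x, 0 <= u x.

Lemma measurable_kern k x : kern k -> measurable_fun [set: T] (k x).
Proof.
move=> [mk _].
exact: (measurableT_comp mk (pair1_measurable x)).
Qed.

Lemma measurable_kern_mul k u : kern k -> nng u ->
  measurable_fun [set: T * T] (fun z => k z.1 z.2 * u z.2).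
Proof.
move=> [mk _] [mu0 _]; apply: measurable_funM => //.
exact: (measurableT_comp mu0 measurable_snd).
Qed.

Lemma measurable_kernu k u x : kern k -> nng u ->
  measurable_fun [set: T] (fun y => (k x y * u y)%:E).
Proof.
move=> kk [mu0 _]; apply/measurable_EFinP; apply: measurable_funM => //.
exact: measurable_kern.
Qed.

Lemma kernu_ge0 k u x y : kern k -> nng u -> (0 <= (k x y * u y)%:E)%E.
Proof. by move=> [_ k0] [_ u0]; rewrite lee_fin mulr_ge0. Qed.

Lemma op_ge0 k u x : kern k -> nng u -> (0 <= op k u x)%E.
Proof. by move=> kk uu; apply: integral_ge0 => y _; exact: kernu_ge0. Qed.

Lemma measurable_op k u : kern k -> nng u -> measurable_fun [set: T] (op k u).
Proof.
move=> kk uu.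
apply: (@measurable_fun_fubini_tonelli_F _ _ T T R mu (fun z => (k z.1 z.2 * u z.2)%:E)).
  by apply/measurable_EFinP; exact: measurable_kern_mul.
by move=> z; exact: kernu_ge0.
Qed.

Lemma measurable_op_pow r k u : kern k -> nng u ->
  measurable_fun [set: T] (fun x => (op k u x `^ r)%E).
Proof.
by move=> kk uu; apply: (measurableT_comp (measurable_poweR _)); exact: measurable_op.
Qed.

Lemma op_le k k' u u' x : kern k -> kern k' -> nng u -> nng u' ->
  (forall y, k x y * u y <= k' x y * u' y) -> (op k u x <= op k' u' x)%E.
Proof.
move=> kk kk' uu uu' h; apply: ge0_int_le.
- exact: measurable_kernu.
- exact: measurable_kernu.
- by move=> y; exact: kernu_ge0.
- by move=> y; rewrite lee_fin.
Qed.

Lemma energy_le r k k' u u' : 0 <= r -> kern k -> kern k' -> nng u -> nng u' ->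
  (forall x y, k x y * u y <= k' x y * u' y) -> (energy r k u <= energy r k' u')%E.
Proof.
move=> r0 kk kk' uu uu' h; apply: ge0_int_le.
- exact: measurable_op_pow.
- exact: measurable_op_pow.
- by move=> y; exact: poweR_ge0.
- by move=> x; apply: lee_poweR => //; [exact: op_ge0|exact: op_le].
Qed.

Lemma nngZ (c : R) u : 0 <= c -> nng u -> nng (fun x => c * u x).
Proof. by move=> c0 [mu0 u0]; split=> [|x]; [exact: measurable_funM|exact: mulr_ge0]. Qed.

Lemma opZ (c : R) k u x : 0 <= c -> kern k -> nng u ->
  op k (fun x => c * u x) x = (c%:E * op k u x)%E.
Proof.
move=> c0 kk uu; rewrite -ge0_intZ//.
- by apply: eq_integral => y _; rewrite mulrCA EFinM.
- exact: measurable_kernu.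
- by move=> y; exact: kernu_ge0.
Qed.

Lemma energyZ (c r : R) k u : 0 <= c -> kern k -> nng u ->
  energy r k (fun x => c * u x) = ((c `^ r)%:E * energy r k u)%E.
Proof.
move=> c0 kk uu; rewrite -ge0_intZ.
- by apply: eq_integral => x _; rewrite opZ// poweRM ?lee_fin ?op_ge0// poweR_EFin.
- exact: measurable_op_pow.
- exact: powR_ge0.
- by move=> x; exact: poweR_ge0.
Qed.

(** The factorization of the integrand to which Cauchy-Schwarz is applied in [schur_young]. *)
Lemma schur_split (q k w u : R) : 0 <= k -> 0 <= w -> 0 <= u ->
  (k `^ q * w) `^ 2^-1 * (k `^ (2 - q) * u ^+ 2) `^ (1 - 2^-1) =
  w `^ 2^-1 * k * u.
Proof.
move=> k0 w0 u0; have -> : 1 - 2^-1 = 2^-1 :> R by field.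
have uE : (u ^+ 2) `^ 2^-1 = u by rewrite -powR_mulrn// -powRrM mulfV// powRr1.
rewrite (powRM _ (powR_ge0 k q) w0) (powRM _ (powR_ge0 k (2 - q)) (sqr_ge0 u)).
rewrite uE -!powRrM.
have kE : k `^ (q * 2^-1) * k `^ ((2 - q) * 2^-1) = k.
  rewrite -powRD; first by rewrite -mulrDl addrC subrK mulfV// powRr1.
  by rewrite -mulrDl addrC subrK mulfV// oner_eq0.
by rewrite mulrACA mulrA [in LHS]mulrAC -[X in _ = _ * X * _]kE; ring.
Qed.

(** The operator with kernel k from L^2(w mu) to L^r(w mu), conjugated to act from L^2(mu) to
    L^r(mu) through u = w^(1/2) f. *)
Definition wkern (r : R) (w : T -> R) (k : T -> T -> R) (x y : T) : R :=
  w x `^ r^-1 * w y `^ 2^-1 * k x y.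

Lemma kern_wkern r w k : nng w -> kern k -> kern (wkern r w k).
Proof.
move=> [mw w0] [mk k0]; split=> [|x y]; last by rewrite !mulr_ge0 ?powR_ge0.
apply: measurable_funM => //; apply: measurable_funM.
  exact: (measurableT_comp (measurable_powR _) (measurableT_comp mw measurable_fst)).
exact: (measurableT_comp (measurable_powR _) (measurableT_comp mw measurable_snd)).
Qed.

(** Cauchy-Schwarz separates k^q w, controlled by the row bound, from k^(2-q) u^2. As 2 - q = 2 q /
    r, Hölder with exponents 2/r and 1 - 2/r and the bound on u reduce the latter to (int k^q
    u^2)^(2/r). Raising to the power r leaves w(x) C^(r/2) int k^q u^2; integrating in x uses the
    column bound and gives the last factor C. *)
Lemma schur_young (r q C : R) (k : T -> T -> R) (w : T -> R) :
  2 < r -> q^-1 = 2^-1 + r^-1 -> 0 <= C -> kern k -> nng w ->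
  (forall x, \int[mu]_y (k x y `^ q * w y)%:E <= C%:E)%E ->
  (forall y, \int[mu]_x (k x y `^ q * w x)%:E <= C%:E)%E ->
  forall u, nng u -> (sqint mu u <= 1)%E ->
  (energy r (wkern r w k) u
    <= (C `^ (r / 2 + 1))%:E)%E.
Proof.
move=> r2 qE C0 kk [mw w0] k1 k2 u [mu0 u0] u1.
have r0 : 0 < r by lra.
have q0 : 0 < q by rewrite -invr_gt0 qE addr_gt0 ?invr_gt0.
have qr : 2 - q = q * (2 / r).
  have : q * q^-1 = 1 by rewrite mulfV// gt_eqF.
  by rewrite qE mulrDr; lra.
have k0 := kk.2.
have mkx x := measurable_kern x kk.
have mpk x (p : R) : measurable_fun [set: T] (fun y => k x y `^ p).
  exact: (measurableT_comp (measurable_powR _)).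
pose Y x : \bar R := (\int[mu]_y (k x y `^ q * u y ^+ 2)%:E)%E.
have Y0 x : (0 <= Y x)%E.
  by apply: integral_ge0 => y _; rewrite lee_fin mulr_ge0 ?powR_ge0 ?sqr_ge0.
have mu2 : measurable_fun [set: T] (fun y => u y ^+ 2) by exact: measurable_funX.
have opw x : op (wkern r w k) u x =
    ((w x `^ r^-1)%:E * \int[mu]_y ((k x y `^ q * w y) `^ 2^-1 *
       (k x y `^ (2 - q) * u y ^+ 2) `^ (1 - 2^-1))%:E)%E.
  rewrite -ge0_intZ ?powR_ge0//.
  - apply: eq_integral => y _; rewrite -EFinM schur_split//; congr EFin.
    by rewrite !mulrA.
  - apply/measurable_EFinP; apply: measurable_funM.
    + apply: (measurableT_comp (measurable_powR _)).
      exact: measurable_funM.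
    + apply: (measurableT_comp (measurable_powR _)).
      exact: measurable_funM.
  - by move=> y; rewrite lee_fin mulr_ge0// powR_ge0.
have step x : (op (wkern r w k) u x `^ r
    <= (w x * C `^ (r / 2))%:E * Y x)%E.
  have h2 : (\int[mu]_y (k x y `^ (2 - q) * u y ^+ 2)%:E <= Y x `^ (2 / r))%E.
    have a01 : 0 < 2 / r < 1 by rewrite divr_gt0//= ltr_pdivrMr// mul1r.
    have a0 : 0 <= 1 - 2 / r by case/andP: a01; lra.
    have /= := @ge0_hoelder (fun y => k x y `^ q * u y ^+ 2) (fun y => u y ^+ 2) (2 / r) a01.
    move=> /(_ (measurable_funM (mpk x q) mu2) mu2).
    move=> /(_ (fun y => mulr_ge0 (powR_ge0 _ _) (sqr_ge0 _)) (fun y => sqr_ge0 _)) h.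
    apply: (@le_trans _ _ (Y x `^ (2 / r) * sqint mu u `^ (1 - 2 / r))%E).
      apply: le_trans h; rewrite le_eqVlt; apply/orP; left; apply/eqP.
      apply: eq_integral => y _; congr EFin.
      rewrite powRM ?powR_ge0 ?sqr_ge0// -powRrM -qr -mulrA; congr (_ * _).
      rewrite -powRD; first by rewrite addrC subrK powRr1 ?sqr_ge0.
      by rewrite addrC subrK oner_eq0.
    rewrite -[leRHS]mule1; apply: lee_wpmul2l; first exact: poweR_ge0.
    rewrite -(poweR1r (1 - 2 / r)); apply: lee_poweR => //.
    exact: sqint_ge0.
  have h1 : (\int[mu]_y ((k x y `^ q * w y) `^ 2^-1 *
       (k x y `^ (2 - q) * u y ^+ 2) `^ (1 - 2^-1))%:E <=
       (C `^ 2^-1)%:E * (Y x `^ (2 / r)) `^ (2^-1))%E.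
    have a01 : 0 < 2^-1 :> R /\ 2^-1 < 1 :> R by split; lra.
    move/andP in a01.
    have := @ge0_hoelder (fun y => k x y `^ q * w y)
      (fun y => k x y `^ (2 - q) * u y ^+ 2) 2^-1 a01.
    move=> /(_ (measurable_funM (mpk x q) mw) (measurable_funM (mpk x (2 - q)) mu2)).
    move=> /(_ (fun y => mulr_ge0 (powR_ge0 _ _) (w0 y)) (fun y => mulr_ge0 (powR_ge0 _ _) (sqr_ge0 _))) h.
    apply: le_trans h _.
    have -> : 1 - 2^-1 = 2^-1 :> R by field.
    apply: lee_pmul; rewrite ?poweR_ge0//.
      rewrite -poweR_EFin; apply: lee_poweR => //.
      by apply: integral_ge0 => y _; rewrite lee_fin mulr_ge0 ?powR_ge0.
    apply: lee_poweR => //.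
    by apply: integral_ge0 => y _; rewrite lee_fin mulr_ge0 ?powR_ge0 ?sqr_ge0.
  rewrite opw.
  have X0 : (0 <= \int[mu]_y ((k x y `^ q * w y) `^ 2^-1 *
       (k x y `^ (2 - q) * u y ^+ 2) `^ (1 - 2^-1))%:E)%E.
    by apply: integral_ge0 => y _; rewrite lee_fin mulr_ge0 ?powR_ge0.
  apply: (@le_trans _ _ (((w x `^ r^-1)%:E * ((C `^ 2^-1)%:E * (Y x `^ (2 / r)) `^ (2^-1))) `^ r)%E).
    apply: lee_poweR; [exact: ltW| |].
      by rewrite mule_ge0// lee_fin powR_ge0.
    by apply: lee_wpmul2l => //; rewrite lee_fin powR_ge0.
  rewrite !poweRM ?mule_ge0 ?lee_fin ?powR_ge0 ?poweR_ge0//.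
  rewrite !poweR_EFin -!powRrM -!poweRrM mulVf ?gt_eqF// powRr1//.
  have -> : 2 / r * (2^-1 * r) = 1 by field; rewrite gt_eqF.
  by rewrite poweRe1// muleA EFinM [2^-1 * r]mulrC.
have mkk (p : R) : measurable_fun [set: T * T] (fun z => k z.1 z.2 `^ p).
  exact: (measurableT_comp (measurable_powR _) kk.1).
apply: (@le_trans _ _ (\int[mu]_x ((w x * C `^ (r / 2))%:E * Y x))%E).
  apply: ge0_int_le => //.
  - by apply: measurable_op_pow; [exact: kern_wkern|split].
  - apply: emeasurable_funM; first by apply/measurable_EFinP; exact: measurable_funM.
    apply: (@measurable_fun_fubini_tonelli_F _ _ T T R mu
      (fun z => (k z.1 z.2 `^ q * u z.2 ^+ 2)%:E)).
      apply/measurable_EFinP; apply: measurable_funM => //.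
      exact: (measurableT_comp mu2 measurable_snd).
    by move=> z; rewrite lee_fin mulr_ge0 ?powR_ge0 ?sqr_ge0.
  - by move=> x; exact: poweR_ge0.
pose H (z : T * T) : \bar R :=
  ((w z.1 * C `^ (r / 2)) * (k z.1 z.2 `^ q * u z.2 ^+ 2))%:E.
have mH : measurable_fun [set: T * T] H.
  apply/measurable_EFinP; apply: measurable_funM; last first.
    apply: measurable_funM => //; exact: (measurableT_comp mu2 measurable_snd).
  by apply: measurable_funM => //; exact: (measurableT_comp mw measurable_fst).
have H0 z : (0 <= H z)%E.
  by rewrite lee_fin !mulr_ge0 ?powR_ge0 ?sqr_ge0.
have -> : (\int[mu]_x ((w x * C `^ (r / 2))%:E * Y x) =
    \int[mu]_x \int[mu]_y H (x, y))%E.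
  apply: eq_integral => x _; rewrite /H /= -ge0_intZ//.
  - by apply/measurable_EFinP; exact: measurable_funM.
  - by rewrite mulr_ge0 ?powR_ge0.
  - by move=> y; rewrite lee_fin mulr_ge0 ?powR_ge0 ?sqr_ge0.
rewrite fubini_tonelli//.
have C'0 y : 0 <= C `^ (r / 2) * u y ^+ 2 by rewrite mulr_ge0 ?powR_ge0 ?sqr_ge0.
apply: (@le_trans _ _ (\int[mu]_y ((C `^ (r / 2 + 1))%:E * (u y ^+ 2)%:E))%E).
  apply: ge0_int_le => //.
  - exact: (measurable_fun_fubini_tonelli_G).
  - by apply: emeasurable_funM; [exact: measurable_cst|exact/measurable_EFinP].
  - by move=> y; apply: integral_ge0.
  move=> y; rewrite /H/=.
  have -> : (\int[mu]_x (w x * C `^ (r / 2) * (k x y `^ q * u y ^+ 2))%:E =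
      (C `^ (r / 2) * u y ^+ 2)%:E * \int[mu]_x (k x y `^ q * w x)%:E)%E.
    rewrite -ge0_intZ//.
    - by apply: eq_integral => x _; rewrite -EFinM; congr EFin; ring.
    - apply/measurable_EFinP; apply: measurable_funM => //.
      apply: (measurableT_comp (measurable_powR _)).
      exact: (measurableT_comp kk.1 (pair2_measurable y)).
    - by move=> x; rewrite lee_fin mulr_ge0 ?powR_ge0.
  apply: (@le_trans _ _ ((C `^ (r / 2) * u y ^+ 2)%:E * C%:E)%E).
    by apply: lee_wpmul2l => //; rewrite lee_fin.
  rewrite -!EFinM lee_fin powRD; last first.
    apply/implyP => /eqP h; exfalso.
    have : 0 < r / 2 by rewrite divr_gt0.
    by lra.
  by rewrite powRr1// mulrAC.
rewrite ge0_intZ ?powR_ge0//; last 2 first.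
- exact: measurable_sqr.
- by move=> y; rewrite lee_fin sqr_ge0.
rewrite -[leRHS]mule1; apply: lee_wpmul2l => //.
by rewrite lee_fin powR_ge0.
Qed.

End schur.

(** * Maximizers for nonnegative kernels *)

Section maximizer.
Context d (T : measurableType d) (R : realType).
Variable mu : {sigma_finite_measure set T -> \bar R}.
Local Notation sqint := (sqint mu).
Local Notation L2 := (L2 mu).
Local Notation ip := (ip mu).
Local Notation energy := (energy mu).
Local Notation op := (op mu).

Lemma nng_abs (w : T -> R) : measurable_fun [set: T] w -> nng (fun x => `|w x|).
Proof. by move=> mw; split=> [|x]; [exact: measurableT_comp|exact: normr_ge0]. Qed.

Lemma sqint_abs (w : T -> R) : sqint (fun x => `|w x|) = sqint w.
Proof. by apply: eq_integral => x _; rewrite real_normK ?num_real. Qed.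

Lemma sqintZ (c : R) (w : T -> R) : measurable_fun [set: T] w ->
  sqint (fun x => c * w x) = ((c ^+ 2)%:E * sqint w)%E.
Proof.
move=> mw; rewrite -ge0_intZ ?sqr_ge0//.
- by apply: eq_integral => x _; rewrite exprMn EFinM.
- exact: measurable_sqr.
- by move=> x; rewrite lee_fin sqr_ge0.
Qed.

Lemma nng_L2 (c : R) (u : T -> R) : nng u -> (sqint u <= c%:E)%E -> L2 u.
Proof. by move=> [mu0 _] u1; split => //; apply: le_lt_trans u1 _; rewrite ltry. Qed.

Lemma L2_abs (w : T -> R) : L2 w -> L2 (fun x => `|w x|).
Proof. by move=> [mw w2]; split; [exact: measurableT_comp|rewrite sqint_abs]. Qed.

Lemma opE (k : T -> T -> R) (u : T -> R) (x : T) :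
  L2 (k x) -> L2 u -> op k u x = (ip (k x) u)%:E.
Proof.
move=> lk lu; rewrite /ip /Rintegral fineK//.
by apply: integrable_fin_num => //; exact: L2_mulr_integrable.
Qed.

Lemma ler_norm_ip (f w : T -> R) : L2 f -> L2 w -> (forall x, 0 <= f x) ->
  `|ip f w| <= ip f (fun x => `|w x|).
Proof.
move=> lf lw f0; apply: le_trans (le_normr_Rintegral _ _) _ => //.
  exact: L2_mulr_integrable.
rewrite le_eqVlt; apply/orP; left; apply/eqP.
by apply: eq_Rintegral => x _; rewrite normrM ger0_norm.
Qed.

Lemma sqint_subE (f g : T -> R) : L2 f -> L2 g ->
  sqint (fun x => f x - g x) = (ip f f - 2 * ip f g + ip g g)%:E.
Proof.
move=> lf lg; have lfg := L2B lf lg; rewrite sqint_ip//; congr EFin.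
rewrite ipBl// (ipC mu f (fun x => f x - g x)) (ipC mu g (fun x => f x - g x)).
by rewrite !ipBl// (ipC mu g f); ring.
Qed.

(** Serves to see that a weak limit is nonzero. If |g| = 0, then |f - t g|^2 is affine in t with
    slope -2 <f, g>, and becomes negative. *)
Lemma ip_pos_sqr_gt0 (f g : T -> R) : L2 f -> L2 g -> 0 < ip f g -> 0 < ip g g.
Proof.
move=> lf lg fg0; rewrite lt0r ip_ge0 andbT; apply/eqP => g0.
have h t : 0 <= ip f f - 2 * (t * ip f g).
  have ltg := L2Z t lg.
  have := sqint_ge0 mu (fun x => f x - t * g x).
  rewrite sqint_subE// lee_fin.
  rewrite (ipC mu f (fun x => t * g x)) !ipZl// (ipC mu g (fun x => t * g x)).
  by rewrite ipZl// g0 (ipC mu g f); lra.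
have := h ((ip f f + 1) / ip f g); rewrite mulfVK ?gt_eqF//.
by have := ip_ge0 mu f; lra.
Qed.

(** The inequality of [powRD_le] applied at each x to the two parts of the operator. The part of K'
    is finite because its rows are in L^2; if the part of K - K' is infinite, so is the right-hand
    side. *)
Lemma energy_split (r eta D : R) (K K' : T -> T -> R) (u : T -> R) :
  0 < r -> 0 <= eta -> 0 < D ->
  (forall a b : R, 0 <= a -> 0 <= b -> (a + b) `^ r <= (1 + eta) * a `^ r + D * b `^ r) ->
  kern K -> kern K' -> (forall x y, K' x y <= K x y) -> (forall x, L2 (K' x)) ->
  nng u -> L2 u ->
  (energy r K u <= (1 + eta)%:E * energy r K' u
    + D%:E * energy r (fun x y => K x y - K' x y)%R u)%E.
Proof.
move=> r0 eta0 D0 DP kK kK' K'K lK' nu lu.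
have e1 : 0 <= 1 + eta by lra.
have kd : kern (fun x y => K x y - K' x y).
  split=> [|x y]; last by rewrite subr_ge0.
  by apply: measurable_funB; [exact: kK.1|exact: kK'.1].
rewrite -(ge0_intZ _ (measurable_op_pow mu r kK' nu) e1); last first.
  by move=> x; exact: poweR_ge0.
rewrite -(ge0_intZ _ (measurable_op_pow mu r kd nu) (ltW D0)); last first.
  by move=> x; exact: poweR_ge0.
have mZ (c : R) k' : kern k' -> measurable_fun [set: T] (fun x => (c%:E * op k' u x `^ r)%E).
  by move=> kk'; apply: emeasurable_funM; [exact: measurable_cst|exact: measurable_op_pow].
rewrite -ge0_intD; last 4 first.
- exact: mZ.
- exact: mZ.
- by move=> x; rewrite mule_ge0 ?lee_fin ?poweR_ge0.
- by move=> x; rewrite mule_ge0 ?lee_fin ?poweR_ge0 ?(ltW D0).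
apply: ge0_int_le.
- exact: measurable_op_pow.
- by apply: emeasurable_funD; exact: mZ.
- by move=> x; exact: poweR_ge0.
move=> x; have -> : op K u x = (op K' u x + op (fun x y => K x y - K' x y)%R u x)%E.
  rewrite -ge0_intD.
  - by apply: eq_integral => y _; rewrite -EFinD -mulrDl subrKC.
  - exact: (measurable_kernu x kK' nu).
  - exact: (measurable_kernu x kd nu).
  - by move=> y; exact: (kernu_ge0 x y kK' nu).
  - by move=> y; exact: (kernu_ge0 x y kd nu).
rewrite opE//; have a0 : 0 <= ip (K' x) u by rewrite -lee_fin -opE//; exact: op_ge0.
move: (op_ge0 mu x kd nu).
case: (op _ _ _) => [b| |//].
  rewrite lee_fin => b0; rewrite -EFinD !poweR_EFin -!EFinM -EFinD lee_fin.
  exact: DP.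
move=> _; rewrite addey// poweRyr ?gt_eqF//.
by rewrite poweR_EFin -EFinM gt0_muley ?lte_fin// addey// leey.
Qed.

(** * Abstract existence of a maximizer from truncation and nonvanishing *)

Section maximizing.
Variables (r C : R) (K : T -> T -> R).
Hypothesis r2 : 2 < r.
Hypothesis kK : kern K.
Hypothesis energy_bounded :
  forall u, nng u -> (sqint u <= 1)%E -> (energy r K u <= C%:E)%E.
Hypothesis truncation : forall eta : R, 0 < eta -> exists K',
  [/\ kern K', forall x y, K' x y <= K x y, forall x, L2 (K' x) &
      forall u, nng u -> (sqint u <= 1)%E ->
        (energy r (fun x y => K x y - K' x y)%R u <= eta%:E)%E].
(** Here u' stands for a copy of u under a symmetry of the problem. The test function b is the same
    for all u, so that a weak limit of the copies pairs with it to at least delta. *)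
Hypothesis nonvanishing : forall e : R, 0 < e -> exists b (delta : R),
  [/\ L2 b, 0 < delta & forall u, nng u -> (sqint u <= 1)%E ->
    (e%:E <= energy r K u)%E -> exists u',
    [/\ nng u', (sqint u' <= 1)%E, energy r K u' = energy r K u
      & delta <= ip b u']].
Hypothesis unit_exists : exists u0 : T -> R, nng u0 /\ sqint u0 = 1%E.

Let r0 : 0 < r. Proof. exact: lt_trans r2. Qed.

Let S := sup [set fine (energy r K u) | u in [set u | nng u /\ (sqint u <= 1)%E]].

Let energy_ge0 k u : (0 <= energy r k u)%E.
Proof. by apply: integral_ge0 => x _; exact: poweR_ge0. Qed.

Let energy_fin u : nng u -> (sqint u <= 1)%E -> energy r K u \is a fin_num.
Proof.
move=> uu u1; rewrite ge0_fin_numE//.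
by apply: le_lt_trans (energy_bounded uu u1) _; rewrite ltry.
Qed.

Let energy_S u : nng u -> (sqint u <= 1)%E -> (energy r K u <= S%:E)%E.
Proof.
move=> uu u1; rewrite -[energy r K u]fineK ?energy_fin// lee_fin.
apply: ub_le_sup; last by exists u.
exists C => _ [v [vv v1] <-].
by rewrite -lee_fin fineK ?energy_fin//; exact: energy_bounded.
Qed.

Let S_ge0 : 0 <= S.
Proof.
have [u0 [uu0 u01]] := unit_exists; rewrite -lee_fin.
by apply: le_trans (energy_S uu0 _); rewrite ?u01.
Qed.

(** Homogeneity of degree r of the energy. *)
Let energy_scaled (A : R) u : 0 < A -> nng u -> (sqint u <= (A ^+ 2)%:E)%E ->
  (energy r K u <= (S * A `^ r)%:E)%E.
Proof.
move=> A0 uu uA.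
have -> : u = (fun x => A * (A^-1 * u x)).
  by apply/funext => x; rewrite mulrA mulfV ?gt_eqF// mul1r.
have Ai : 0 <= A^-1 by rewrite invr_ge0 ltW.
have vv : nng (fun x => A^-1 * u x) by exact: nngZ.
rewrite energyZ ?(ltW A0)// muleC EFinM; apply: lee_wpmul2r.
  by rewrite lee_fin powR_ge0.
apply: energy_S => //; rewrite sqintZ; last exact: uu.1.
apply: (@le_trans _ _ (((A^-1) ^+ 2)%:E * (A ^+ 2)%:E)%E).
  by apply: lee_wpmul2l => //; rewrite lee_fin sqr_ge0.
by rewrite -EFinM -exprMn mulVf ?gt_eqF// expr1n.
Qed.

(** One factor 1 + eta comes from replacing K by K', the other from Brezis-Lieb applied to K' u_k,
    which converges pointwise as the rows of K' are test functions. The bound t^(2/r) on |u_k - v|^2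
    is scaled so that the remainder has energy at most S t. *)
Let asymptotic_splitting (u : nat -> T -> R) (v : T -> R) (t eta : R) :
  (forall k, nng (u k)) -> (forall k, (sqint (u k) <= 1)%E) -> L2 v ->
  (forall w, L2 w -> ip (u k) w @[k --> \oo] --> ip v w) ->
  0 < t -> 0 < eta ->
  (\forall k \near \oo, (sqint (fun x => u k x - v x)%R <= (t `^ (2 / r))%:E)%E) ->
  \forall k \near \oo,
    (energy r K (u k) <= (1 + eta)%:E * ((1 + eta)%:E * (S * t)%:E
      + energy r K (fun x => `|v x|)%R + eta%:E) + eta%:E)%E.
Proof.
move=> uu u1 lv wk t0 eta0 near_t.
have e1 : 0 <= 1 + eta by lra.
have [D D0 DP] := powRD_le r0 eta0.
(* The tail is multiplied by D in [energy_split], so a tail of eta / D costs eta. *)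
have [K' [kK' K'K lK' tail]] := truncation (divr_gt0 eta0 D0).
have lu k : L2 (u k) := nng_L2 (uu k) (u1 k).
have K'0 := kK'.2.
pose a_ k x := ip (K' x) (u k).
pose a x := ip (K' x) v.
have a_E k x : op K' (u k) x = (a_ k x)%:E by exact: opE.
have a_0 k x : 0 <= a_ k x by rewrite -lee_fin -a_E op_ge0.
have ma_ k : measurable_fun [set: T] (a_ k).
  apply/measurable_EFinP; rewrite (_ : _ \o _ = op K' (u k)); last first.
    by apply/funext => x; rewrite /= -a_E.
  exact: measurable_op.
have aa x : a_ ^~ x @ \oo --> a x.
  rewrite /a_ /a ipC; under eq_fun do rewrite ipC.
  exact: wk.
have ma : measurable_fun [set: T] a by apply: measurable_fun_cvg ma_ _ => x _.
have mabs (f : T -> R) : measurable_fun [set: T] f ->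
    measurable_fun [set: T] (fun x => (`|f x| `^ r)%:E).
  move=> mf; apply/measurable_EFinP; apply: (measurableT_comp (measurable_powR _)).
  exact: measurableT_comp.
(* Returns from K' to K and from a signed w to |w|; used for w = v and for w = u_k - v. *)
have ip_energy (w : T -> R) (f : T -> R) : L2 w -> measurable_fun [set: T] f ->
    (forall x, `|f x| <= ip (K' x) (fun y => `|w y|)) ->
    (\int[mu]_x (`|f x| `^ r)%:E <= energy r K (fun y => `|w y|)%R)%E.
  move=> lw mf fw; have nw := nng_abs lw.1.
  apply: (@le_trans _ _ (energy r K' (fun y => `|w y|)%R)).
    apply: ge0_int_le; [exact: mabs|exact: measurable_op_pow| |].
      by move=> x; rewrite lee_fin powR_ge0.
    move=> x; rewrite opE//; last exact: L2_abs.
    rewrite poweR_EFin lee_fin; apply: ge0_ler_powR; rewrite ?nnegrE ?(ltW r0)//.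
    exact: le_trans (fw x).
  apply: energy_le => // [|x y]; first exact: ltW.
  by rewrite ler_wpM2r.
have Ja : (\int[mu]_x (`|a x| `^ r)%:E <= energy r K (fun x => `|v x|)%R)%E.
  by apply: ip_energy => // x; exact: ler_norm_ip.
have [Jfin|] := boolP (energy r K (fun x => `|v x|)%R \is a fin_num); last first.
  rewrite ge0_fin_numE// -leNgt leye_eq => /eqP ->; apply: nearW => k.
  rewrite addey// addye// gt0_muley ?addye ?leey//.
  by rewrite lte_fin; lra.
have ia : (\int[mu]_x (`|a x| `^ r)%:E < +oo)%E.
  by apply: le_lt_trans Ja _; rewrite -ge0_fin_numE.
have := brezis_lieb_le r0 eta0 eta0 ma_ aa ia.
apply: filterS2 near_t => k sk bl.
have mu_k := uu k.
have lsub := L2B (lu k) lv.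
have split1 := energy_split r0 (ltW eta0) D0 DP kK kK' K'K lK' mu_k (lu k).
apply: le_trans split1 _; apply: leeD; last first.
  apply: (@le_trans _ _ (D%:E * (eta / D)%:E)%E).
    by apply: lee_wpmul2l; [rewrite lee_fin ltW|exact: tail].
  by rewrite -EFinM mulrC mulfVK// gt_eqF.
apply: lee_wpmul2l; first by rewrite lee_fin.
have -> : energy r K' (u k) = (\int[mu]_x (`|a_ k x| `^ r)%:E)%E.
  by apply: eq_integral => x _; rewrite a_E poweR_EFin ger0_norm.
apply: le_trans bl _; apply: leeD => //; apply: leeD => //.
apply: lee_wpmul2l; first by rewrite lee_fin.
apply: (@le_trans _ _ (energy r K (fun y => `|u k y - v y|)%R)).
  apply: ip_energy => //; first exact: measurable_funB.
  move=> x; rewrite /a_ /a (ipC _ _ (u k)) (ipC _ _ v) -ipBl// (ipC _ _ (K' x)).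
  exact: ler_norm_ip.
have tE : t = (t `^ r^-1) `^ r by rewrite -powRrM mulVf ?gt_eqF// powRr1// ltW.
rewrite [in leRHS]tE; apply: energy_scaled; [by rewrite powR_gt0| |].
  by apply: nng_abs; exact: lsub.1.
rewrite sqint_abs; apply: le_trans sk _; rewrite lee_fin.
by rewrite -powR_mulrn ?powR_ge0// -powRrM mulrC.
Qed.

Let limit_splitting (u : nat -> T -> R) (v : T -> R) (t : R) :
  (forall k, nng (u k)) -> (forall k, (sqint (u k) <= 1)%E) -> L2 v ->
  (sqint v <= 1)%E ->
  (forall w, L2 w -> ip (u k) w @[k --> \oo] --> ip v w) ->
  (forall e : R, 0 < e -> \forall k \near \oo, ((S - e)%:E <= energy r K (u k))%E) ->
  0 < t ->
  (\forall k \near \oo, (sqint (fun x => u k x - v x)%R <= (t `^ (2 / r))%:E)%E) ->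
  S <= S * t + fine (energy r K (fun x => `|v x|)).
Proof.
move=> uu u1 lv v1 wk uS t0 near_t.
have nv := nng_abs lv.1.
have vfin : energy r K (fun x => `|v x|) \is a fin_num.
  by apply: energy_fin => //; rewrite sqint_abs.
set J := fine _; have J0 : 0 <= J by exact: fine_ge0.
have St0 : 0 <= S * t by rewrite mulr_ge0 ?(ltW t0).
apply/ler_addgt0Pr => e e0.
(* Since eta^2 <= eta, expanding the bound of [asymptotic_splitting] gives S t + J + eta (3 S t + J
   + 3); one more eta comes from S - eta on the left. *)
pose D := 3 * (S * t) + J + 4.
have D0 : 0 < D by rewrite /D; lra.
pose eta := Num.min 1 (e / D).
have eta0 : 0 < eta by rewrite lt_min ltr01 divr_gt0.
have eta1 : eta <= 1 by rewrite ge_min lexx.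
have etaD : eta * D <= e by rewrite -ler_pdivlMr// ge_min lexx orbT.
have h1 := asymptotic_splitting uu u1 lv wk t0 eta0 near_t.
have h2 := uS eta eta0.
have [k [hk1 hk2]] : exists k, ((S - eta)%:E <= energy r K (u k))%E /\
    (energy r K (u k) <= (1 + eta)%:E * ((1 + eta)%:E * (S * t)%:E
      + energy r K (fun x => `|v x|)%R + eta%:E) + eta%:E)%E.
  by apply: (@filter_ex _ \oo); apply: filterS2 h2 h1 => k; split.
have := le_trans hk1 hk2.
rewrite -[energy r K (fun x => `|v x|)]fineK// -/J -!(EFinM, EFinD) lee_fin => h.
have h3 : eta * eta <= eta by rewrite ler_piMr// ltW.
have h4 : eta * eta * (S * t) <= eta * (S * t) by exact: ler_wpM2r.
move: etaD; rewrite /D => etaD.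
have -> : S * t + J + e = (S * t + J) + e by [].
lra.
Qed.

Lemma maximizer_exists : exists g, [/\ nng g, sqint g = 1%E &
  forall f, nng f -> (sqint f <= 1)%E -> (energy r K f <= energy r K g)%E].
Proof.
(* If S = 0, every energy vanishes on the unit ball and any unit vector is a maximizer. *)
have := S_ge0; rewrite le0r => /orP[/eqP S0|S_gt0].
  have [u0 [uu0 u01]] := unit_exists; exists u0; split => // f ff f1.
  by apply: le_trans (energy_S ff f1) _; rewrite S0.
have S2 : 0 < S / 2 by lra.
have [b [delta [lb delta0 bP]]] := nonvanishing S2.
have /choice[u uP] : forall k, exists u, [/\ nng u, (sqint u <= 1)%E,
    ((S - S / 2 / k.+1%:R)%:E <= energy r K u)%E & delta <= ip b u].
  move=> k; pose e := S / 2 / k.+1%:R.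
  have e0 : 0 < e by rewrite divr_gt0.
  have eS : e <= S / 2 by rewrite ler_pdivrMr// ler_peMr ?ler1n// ltW.
  have hsup : has_sup [set fine (energy r K u) | u in [set u | nng u /\ (sqint u <= 1)%E]].
    split.
      have [u0 [uu0 u01]] := unit_exists.
      by exists (fine (energy r K u0)), u0; split => //; rewrite u01.
    exists C => _ [v [vv v1] <-].
    by rewrite -lee_fin fineK ?energy_fin//; exact: energy_bounded.
  have [_ [w [ww w1] <-] Sw] := sup_adherent e0 hsup.
  have Sw' : ((S - e)%:E <= energy r K w)%E.
    by rewrite -[leRHS]fineK ?energy_fin// lee_fin ltW.
  have [|w' [ww' w'1 Eww' bw']] := bP w ww w1.
    by apply: le_trans Sw'; rewrite lee_fin; lra.
  by exists w'; split => //; rewrite Eww'.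
have lu k : L2 (u k) by have [uu u1 _ _] := uP k; exact: nng_L2 uu u1.
have [v [s [lv sinc wk]]] := @L2_weak_compactness _ _ _ mu 1 u lu
  (fun k => let: And4 _ h _ _ := uP k in h).
have les i : (i <= s i)%N.
  by elim: i => // i IH; apply: leq_ltn_trans IH (sinc _ _ (ltnSn i)).
pose us i := u (s i).
have uus i : nng (us i) by have [] := uP (s i).
have us1 i : (sqint (us i) <= 1)%E by have [] := uP (s i).
pose m := ip v v.
have m0 : 0 < m.
  apply: (ip_pos_sqr_gt0 lb lv); apply: (lt_le_trans delta0).
  have c := wk b lb; rewrite ipC -(cvg_lim (@Rhausdorff R) c).
  apply: limr_ge; first by apply/cvg_ex; eexists; exact: c.
  by apply: nearW => i; rewrite ipC; have [] := uP (s i).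
have sub_le i : (sqint (fun x => us i x - v x)%R <= (1 - 2 * ip (us i) v + m)%:E)%E.
  rewrite (sqint_subE (lu (s i)) lv) lee_fin -/m !lerD2r.
  by have := us1 i; rewrite (sqint_ip (lu (s i))) lee_fin.
have csub : 1 - 2 * ip (us i) v + m @[i --> \oo] --> 1 - m.
  rewrite (_ : 1 - m = 1 - 2 * m + m); last by ring.
  apply: cvgD; last exact: cvg_cst.
  apply: cvgB; first exact: cvg_cst.
  by apply: cvgM; [exact: cvg_cst|exact: wk].
have m1 : m <= 1.
  rewrite -subr_ge0 -(cvg_lim (@Rhausdorff R) csub).
  apply: limr_ge; first by apply/cvg_ex; eexists; exact: csub.
  apply: nearW => i; rewrite -lee_fin; apply: le_trans (sub_le i).
  exact: sqint_ge0.
have uS (e : R) : 0 < e -> \forall k \near \oo, ((S - e)%:E <= energy r K (us k))%E.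
  move=> e0; have e2 : 0 < e / (S / 2) by rewrite divr_gt0.
  have := near_infty_natSinv_lt (PosNum e2); apply: filterS => k /= hk.
  have [_ _ h _] := uP (s k); apply: le_trans h; rewrite lee_fin lerD2l lerN2.
  apply: (@le_trans _ _ (S / 2 / k.+1%:R)).
    apply: ler_wpM2l; first exact: ltW.
    by rewrite lef_pV2 ?posrE ?ltr0n// ler_nat ltnS.
  by rewrite mulrC -ler_pdivlMr// ltW.
have sv : sqint v = m%:E by exact: sqint_ip.
have sv1 : (sqint v <= 1)%E by rewrite sv lee_fin.
have nv := nng_abs lv.1.
set J := fine (energy r K (fun x => `|v x|)).
have vfin : energy r K (fun x => `|v x|) \is a fin_num.
  by apply: energy_fin => //; rewrite sqint_abs.
have key : S <= S * (1 - m) `^ (r / 2) + J.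
  apply/ler_addgt0Pr => e e0.
  (* The squared norm of us_i - v is bounded by a sequence tending to 1 - m; the extra e / S makes
     t^(2/r) exceed this limit and keeps t positive when m = 1. *)
  pose t := (1 - m) `^ (r / 2) + e / S.
  have eS0 : 0 < e / S by rewrite divr_gt0.
  have t0 : 0 < t by rewrite ltr_wpDl ?powR_ge0.
  have -> : S * (1 - m) `^ (r / 2) + J + e = S * t + J.
    by rewrite /t mulrDr [S * (e / S)]mulrC mulfVK ?gt_eqF//; ring.
  apply: (limit_splitting uus us1 lv sv1 wk uS t0).
  have lt1 : 1 - m < t `^ (2 / r).
    have -> : 1 - m = ((1 - m) `^ (r / 2)) `^ (2 / r).
      rewrite -powRrM (_ : r / 2 * (2 / r) = 1) ?powRr1 ?subr_ge0//.
      by field; rewrite gt_eqF.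
    apply: gt0_ltr_powR; rewrite ?nnegrE ?powR_ge0 ?divr_gt0 ?(ltW t0)//.
    by rewrite /t ltrDl.
  have near_lt : \forall i \near \oo, 1 - 2 * ip (us i) v + m < t `^ (2 / r).
    exact: (cvgr_lt (1 - m)).
  apply: filterS near_lt => i hi.
  by apply: le_trans (sub_le i) _; rewrite lee_fin ltW.
have Jm : J <= S * m `^ (r / 2).
  rewrite -lee_fin fineK//.
  have -> : m `^ (r / 2) = (m `^ 2^-1) `^ r by rewrite -powRrM mulrC.
  apply: energy_scaled => //; first by rewrite powR_gt0.
  rewrite sqint_abs sv lee_fin -powR_mulrn ?powR_ge0// -powRrM mulVf// powRr1//.
  exact: ltW.
(* For 0 < m < 1 both (1 - m)^(r/2) < 1 - m and m^(r/2) < m, so [key] and [Jm] would give S < S. *)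
have me1 : m = 1.
  apply/eqP; rewrite eq_le m1/= leNgt; apply/negP => mlt1.
  have pw (x : R) : 0 < x < 1 -> x `^ (r / 2) < x.
    move=> /andP[x0 x1].
    have -> : x `^ (r / 2) = x * x `^ (r / 2 - 1).
      by rewrite mulr_powRB1 ?(ltW x0)// divr_gt0.
    have r21 : 0 < r / 2 - 1 by have := r2; lra.
    rewrite gtr_pMr// /powR gt_eqF// -[ltRHS]expR0 ltr_expR.
    by rewrite pmulr_rlt0// ln_lt0// x0.
  have h1 : (1 - m) `^ (r / 2) < 1 - m by apply: pw; apply/andP; split; lra.
  have h2 : m `^ (r / 2) < m by apply: pw; rewrite m0.
  have : S * (1 - m) `^ (r / 2) + S * m `^ (r / 2) < S.
    rewrite -mulrDr -[ltRHS]mulr1 ltr_pM2l//; lra.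
  by rewrite ltNge => /negP; apply; apply: le_trans key _; rewrite lerD2l.
exists (fun x => `|v x|); split => //; first by rewrite sqint_abs sv me1.
move=> f ff f1; apply: le_trans (energy_S ff f1) _.
rewrite -[leRHS]fineK// lee_fin -/J.
have := key; rewrite me1 subrr powR0 ?mulr0 ?add0r//.
by rewrite gt_eqF// divr_gt0.
Qed.

End maximizing.
End maximizer.

(** * Lebesgue measure on R^n under dilations *)

Section affine_change_of_variables.
Variable R : realType.
Local Open Scope ereal_scope.

Local Notation leb := (@lebesgue_measure R).

Let aff1 (c rho : R) : measurableTypeR R -> measurableTypeR R :=
  fun t => (c + rho * t)%R.

Let measurable_aff1 c rho : measurable_fun [set: measurableTypeR R] (aff1 c rho).
Proof. by apply: measurable_funD => //; exact: measurable_funM. Qed.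

(** The image of Lebesgue measure under the affine map, multiplied by rho, has the right value on
    half-open intervals, hence is Lebesgue measure by uniqueness. *)
Lemma integral_lebesgue_affine (c rho : R) (f : measurableTypeR R -> \bar R) :
  (0 < rho)%R -> measurable_fun [set: measurableTypeR R] f -> (forall x, 0 <= f x) ->
  \int[leb]_x f x = rho%:E * \int[leb]_x f (c + rho * x)%R.
Proof.
move=> rho0 mf f0.
pose phi := aff1 c rho; have mphi : measurable_fun setT phi by exact: measurable_aff1.
pose nu0 : {measure set (measurableTypeR R) -> \bar R} := pushforward leb phi.
pose nu := mscale (NngNum (ltW rho0)) (nu0 mphi).
have lebE A : measurable A -> leb A = nu A.
  move=> mA; apply: lebesgue_measure_unique => // X [[a b]] _ <-.
  rewrite /nu /mscale /= /nu0 /= /pushforward.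
  rewrite [X in _ = _ * leb X](_ : _ = `]((a - c) / rho)%R, ((b - c) / rho)%R]%classic); last first.
    apply/seteqP; split=> x /=; rewrite /phi /aff1 !in_itv/=.
      by rewrite ltr_pdivrMr// ler_pdivlMr//; lra.
    by rewrite ltr_pdivrMr// ler_pdivlMr//; lra.
  rewrite !lebesgue_measure_itv/= !lte_fin ltr_pM2r ?invr_gt0// ltrD2r.
  case: ifP => _; last by rewrite mule0.
  by rewrite -!EFinB -EFinM; congr EFin; field; rewrite gt_eqF.
transitivity (\int[nu]_x f x).
  by apply: eq_measure_integral => A mA _; exact: lebE.
rewrite ge0_integral_mscale//; congr (_ * _).
by rewrite ge0_integral_pushforward.
Qed.

Lemma integral_lebesgue_tupleS n (F : euclid R n.+1 -> \bar R) :
  measurable_fun [set: euclid R n.+1] F -> (forall x, 0 <= F x) ->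
  \int[lebesgue_tuple R n.+1]_x F x =
  \int[leb]_t \int[lebesgue_tuple R n]_v F (cons_pair (t, v)).
Proof.
move=> mF F0; have mc := @measurable_cons_pair R n.
pose nu : {measure set (euclid R n.+1) -> \bar R} :=
  pushforward (leb \x lebesgue_tuple R n) (@cons_pair R n).
transitivity (\int[nu mc]_x F x).
  by apply: eq_measure_integral => A mA _.
rewrite ge0_integral_pushforward//=.
rewrite fubini_tonelli1//.
exact: (measurableT_comp mF mc).
Qed.

(** Covers both changes of variables in use: translations (rho = 1), to recentre at the diagonal,
    and dilations (c = 0). *)
Definition affine n (c : euclid R n) (rho : R) (y : euclid R n) : euclid R n :=
  [tuple (tnth c i + rho * tnth y i)%R | i < n].

Lemma affine_cons n (c : euclid R n.+1) rho t (v : euclid R n) :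
  affine c rho (cons_pair (t, v)) =
  cons_pair ((thead c + rho * t)%R, affine [tuple of behead c] rho v).
Proof.
apply: eq_from_tnth => i; rewrite tnth_mktuple.
case: (unliftP ord0 i) => [j ->|->].
  by rewrite /cons_pair /= !tnthS tnth_mktuple {1}(tuple_eta c) tnthS.
by rewrite /cons_pair /= /thead.
Qed.

Lemma measurable_affine n (c : euclid R n) rho :
  measurable_fun [set: euclid R n] (affine c rho).
Proof.
apply/measurable_fun_tnthP => i.
rewrite (_ : _ \o _ = fun y => (tnth c i + rho * tnth y i)%R); last first.
  by apply/funext => y /=; rewrite tnth_mktuple.
by apply: measurable_funD => //; apply: measurable_funM => //; exact: measurable_tnth.
Qed.

(** Induction on the dimension: the first coordinate contributes one factor rho by the
    one-dimensional formula, the others contribute rho^n by induction. *)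
Lemma integral_affine n (c : euclid R n) (rho : R) (F : euclid R n -> \bar R) :
  (0 < rho)%R -> measurable_fun [set: euclid R n] F -> (forall x, 0 <= F x) ->
  \int[lebesgue_tuple R n]_x F x =
  (rho ^+ n)%:E * \int[lebesgue_tuple R n]_x F (affine c rho x).
Proof.
move=> rho0; elim: n c F => [|n IH] c F mF F0.
  rewrite expr0 mul1e; apply: eq_integral => x _; congr F.
  by apply: eq_from_tnth => -[].
rewrite !integral_lebesgue_tupleS//; last exact: (measurableT_comp mF (measurable_affine c rho)).
have mc := @measurable_cons_pair R n.
have mFc t : measurable_fun [set: euclid R n] (fun v => F (cons_pair (t, v))).
  exact: (measurableT_comp (measurableT_comp mF mc) (pair1_measurable t)).
pose G t := \int[lebesgue_tuple R n]_v F (cons_pair (t, v)).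
have mG : measurable_fun [set: measurableTypeR R] G.
  apply: (@measurable_fun_fubini_tonelli_F _ _ _ _ R (lebesgue_tuple R n)
    (fun z => F (cons_pair z))) => //.
  exact: (measurableT_comp mF mc).
have G0 t : 0 <= G t by exact: integral_ge0.
rewrite (integral_lebesgue_affine (thead c) rho0 mG G0).
rewrite exprS EFinM -muleA; congr (_ * _).
rewrite -ge0_intZ.
- apply: eq_integral => t _; rewrite /G (IH [tuple of behead c])//.
  by congr (_ * _); apply: eq_integral => v _; rewrite affine_cons.
- apply: (@measurable_fun_fubini_tonelli_F _ _ _ _ R (lebesgue_tuple R n)
    (fun z => F (affine c rho (cons_pair z)))) => //.
  exact: (measurableT_comp (measurableT_comp mF (measurable_affine c rho)) mc).
- by rewrite exprn_ge0// ltW.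
- by move=> t; exact: integral_ge0.
Qed.

End affine_change_of_variables.

(* MathComp-Analysis has another [edist]. *)
Local Notation edist := Defs.edist.

(** * Euclidean norm, balls, and integrals of powers of the norm *)

Section euclidean.
Variables (R : realType) (n : nat).
Local Notation X := (euclid R n).
Local Notation lam := (lebesgue_tuple R n).
Implicit Types (x y : X) (rho : R).

Lemma enorm_ge0 x : 0 <= enorm x. Proof. exact: sqrtr_ge0. Qed.

Lemma edist_ge0 x y : 0 <= edist x y. Proof. exact: sqrtr_ge0. Qed.

Lemma enorm_sqr x : enorm x ^+ 2 = \sum_(i < n) (tnth x i : R) ^+ 2.
Proof. by rewrite sqr_sqrtr// sumr_ge0// => i _; exact: sqr_ge0. Qed.

Lemma edist_sqr x y : edist x y ^+ 2 = \sum_(i < n) ((tnth x i : R) - tnth y i) ^+ 2.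
Proof. by rewrite sqr_sqrtr// sumr_ge0// => i _; exact: sqr_ge0. Qed.

Lemma edistC x y : edist x y = edist y x.
Proof. by congr Num.sqrt; apply: eq_bigr => i _; rewrite -sqrrN opprB. Qed.

(** A quasi-triangle inequality, proved coordinate by coordinate; its constant suffices for
    separating the regions in [kap_pointwise]. *)
Lemma enorm_sqr_le x y : enorm x ^+ 2 <= 2 * edist x y ^+ 2 + 2 * enorm y ^+ 2.
Proof.
rewrite !enorm_sqr edist_sqr !mulr_sumr -big_split/=; apply: ler_sum => i _.
move: (tnth x i : R) (tnth y i : R) => a b.
by have := sqr_ge0 (a - b - b); lra.
Qed.

Lemma edist_sqr_le x y : edist x y ^+ 2 <= 2 * enorm x ^+ 2 + 2 * enorm y ^+ 2.
Proof.
rewrite !enorm_sqr edist_sqr !mulr_sumr -big_split/=; apply: ler_sum => i _.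
move: (tnth x i : R) (tnth y i : R) => a b.
by have := sqr_ge0 (a + b); lra.
Qed.

Lemma measurable_enorm : measurable_fun [set: X] (@enorm R n).
Proof.
rewrite (_ : @enorm R n = fun x => (\sum_(i < n) (tnth x i : R) ^+ 2) `^ 2^-1).
  apply: (measurableT_comp (measurable_powR _)).
  by apply: measurable_sum => i; apply: measurable_funX; exact: measurable_tnth.
apply/funext => x; rewrite powR12_sqrt// sumr_ge0// => i _; exact: sqr_ge0.
Qed.

Lemma measurable_edist : measurable_fun [set: X * X] (fun z => edist z.1 z.2).
Proof.
rewrite (_ : (fun z => _) = fun z : X * X =>
    (\sum_(i < n) ((tnth z.1 i : R) - tnth z.2 i) ^+ 2) `^ 2^-1); last first.
  apply/funext => z; rewrite powR12_sqrt// sumr_ge0// => i _; exact: sqr_ge0.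
apply: (measurableT_comp (measurable_powR _)).
apply: measurable_sum => i; apply: measurable_funX; apply: measurable_funB.
  exact: (measurableT_comp (measurable_tnth i) measurable_fst).
exact: (measurableT_comp (measurable_tnth i) measurable_snd).
Qed.

Definition dilate rho y : X := affine [tuple (0 : R) | i < n] rho y.

Lemma measurable_dilate rho : measurable_fun [set: X] (dilate rho).
Proof. exact: measurable_affine. Qed.

Lemma tnth_dilate rho y i : tnth (dilate rho y) i = rho * tnth y i :> R.
Proof. by rewrite !tnth_mktuple add0r. Qed.

Lemma enorm_dilate rho y : 0 <= rho -> enorm (dilate rho y) = rho * enorm y.
Proof.
move=> rho0; rewrite /enorm -[in RHS](ger0_norm rho0) -sqrtr_sqr -sqrtrM ?sqr_ge0//.
by congr Num.sqrt; rewrite mulr_sumr; apply: eq_bigr => i _; rewrite tnth_dilate exprMn.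
Qed.

Lemma edist_dilate rho x y : 0 <= rho ->
  edist (dilate rho x) (dilate rho y) = rho * edist x y.
Proof.
move=> rho0; rewrite /edist -[in RHS](ger0_norm rho0) -sqrtr_sqr -sqrtrM ?sqr_ge0//.
congr Num.sqrt; rewrite mulr_sumr; apply: eq_bigr => i _.
by rewrite !tnth_dilate -mulrBr exprMn.
Qed.

Lemma edist_affine x y : edist x (affine x 1 y) = enorm y.
Proof.
congr Num.sqrt; apply: eq_bigr => i _.
by rewrite tnth_mktuple mul1r opprD addNKr sqrrN.
Qed.

Definition eball rho : set X := [set y | enorm y <= rho].

Lemma measurable_eball rho : measurable (eball rho).
Proof.
have := measurable_enorm measurableT (measurable_itv `]-oo, rho]).
by rewrite setTI; congr measurable.
Qed.

Lemma lebesgue_ball_le rho : 0 <= rho ->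
  (lam (eball rho) <= ((2 * rho) ^+ n)%:E)%E.
Proof.
move=> rho0; pose A (i : 'I_n) : set (measurableTypeR R) := `[- rho, rho]%classic.
apply: (@le_trans _ _ (lam [set x | forall i, A i (tnth x i)])).
  apply: le_measure; rewrite ?inE.
  - exact: measurable_eball.
  - rewrite (_ : [set _ | _] = \bigcap_(i in [set: 'I_n])
        ((fun x : X => tnth x i : measurableTypeR R) @^-1` (A i))).
      apply: fin_bigcap_measurable => // i _; rewrite -[X in measurable X]setTI.
      by apply: measurable_tnth => //; exact: measurable_itv.
    by apply/seteqP; split=> x /= h i; [move=> _|]; exact: h.
  - move=> y /= yr i; rewrite /A /= in_itv/= -ler_norml.
    apply: ler_of_sqr => //; rewrite real_normK ?num_real//.
    apply: (@le_trans _ _ (enorm y ^+ 2)); last first.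
      by rewrite lerXn2r ?nnegrE ?enorm_ge0.
    by rewrite enorm_sqr (bigD1 i)//= lerDl sumr_ge0// => j _; exact: sqr_ge0.
rewrite lebesgue_tuple_box; last by move=> i; exact: measurable_itv.
rewrite (eq_bigr (fun=> (2 * rho)%:E)); last first.
  move=> i _; rewrite /A lebesgue_measure_itv/= lte_fin.
  case: ltP => h; first by rewrite -EFinB; congr EFin; ring.
  by congr EFin; lra.
by rewrite prodEFin prodr_const card_ord.
Qed.

(** f is dominated by the sum of c_j times the indicators of the balls of radius rho_j. Using balls
    instead of shells, only an upper bound on the volume of balls enters. *)
Lemma integral_dyadic_le (f : X -> R) (c rho : nat -> R) (a z : R) :
  measurable_fun [set: X] f -> (forall y, 0 <= f y) ->
  (forall j, 0 <= c j) -> (forall j, 0 <= rho j) ->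
  (forall y, f y != 0 -> exists j, f y <= c j /\ enorm y <= rho j) ->
  0 <= a -> 0 < z < 1 -> (forall j, c j * (2 * rho j) ^+ n <= a * z ^+ j) ->
  (\int[lam]_y (f y)%:E <= (a / (1 - z))%:E)%E.
Proof.
move=> mf f0 c0 rho0 fP a0 z01 cz.
pose t j y : \bar R := ((c j)%:E * (\1_(eball (rho j)) y)%:E)%E.
have t0 j y : (0 <= t j y)%E by rewrite /t -EFinM lee_fin mulr_ge0.
have mt j : measurable_fun [set: X] (t j).
  apply: emeasurable_funM; first exact: measurable_cst.
  apply/measurable_EFinP; apply: measurable_indic; exact: measurable_eball.
apply: (@le_trans _ _ (\int[lam]_y (\sum_(j <oo) t j y)%E)%E).
  apply: ge0_int_le.
  - exact/measurable_EFinP.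
  - by apply: ge0_emeasurable_sum.
  - by move=> y; rewrite lee_fin.
  move=> y; have [->|/fP[j [fc yj]]] := eqVneq (f y) 0.
    by apply: nneseries_ge0.
  apply: (@le_trans _ _ (\sum_(0 <= i < j.+1) t i y)%E); last first.
    by apply: nneseries_lim_ge.
  rewrite big_nat_recr//=; apply: (@le_trans _ _ (t j y)).
    by rewrite /t indicE mem_set// -EFinM mulr1 lee_fin.
  by rewrite leeDr// sume_ge0.
rewrite integral_nneseries//.
apply: (@le_trans _ _ (\sum_(j <oo) (a * z ^+ j)%:E)%E); last first.
  exact: nneseries_geometric_le.
apply: lee_nneseries => [j _ _|j _]; first exact: integral_ge0.
have mi : measurable_fun [set: X] (fun y => (\1_(eball (rho j)) y)%:E : \bar R).
  by apply/measurable_EFinP; apply: measurable_indic; exact: measurable_eball.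
have i0 y : (0 <= (\1_(eball (rho j)) y)%:E :> \bar R)%E by rewrite lee_fin.
rewrite /t (ge0_intZ lam mi (c0 j) i0).
rewrite integral_indic// ?setIT; last exact: measurable_eball.
apply: (@le_trans _ _ ((c j)%:E * ((2 * rho j) ^+ n)%:E)%E).
  by apply: lee_wpmul2l; [rewrite lee_fin|exact: lebesgue_ball_le].
by rewrite -EFinM lee_fin.
Qed.

Lemma dyadic_below (t rho : R) : 0 < t -> t <= rho ->
  exists j, rho * (2^-1) ^+ j.+1 <= t /\ t <= rho * (2^-1) ^+ j.
Proof.
move=> t0 trho; have rho0 : 0 < rho by exact: lt_le_trans trho.
have ex : exists k, rho * (2^-1) ^+ k.+1 <= t.
  exists (Num.bound (rho / t)).
  have h : rho / t < (Num.bound (rho / t))%:R by apply: archi_boundP; rewrite divr_ge0 ?ltW.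
  rewrite exprVn ler_pdivrMr ?exprn_gt0// mulrC -ler_pdivrMr//.
  apply: (le_trans (ltW h)); rewrite -natrX ler_nat.
  by apply: ltnW; apply: ltn_trans (ltn_expl _ _); rewrite // ltnS.
case: (ex_minnP ex) => j jP jmin; exists j; split => //.
case: j jP jmin => [|j] _ jmin; first by rewrite expr0 mulr1.
by rewrite leNgt; apply/negP => /ltW /jmin; rewrite ltnn.
Qed.

Lemma dyadic_above (t rho : R) : 0 < rho -> rho <= t ->
  exists j, rho * 2 ^+ j <= t /\ t <= rho * 2 ^+ j.+1.
Proof.
move=> rho0 rhot; have [j []] := dyadic_below rho0 rhot.
rewrite !exprVn ler_pdivrMr ?exprn_gt0// ler_pdivlMr ?exprn_gt0// => h1 h2.
by exists j.
Qed.

Lemma powR_exprn (x b : R) k : 0 <= x -> (x ^+ k) `^ b = (x `^ b) ^+ k.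
Proof. by move=> x0; rewrite -!powR_mulrn ?powR_ge0// powRAC. Qed.

Lemma half_powR_lt1 (b : R) : 0 < b -> 0 < (2^-1 : R) `^ b < 1.
Proof.
move=> b0; rewrite powR_gt0//=.
rewrite -[ltRHS](_ : (1 : R) `^ b = 1); last by rewrite powR1.
by apply: gt0_ltr_powR; rewrite ?nnegrE//; lra.
Qed.

Lemma measurable_powR_cut (b : R) (P : R -> bool) :
  measurable [set t | P t] ->
  measurable_fun [set: X] (fun y => enorm y `^ b * (P (enorm y))%:R).
Proof.
move=> mP; apply: (@measurableT_comp _ _ _ _ _ _ (fun t : R => t `^ b * (P t)%:R)).
  apply: measurable_funM; first exact: measurable_powR.
  rewrite (_ : (fun t => _) = \1_[set t | P t]); first exact: measurable_indic.
  by apply/funext => t; rewrite indicE; case: (boolP (P t)) => Pt;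
    [rewrite mem_set|rewrite memNset//; exact/negP].
exact: measurable_enorm.
Qed.

Lemma integral_enorm_powR_inner (b : R) : 0 < b -> b < n%:R ->
  exists2 C : R, 0 <= C & forall rho, 0 < rho ->
  (\int[lam]_y (enorm y `^ (b - n%:R) * (enorm y <= rho)%R%:R)%:E
    <= (C * rho `^ b)%:E)%E.
Proof.
move=> b0 bn; have z01 := half_powR_lt1 b0.
set z := (2^-1 : R) `^ b in z01.
have z0 : 0 <= 1 - z by case/andP: z01; lra.
exists (4 ^+ n * z / (1 - z)).
  by rewrite divr_ge0// mulr_ge0 ?exprn_ge0// powR_ge0.
move=> rho rho0; pose s j := rho * (2^-1) ^+ j.+1.
have s0 j : 0 < s j by rewrite mulr_gt0 ?exprn_gt0// invr_gt0.
rewrite (_ : 4 ^+ n * z / (1 - z) * _ = (4 ^+ n * z * rho `^ b) / (1 - z)); last by ring.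
apply: (@integral_dyadic_le _ (fun j => s j `^ (b - n%:R)) (fun j => rho * (2^-1) ^+ j)) => //.
- apply: (@measurable_powR_cut _ (fun t => t <= rho)).
  rewrite (_ : [set t | _] = `]-oo, rho]%classic); first exact: measurable_itv.
  by apply/seteqP; split => y /=; rewrite in_itv/=.
- by move=> y; rewrite mulr_ge0// powR_ge0.
- by move=> j; exact: powR_ge0.
- by move=> j; rewrite mulr_ge0 ?exprn_ge0// ?invr_ge0// ltW.
- move=> y; have [yrho|] := boolP (enorm y <= rho); last by rewrite mulr0 eqxx.
  (* At the origin the power is 0 by convention, its exponent b - n being nonzero; so a nonzero
     value forces y to be away from the origin, in some dyadic shell. *)
  rewrite mulr1 powR_eq0 negb_and => yn0.
  have y0 : 0 < enorm y.
    rewrite lt0r enorm_ge0 andbT; case/orP: yn0 => //.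
    by rewrite negbK subr_eq0 => /eqP e; move: bn; rewrite e ltxx.
  have [j [j1 j2]] := dyadic_below y0 yrho; exists j; split => //.
  rewrite -[b - _]opprB !powRN lef_pV2 ?posrE ?powR_gt0//.
  apply: ge0_ler_powR; rewrite ?nnegrE ?enorm_ge0 ?(ltW (s0 j)) ?subr_ge0 ?(ltW bn)//.
- by rewrite !mulr_ge0 ?exprn_ge0 ?powR_ge0.
- move=> j; have -> : 2 * (rho * 2^-1 ^+ j) = 4 * s j.
    by rewrite /s exprS; field.
  rewrite exprMn mulrCA -[s j ^+ n]powR_mulrn ?(ltW (s0 j))//.
  rewrite -powRD ?subrK; last by rewrite (gt_eqF (s0 j)) implybT.
  rewrite /s powRM ?exprn_ge0 ?(ltW rho0)// powR_exprn// -/z exprS.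
  by rewrite le_eqVlt; apply/orP; left; apply/eqP; ring.
Qed.

Lemma integral_enorm_powR_outer (b : R) : 0 < b ->
  exists2 C : R, 0 <= C & forall rho, 0 < rho ->
  (\int[lam]_y (enorm y `^ (- b - n%:R) * (rho <= enorm y)%R%:R)%:E
    <= (C * rho `^ (- b))%:E)%E.
Proof.
move=> b0; have z01 := half_powR_lt1 b0.
set z := (2^-1 : R) `^ b in z01.
have z0 : 0 <= 1 - z by case/andP: z01; lra.
exists (4 ^+ n / (1 - z)); first by rewrite divr_ge0// exprn_ge0.
move=> rho rho0; pose s j := rho * 2 ^+ j.
have s0 j : 0 < s j by rewrite mulr_gt0 ?exprn_gt0.
rewrite (_ : 4 ^+ n / (1 - z) * _ = (4 ^+ n * rho `^ (- b)) / (1 - z)); last by ring.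
apply: (@integral_dyadic_le _ (fun j => s j `^ (- b - n%:R)) (fun j => rho * 2 ^+ j.+1)) => //.
- apply: (@measurable_powR_cut _ (fun t => rho <= t)).
  rewrite (_ : [set t | _] = `[rho, +oo[%classic); first exact: measurable_itv.
  by apply/seteqP; split => y /=; rewrite in_itv/= andbT.
- by move=> y; rewrite mulr_ge0// powR_ge0.
- by move=> j; exact: powR_ge0.
- by move=> j; rewrite mulr_ge0 ?exprn_ge0// ltW.
- move=> y; have [yrho|] := boolP (rho <= enorm y); last by rewrite mulr0 eqxx.
  move=> _; have [j [j1 j2]] := dyadic_above rho0 yrho; exists j; split => //.
  have y0 : 0 < enorm y by exact: lt_le_trans yrho.
  rewrite mulr1 -opprD !powRN lef_pV2 ?posrE ?powR_gt0//.
  apply: ge0_ler_powR; rewrite ?nnegrE ?enorm_ge0 ?(ltW (s0 j))//.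
  by rewrite addr_ge0// ltW.
- by rewrite !mulr_ge0 ?exprn_ge0 ?powR_ge0.
- move=> j; have -> : 2 * (rho * 2 ^+ j.+1) = 4 * s j.
    by rewrite /s exprS; ring.
  rewrite exprMn mulrCA -[s j ^+ n]powR_mulrn ?(ltW (s0 j))//.
  rewrite -powRD ?subrK; last by rewrite (gt_eqF (s0 j)) implybT.
  rewrite /s powRM ?exprn_ge0 ?(ltW rho0)// powR_exprn//.
  have -> : 2 `^ (- b) = z by rewrite /z -powR_inv1// -powRrM mulN1r.
  by rewrite le_eqVlt; apply/orP; left; apply/eqP; ring.
Qed.

End euclidean.

(** * The Stein-Weiss kernel *)

Lemma powRD_gt0 (R : realType) (x a b : R) : 0 < x -> x `^ (a + b) = x `^ a * x `^ b.
Proof. by move=> x0; rewrite powRD//; apply/implyP => _; rewrite gt_eqF. Qed.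

Lemma powRN_le (R : realType) (x y p : R) : 0 < x -> x <= y -> 0 <= p ->
  y `^ (- p) <= x `^ (- p).
Proof.
move=> x0 xy p0; have y0 : 0 < y by exact: lt_le_trans xy.
rewrite !powRN lef_pV2 ?posrE ?powR_gt0//.
by apply: ge0_ler_powR; rewrite ?nnegrE// ltW.
Qed.

Section kernel.
Variables (R : realType) (n : nat).
Hypothesis n_gt0 : (0 < n)%N.
Local Notation X := (euclid R n).
Local Notation lam := (lebesgue_tuple R n).
Local Notation nr := (n%:R : R).
Implicit Types (x y : X) (A B : R).

(** The exponents add up to 0, so [kap] is invariant under simultaneous dilations. Powers of [kap]
    and the shifts in [kap_ratio] stay in this family, which is why A and B are arguments. *)
Definition kap A B x y : R :=
  enorm x `^ A * edist x y `^ (- (A + B)) * enorm y `^ B.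

Definition wt x : R := enorm x `^ (- nr).

Lemma kapC A B x y : kap A B x y = kap B A y x.
Proof. by rewrite /kap edistC (addrC A B) mulrC mulrA mulrAC. Qed.

Lemma kap_ge0 A B x y : 0 <= kap A B x y.
Proof. by rewrite !mulr_ge0 ?powR_ge0. Qed.

Lemma kap_powR A B p x y : kap A B x y `^ p = kap (A * p) (B * p) x y.
Proof.
by rewrite /kap !powRM ?mulr_ge0 ?powR_ge0// -!powRrM mulNr mulrDl.
Qed.

Lemma kern_kap A B : kern (kap A B).
Proof.
split=> [|x y]; last exact: kap_ge0.
have me := @measurable_enorm R n.
apply: measurable_funM; first apply: measurable_funM.
- exact: (measurableT_comp (measurable_powR _) (measurableT_comp me measurable_fst)).
- exact: (measurableT_comp (measurable_powR _) (@measurable_edist R n)).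
- exact: (measurableT_comp (measurable_powR _) (measurableT_comp me measurable_snd)).
Qed.

Lemma nng_wt : nng wt.
Proof.
split=> [|x]; last exact: powR_ge0.
exact: (measurableT_comp (measurable_powR _) (@measurable_enorm R n)).
Qed.

(** One term for each region: |y| <= |x|/2, where |x-y| >= |x|/2; |y| >= 2|x|, where |x-y| >= |y|/2;
    and comparable norms, where |x-y| <= 4|x| and only the singularity on the diagonal varies. *)
Let kap_pointwise A B x y : 0 < A -> 0 < B -> 0 < enorm x ->
  kap A B x y * wt y <=
    enorm x `^ A * (enorm x / 2) `^ (- (A + B)) *
      (enorm y `^ (B - nr) * (enorm y <= enorm x)%R%:R) +
    enorm x `^ A * (2^-1) `^ (- (A + B)) *
      (enorm y `^ (- A - nr) * (enorm x <= enorm y)%R%:R) +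
    enorm x `^ A * (2 * enorm x) `^ B * (enorm x / 2) `^ (- nr) *
      (edist x y `^ (- (A + B)) * (edist x y <= 4 * enorm x)%R%:R).
Proof.
move=> A0 B0; set N := enorm x => N0.
have t0 := enorm_ge0 y; set t := enorm y in t0 *.
have e0 := edist_ge0 x y; set e := edist x y in e0 *.
have AB0 : 0 <= A + B by rewrite addr_ge0// ltW.
have sqr_mono (a b : R) : 0 <= a -> a <= b -> a ^+ 2 <= b ^+ 2.
  by move=> a0 ab; rewrite lerXn2r ?nnegrE// (le_trans a0).
set f1 := (X in X + _ + _); set f2 := (X in _ + X + _); set f3 := (X in _ + _ + X).
have f10 : 0 <= f1 by rewrite !mulr_ge0 ?powR_ge0.
have f20 : 0 <= f2 by rewrite !mulr_ge0 ?powR_ge0.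
have f30 : 0 <= f3 by rewrite !mulr_ge0 ?powR_ge0.
rewrite /kap /wt -/N -/t -/e.
have h1 : N ^+ 2 <= 2 * e ^+ 2 + 2 * t ^+ 2 by exact: enorm_sqr_le.
have h2 : t ^+ 2 <= 2 * e ^+ 2 + 2 * N ^+ 2.
  by rewrite /e edistC; exact: enorm_sqr_le.
have h3 : e ^+ 2 <= 2 * N ^+ 2 + 2 * t ^+ 2 by exact: edist_sqr_le.
have [/eqP t_eq0|t_neq0] := boolP (t == 0).
  rewrite t_eq0 (powR0 (lt0r_neq0 B0)) mulr0 mul0r.
  by rewrite !addr_ge0.
have t_gt0 : 0 < t by rewrite lt0r t_neq0.
have [tN|tN] := lerP t (N / 2).
  apply: (@le_trans _ _ f1); last by rewrite -addrA lerDl addr_ge0.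
  rewrite /f1 (_ : t <= N = true) ?mulr1; last by lra.
  rewrite (powRD_gt0 _ _ t_gt0) mulrA ler_wpM2r ?powR_ge0//.
  rewrite ler_wpM2r ?powR_ge0// ler_wpM2l ?powR_ge0//.
  apply: powRN_le => //; first by lra.
  apply: ler_of_sqr => //.
  have : t ^+ 2 <= (N / 2) ^+ 2 by apply: sqr_mono; lra.
  by lra.
have [Nt|Nt] := lerP (2 * N) t.
  apply: (@le_trans _ _ f2); last by rewrite addrAC lerDr addr_ge0.
  rewrite /f2 (_ : N <= t = true) ?mulr1; last by lra.
  have -> : t `^ (- A - nr) = t `^ (- (A + B)) * t `^ B * t `^ (- nr).
    by rewrite -!powRD_gt0//; congr powR; ring.
  rewrite !mulrA ler_wpM2r ?powR_ge0// ler_wpM2r ?powR_ge0//.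
  rewrite -!mulrA ler_wpM2l ?powR_ge0// -powRM ?(ltW t_gt0)//.
  apply: powRN_le => //; first by rewrite mulr_gt0.
  apply: ler_of_sqr => //.
  have : N ^+ 2 <= (t / 2) ^+ 2 by apply: sqr_mono; lra.
  by rewrite !exprMn; lra.
apply: (@le_trans _ _ f3); last by rewrite lerDr addr_ge0.
have e4 : e <= 4 * N.
  apply: ler_of_sqr; first by lra.
  have : t ^+ 2 <= (2 * N) ^+ 2 by apply: sqr_mono; lra.
  by rewrite !exprMn; have := sqr_ge0 N; lra.
rewrite /f3 e4 mulr1.
have hB : t `^ B <= (2 * N) `^ B.
  by apply: ge0_ler_powR; rewrite ?nnegrE ?(ltW B0)//; lra.
have hn : t `^ (- nr) <= (N / 2) `^ (- nr).
  by apply: powRN_le => //; [lra|exact: ltW].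
apply: (@le_trans _ _ (N `^ A * e `^ (- (A + B)) * (2 * N) `^ B * (N / 2) `^ (- nr))).
  by rewrite ler_pM ?mulr_ge0 ?powR_ge0// ler_wpM2l ?mulr_ge0 ?powR_ge0.
by rewrite le_eqVlt; apply/orP; left; apply/eqP; ring.
Qed.

(** B > 0 gives convergence at the origin, A > 0 at infinity, and A + B < n at the diagonal. By
    homogeneity the powers of |x| cancel in each piece, so the bound is uniform in x. *)
Lemma integral_kap_wt A B : 0 < A -> 0 < B -> A + B < nr ->
  exists2 C : R, 0 <= C & forall x,
    (\int[lam]_y (kap A B x y * wt y)%:E <= C%:E)%E.
Proof.
move=> A0 B0 ABn.
have Bn : B < nr by lra.
have b0 : 0 < nr - (A + B) by lra.
have bn : nr - (A + B) < nr by lra.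
have [C1 C10 C1P] := integral_enorm_powR_inner B0 Bn.
have [C2 C20 C2P] := integral_enorm_powR_outer n A0.
have [C3 C30 C3P] := integral_enorm_powR_inner b0 bn.
exists (C1 * (2^-1) `^ (- (A + B)) + C2 * (2^-1) `^ (- (A + B)) +
  C3 * (2 `^ B * (2^-1) `^ (- nr) * 4 `^ (nr - (A + B)))).
  by rewrite !addr_ge0 ?mulr_ge0 ?powR_ge0.
move=> x; have [x0|x0] := eqVneq (enorm x) 0.
  under eq_integral => y _ do rewrite /kap x0 (powR0 (lt0r_neq0 A0)) !mul0r.
  by rewrite integral0 lee_fin !addr_ge0 ?mulr_ge0 ?powR_ge0.
have N0 : 0 < enorm x by rewrite lt0r x0 enorm_ge0.
set N := enorm x in N0 *.
pose c1 := N `^ A * (N / 2) `^ (- (A + B)).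
pose c2 := N `^ A * (2^-1) `^ (- (A + B)).
pose c3 := N `^ A * (2 * N) `^ B * (N / 2) `^ (- nr).
have c10 : 0 <= c1 by rewrite mulr_ge0 ?powR_ge0.
have c20 : 0 <= c2 by rewrite mulr_ge0 ?powR_ge0.
have c30 : 0 <= c3 by rewrite !mulr_ge0 ?powR_ge0.
pose g1 y := enorm y `^ (B - nr) * (enorm y <= N)%R%:R.
pose g2 y := enorm y `^ (- A - nr) * (N <= enorm y)%R%:R.
pose h (t : R) := t `^ (- (A + B)) * (t <= 4 * N)%R%:R.
pose g3 y := h (edist x y).
have g10 y : 0 <= g1 y by rewrite mulr_ge0 ?powR_ge0.
have g20 y : 0 <= g2 y by rewrite mulr_ge0 ?powR_ge0.
have g30 y : 0 <= g3 y by rewrite mulr_ge0 ?powR_ge0.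
have mle (c : R) : measurable [set t : R | t <= c].
  rewrite (_ : [set t | _] = `]-oo, c]%classic); first exact: measurable_itv.
  by apply/seteqP; split => t /=; rewrite in_itv/=.
have mge (c : R) : measurable [set t : R | c <= t].
  rewrite (_ : [set t | _] = `[c, +oo[%classic); first exact: measurable_itv.
  by apply/seteqP; split => t /=; rewrite in_itv/= andbT.
have mg1 : measurable_fun [set: X] g1 by exact: (measurable_powR_cut _ (mle N)).
have mg2 : measurable_fun [set: X] g2 by exact: (measurable_powR_cut _ (mge N)).
have mh : measurable_fun [set: R] h.
  apply: measurable_funM; first exact: measurable_powR.
  rewrite (_ : (fun t => _) = \1_[set t : R | t <= 4 * N]).
    by apply: measurable_indic; exact: mle.
  apply/funext => t; rewrite indicE; case: (boolP (t <= 4 * N)) => tN.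
    by rewrite mem_set.
  by rewrite memNset//; exact/negP.
have mg3 : measurable_fun [set: X] g3.
  apply: (measurableT_comp mh).
  exact: (measurableT_comp (@measurable_edist R n) (pair1_measurable x)).
have i3 : (\int[lam]_y (g3 y)%:E <= (C3 * (4 * N) `^ (nr - (A + B)))%:E)%E.
  rewrite (integral_affine x ltr01); last 2 first.
  - exact/measurable_EFinP.
  - by move=> y; rewrite lee_fin.
  rewrite expr1n mul1e; apply: le_trans (C3P _ (mulr_gt0 (ltr0n _ 4) N0)).
  rewrite le_eqVlt; apply/orP; left; apply/eqP; apply: eq_integral => y _.
  by rewrite /g3 /h edist_affine (_ : nr - (A + B) - nr = - (A + B))//; ring.
have mZ (c : R) (g : X -> R) : measurable_fun [set: X] g ->
    measurable_fun [set: X] (fun y => (c%:E * (g y)%:E)%E).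
  by move=> mg; apply: emeasurable_funM; [exact: measurable_cst|exact/measurable_EFinP].
have E1 : (\int[lam]_y (c1%:E * (g1 y)%:E) <= (C1 * (2^-1) `^ (- (A + B)))%:E)%E.
  rewrite ge0_intZ//; last exact/measurable_EFinP.
  apply: (@le_trans _ _ (c1%:E * (C1 * N `^ B)%:E)%E).
    by apply: lee_wpmul2l; [rewrite lee_fin|exact: C1P].
  rewrite -EFinM lee_fin /c1 powRM ?(ltW N0)//.
  have -> : N `^ (- (A + B)) = (N `^ A * N `^ B)^-1 by rewrite -powRD_gt0// powRN.
  have pA : N `^ A != 0 by rewrite gt_eqF// powR_gt0.
  have pB : N `^ B != 0 by rewrite gt_eqF// powR_gt0.
  by rewrite le_eqVlt; apply/orP; left; apply/eqP; field; rewrite pA pB.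
have E2 : (\int[lam]_y (c2%:E * (g2 y)%:E) <= (C2 * (2^-1) `^ (- (A + B)))%:E)%E.
  rewrite ge0_intZ//; last exact/measurable_EFinP.
  apply: (@le_trans _ _ (c2%:E * (C2 * N `^ (- A))%:E)%E).
    by apply: lee_wpmul2l; [rewrite lee_fin|exact: C2P].
  rewrite -EFinM lee_fin /c2 [N `^ (- A)]powRN.
  have pA : N `^ A != 0 by rewrite gt_eqF// powR_gt0.
  by rewrite le_eqVlt; apply/orP; left; apply/eqP; field; rewrite pA.
have E3 : (\int[lam]_y (c3%:E * (g3 y)%:E) <=
    (C3 * (2 `^ B * (2^-1) `^ (- nr) * 4 `^ (nr - (A + B))))%:E)%E.
  rewrite ge0_intZ//; last exact/measurable_EFinP.
  apply: (@le_trans _ _ (c3%:E * (C3 * (4 * N) `^ (nr - (A + B)))%:E)%E).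
    by apply: lee_wpmul2l; [rewrite lee_fin|exact: i3].
  rewrite -EFinM lee_fin /c3 !powRM ?(ltW N0)//.
  have -> : N `^ (nr - (A + B)) = N `^ nr * (N `^ A * N `^ B)^-1.
    by rewrite powRD_gt0// powRN powRD_gt0.
  rewrite [N `^ (- nr)]powRN.
  have pA : N `^ A != 0 by rewrite gt_eqF// powR_gt0.
  have pB : N `^ B != 0 by rewrite gt_eqF// powR_gt0.
  have pn : N `^ nr != 0 by rewrite gt_eqF// powR_gt0.
  by rewrite le_eqVlt; apply/orP; left; apply/eqP; field; rewrite pA pB pn.
apply: (@le_trans _ _ (\int[lam]_y (c1%:E * (g1 y)%:E + c2%:E * (g2 y)%:E
   + c3%:E * (g3 y)%:E))%E).
  apply: ge0_int_le.
  - apply/measurable_EFinP; apply: measurable_funM; last exact: nng_wt.1.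
    exact: measurable_kern (kern_kap A B).
  - by apply: emeasurable_funD; [apply: emeasurable_funD|]; exact: mZ.
  - by move=> y; rewrite lee_fin mulr_ge0 ?kap_ge0 ?powR_ge0.
  - by move=> y; rewrite -!EFinM -!EFinD lee_fin; exact: kap_pointwise.
have Z0 (c : R) (g : X -> R) : 0 <= c -> (forall y, 0 <= g y) ->
    forall y, (0 <= c%:E * (g y)%:E)%E.
  by move=> c0 g0 y; rewrite mule_ge0 ?lee_fin.
rewrite ge0_intD; last 4 first.
- by apply: emeasurable_funD; exact: mZ.
- exact: mZ.
- by move=> y; rewrite adde_ge0// Z0.
- exact: Z0.
rewrite ge0_intD; [|exact: mZ|exact: mZ|exact: Z0|exact: Z0].
by rewrite !EFinD; apply: leeD => //; exact: leeD.
Qed.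

End kernel.

Lemma measurable_natr_le d (T : measurableType d) (R : realType) (f g : T -> R) :
  measurable_fun [set: T] f -> measurable_fun [set: T] g ->
  measurable_fun [set: T] (fun z => (f z <= g z)%R%:R : R).
Proof.
move=> mf mg; rewrite (_ : (fun z => _) = \1_[set z | f z <= g z]).
  apply: measurable_indic; rewrite -[X in measurable X]setTI.
  exact: measurable_fun_le.
apply/funext => z; rewrite indicE; case: (boolP (f z <= g z)) => fg.
  by rewrite mem_set.
by rewrite memNset//; exact/negP.
Qed.

(** * Truncation of the kernel and the local energy bound *)

Section stein_weiss_kernel.
Variables (R : realType) (n : nat).
Hypothesis n_gt0 : (0 < n)%N.
Local Notation X := (euclid R n).
Local Notation lam := (lebesgue_tuple R n).
Local Notation nr := (n%:R : R).
Local Notation kap := (@kap R n).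
Local Notation wt := (@wt R n).

Let nr_gt0 : 0 < nr. Proof. by rewrite ltr0n. Qed.

(** The indicator of N/L <= |y| <= L N, written without division so that |y| and N play symmetric
    roles ([annC]). *)
Definition ann (L N : R) (y : X) : R :=
  (enorm y <= L * N)%R%:R * (N <= L * enorm y)%R%:R.

Lemma ann_ge0 L N y : 0 <= ann L N y.
Proof. by rewrite mulr_ge0. Qed.

Lemma annC L (x y : X) : ann L (enorm x) y = ann L (enorm y) x.
Proof. by rewrite /ann mulrC. Qed.

Lemma ann_sqr L N y : ann L N y ^+ 2 = ann L N y.
Proof. by rewrite /ann exprMn; do 2 case: (_ <= _); rewrite ?expr1n ?expr0n. Qed.

Lemma measurable_ann L N : measurable_fun [set: X] (ann L N).
Proof.
have me := @measurable_enorm R n.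
apply: measurable_funM; apply: measurable_natr_le => //; exact: measurable_funM.
Qed.

Lemma integral_ann_wt (L N : R) : 0 < L -> 0 <= N ->
  (\int[lam]_y (ann L N y * wt y)%:E <= ((2 * L ^+ 2) ^+ n)%:E)%E.
Proof.
move=> L0; rewrite le0r => /orP[/eqP ->|N0].
  under eq_integral => y _.
    rewrite (_ : ann L 0 y * wt y = 0); last first.
      rewrite /ann mulr0 /wt.
      have := enorm_ge0 y; rewrite le0r => /orP[/eqP ->|y0].
        by rewrite powR0 ?mulr0// oppr_eq0 gt_eqF.
      by rewrite leNgt y0 !mul0r.
    over.
  by rewrite integral0 lee_fin exprn_ge0// mulr_ge0 ?exprn_ge0// ltW.
have LN0 : 0 < N / L by rewrite divr_gt0.
have c0 : 0 <= (N / L) `^ (- nr) by exact: powR_ge0.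
apply: (@le_trans _ _ (\int[lam]_y (((N / L) `^ (- nr))%:E *
    (\1_(eball (L * N)) y)%:E))%E).
  apply: ge0_int_le.
  - apply/measurable_EFinP; apply: measurable_funM; first exact: measurable_ann.
    exact: (nng_wt R n).1.
  - apply: emeasurable_funM; first exact: measurable_cst.
    by apply/measurable_EFinP; apply: measurable_indic; exact: measurable_eball.
  - by move=> y; rewrite lee_fin mulr_ge0 ?ann_ge0 ?powR_ge0.
  move=> y; rewrite -EFinM lee_fin indicE /ann.
  have [yLN|_] := boolP (enorm y <= L * N); last by rewrite !mul0r mulr_ge0.
  rewrite mem_set// mul1r mulr1.
  have [yL|_] := boolP (N <= L * enorm y); last by rewrite mul0r.
  by rewrite mul1r /wt; apply: powRN_le => //; rewrite ler_pdivrMr// mulrC.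
have mi : measurable_fun [set: X] (fun y => (\1_(eball (L * N)) y)%:E : \bar R).
  by apply/measurable_EFinP; apply: measurable_indic; exact: measurable_eball.
have i0 (y : X) : (0 <= (\1_(eball (L * N)) y)%:E :> \bar R)%E by rewrite lee_fin.
rewrite (ge0_intZ lam mi c0 i0) integral_indic// ?setIT; last exact: measurable_eball.
have LN : 0 <= L * N by rewrite mulr_ge0// ltW.
apply: (@le_trans _ _ (((N / L) `^ (- nr))%:E * ((2 * (L * N)) ^+ n)%:E)%E).
  by apply: lee_wpmul2l => //; exact: lebesgue_ball_le.
rewrite -EFinM lee_fin powRN powR_mulrn ?(ltW LN0)// -exprVn -exprMn.
by rewrite le_eqVlt (_ : (N / L)^-1 * _ = 2 * L ^+ 2) ?eqxx//; field; rewrite !gt_eqF.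
Qed.

Lemma integral_kap_wt2 (A B : R) : 0 < A -> 0 < B -> A + B < nr ->
  exists2 C : R, 0 <= C &
    (forall x, (\int[lam]_y (kap A B x y * wt y)%:E <= C%:E)%E) /\
    (forall y, (\int[lam]_x (kap A B x y * wt x)%:E <= C%:E)%E).
Proof.
move=> A0 B0 AB.
have [C C0 CP] := integral_kap_wt A0 B0 AB.
have BA : B + A < nr by rewrite addrC.
have [C' C'0 C'P] := integral_kap_wt B0 A0 BA.
exists (C + C'); first exact: addr_ge0.
split=> x; [apply: le_trans (CP x) _|].
  by rewrite lee_fin lerDl.
under eq_integral do rewrite kapC.
by apply: le_trans (C'P x) _; rewrite lee_fin lerDr.
Qed.

Variables (A B r q : R).
Hypothesis A0 : 0 < A.
Hypothesis B0 : 0 < B.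
Hypothesis r2 : 2 < r.
Hypothesis qE : q^-1 = 2^-1 + r^-1.
Hypothesis qAB : q * (A + B) < nr.

Let r0 : 0 < r. Proof. exact: lt_trans r2. Qed.
Let q0 : 0 < q. Proof. by rewrite -invr_gt0 qE addr_gt0// invr_gt0. Qed.

Local Notation k := (kap A B).
Definition sw_kernel : X -> X -> R := wkern r wt k.
Local Notation K := sw_kernel.

Lemma kern_sw : kern K.
Proof. by apply: kern_wkern; [exact: nng_wt|exact: kern_kap]. Qed.

Definition dom (L : R) (x y : X) : R := (k x y <= L)%R%:R * ann L (enorm x) y.
Definition kin (L : R) (x y : X) : R := k x y * dom L x y.
Definition kout (L : R) (x y : X) : R := k x y * (1 - dom L x y).

Lemma dom01 L x y : dom L x y = 0 \/ dom L x y = 1.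
Proof.
rewrite /dom /ann; do 3 case: (_ <= _); rewrite ?mulr1 ?mul1r ?mulr0 ?mul0r; by [left|right].
Qed.

Lemma measurable_dom L : measurable_fun [set: X * X] (fun z => dom L z.1 z.2).
Proof.
have m1 : measurable_fun [set: X * X] (fun z => enorm z.1).
  exact: (measurableT_comp (@measurable_enorm R n) measurable_fst).
have m2 : measurable_fun [set: X * X] (fun z => enorm z.2).
  exact: (measurableT_comp (@measurable_enorm R n) measurable_snd).
apply: measurable_funM.
  by apply: measurable_natr_le => //; exact: (kern_kap n A B).1.
by apply: measurable_funM; apply: measurable_natr_le => //; exact: measurable_funM.
Qed.

Lemma kern_kin L : kern (kin L).
Proof.
split=> [|x y].
  by apply: measurable_funM; [exact: (kern_kap n A B).1|exact: measurable_dom].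
by rewrite mulr_ge0 ?kap_ge0//; case: (dom01 L x y) => ->.
Qed.

Lemma kern_kout L : kern (kout L).
Proof.
split=> [|x y].
  apply: measurable_funM; first exact: (kern_kap n A B).1.
  by apply: measurable_funB => //; exact: measurable_dom.
by rewrite mulr_ge0 ?kap_ge0//; case: (dom01 L x y) => ->; rewrite ?subr0 ?subrr.
Qed.

Lemma kin_le L x y : 0 <= L -> kin L x y <= L * ann L (enorm x) y.
Proof.
move=> L0; rewrite /kin /dom; have [kL|_] := boolP (k x y <= L).
  by rewrite mul1r ler_wpM2r// ann_ge0.
by rewrite mul0r mulr0 mulr_ge0 ?ann_ge0.
Qed.

Lemma kap_ratio (a b e : R) (x y : X) : 0 < enorm x -> 0 < enorm y ->
  kap (a - e) (b + e) x y = kap a b x y * (enorm y / enorm x) `^ e.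
Proof.
move=> x0 y0; rewrite /kap (_ : a - e + (b + e) = a + b); last by ring.
have iE : (enorm x)^-1 `^ e = (enorm x `^ e)^-1.
  by rewrite -powR_inv1 ?(ltW x0)// powRAC powR_inv1// powR_ge0.
rewrite powRM ?invr_ge0 ?(ltW x0) ?(ltW y0)// iE !powRD_gt0// powRN.
move: (enorm x `^ a) (enorm x `^ e)^-1 (enorm y `^ b) (enorm y `^ e) => p1 p2 p3 p4.
by move: (edist x y `^ _) => p5; ring.
Qed.

(** Off the region one of k / L, |y| / (L |x|) and |x| / (L |y|) exceeds 1. Multiplying k^q by its
    e-th power gives a kernel of the same family with perturbed exponents, and the factor L^-e is
    gained. *)
Let kout_pointwise (e L : R) x y : 0 < e -> 0 < L ->
  kout L x y `^ q <= L `^ (- e) *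
    (kap (A * (q + e)) (B * (q + e)) x y + kap (A * q - e) (B * q + e) x y
     + kap (A * q + e) (B * q - e) x y).
Proof.
move=> e0 L0.
have rhs0 : 0 <= L `^ (- e) *
    (kap (A * (q + e)) (B * (q + e)) x y + kap (A * q - e) (B * q + e) x y
     + kap (A * q + e) (B * q - e) x y).
  by rewrite mulr_ge0 ?powR_ge0// !addr_ge0 ?kap_ge0.
rewrite /kout; have [d0|d1] := dom01 L x y; last first.
  by rewrite d1 subrr mulr0 powR0// gt_eqF.
rewrite d0 subr0 mulr1.
have [x0|x0] := eqVneq (enorm x) 0.
  have -> : k x y = 0 by rewrite /kap x0 (powR0 (lt0r_neq0 A0)) !mul0r.
  by rewrite powR0// gt_eqF.
have [y0|y0] := eqVneq (enorm y) 0.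
  have -> : k x y = 0 by rewrite /kap y0 (powR0 (lt0r_neq0 B0)) mulr0.
  by rewrite powR0// gt_eqF.
have xp : 0 < enorm x by rewrite lt0r x0 enorm_ge0.
have yp : 0 < enorm y by rewrite lt0r y0 enorm_ge0.
have L1 : 1 = L `^ (- e) * L `^ e.
  by rewrite powRN mulVf// gt_eqF// powR_gt0.
set k1 := kap (A * (q + e)) _ x y; set k2 := kap (A * q - e) _ x y.
set k3 := kap (A * q + e) _ x y.
have k10 : 0 <= k1 by exact: kap_ge0.
have k20 : 0 <= k2 by exact: kap_ge0.
have k30 : 0 <= k3 by exact: kap_ge0.
have kq0 := powR_ge0 (k x y) q.
suff : L `^ e * k x y `^ q <= k1 + k2 + k3.
  move=> h; rewrite -[leLHS]mul1r L1 -mulrA.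
  by rewrite ler_wpM2l// powR_ge0.
have [kL|Lk] := lerP (k x y) L; last first.
  have kp : 0 < k x y by exact: lt_trans Lk.
  apply: (@le_trans _ _ k1); last by lra.
  rewrite /k1 -kap_powR powRD_gt0// mulrC ler_wpM2l//.
  by apply: ge0_ler_powR; rewrite ?nnegrE ?ltW.
have [yL|yL] := lerP (enorm y) (L * enorm x); last first.
  apply: (@le_trans _ _ k2); last by lra.
  rewrite /k2 kap_ratio// -kap_powR mulrC ler_wpM2l//.
  apply: ge0_ler_powR; rewrite ?nnegrE ?divr_ge0 ?(ltW e0) ?(ltW L0) ?(ltW xp) ?(ltW yp)//.
  by rewrite ler_pdivlMr// ltW.
have [xL|xL] := lerP (enorm x) (L * enorm y); last first.
  apply: (@le_trans _ _ k3); last by lra.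
  rewrite /k3 (kapC (A * q + e)) kap_ratio// (kapC (B * q)) -kap_powR mulrC ler_wpM2l//.
  apply: ge0_ler_powR; rewrite ?nnegrE ?divr_ge0 ?(ltW e0) ?(ltW L0) ?(ltW xp) ?(ltW yp)//.
  by rewrite ler_pdivlMr// ltW.
by move: d0; rewrite /dom /ann kL yL xL !mulr1 => /eqP; rewrite oner_eq0.
Qed.

Lemma kout_bound : exists e C : R, [/\ 0 < e, 0 < C & forall L, 0 < L ->
  (forall x, (\int[lam]_y (kout L x y `^ q * wt y)%:E <= (L `^ (- e) * C)%:E)%E) /\
  (forall y, (\int[lam]_x (kout L x y `^ q * wt x)%:E <= (L `^ (- e) * C)%:E)%E)].
Proof.
have AB0 : 0 < A + B by exact: addr_gt0.
pose m0 := (nr - q * (A + B)) / (A + B) / 2.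
have m00 : 0 < m0 by rewrite !divr_gt0// subr_gt0.
(* Small enough that the three perturbed pairs of exponents remain positive with sum below n: [m0]
   takes half of the room left by q (A + B) < n. *)
pose e := Num.min m0 (Num.min (A * q / 2) (B * q / 2)).
have Aq0 : 0 < A * q by exact: mulr_gt0.
have Bq0 : 0 < B * q by exact: mulr_gt0.
have e0 : 0 < e by rewrite !lt_min m00 !divr_gt0.
have eA : e <= A * q / 2 by rewrite !ge_min lexx !orbT.
have eB : e <= B * q / 2 by rewrite !ge_min lexx !orbT.
have em : e * (A + B) < nr - q * (A + B).
  apply: (@le_lt_trans _ _ (m0 * (A + B))).
    by rewrite ler_wpM2r ?(ltW AB0)// ge_min lexx.
  rewrite /m0 mulrAC divfK ?gt_eqF//.
  by rewrite ltr_pdivrMr// ltr_pMr ?subr_gt0// ltr1n.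
have qe0 : 0 < q + e by exact: addr_gt0.
have h1 : A * (q + e) + B * (q + e) < nr.
  by rewrite (_ : _ + _ = q * (A + B) + e * (A + B)) -?ltrBrDl//; ring.
have h2 : A * q - e + (B * q + e) < nr by rewrite (_ : _ + _ = q * (A + B))//; ring.
have h3 : A * q + e + (B * q - e) < nr by rewrite (_ : _ + _ = q * (A + B))//; ring.
have eA' : 0 < A * q - e.
  by rewrite subr_gt0 (le_lt_trans eA)// ltr_pdivrMr// ltr_pMr// ltr1n.
have eB' : 0 < B * q - e.
  by rewrite subr_gt0 (le_lt_trans eB)// ltr_pdivrMr// ltr_pMr// ltr1n.
have [C1 C10 [C1x C1y]] := integral_kap_wt2 (mulr_gt0 A0 qe0) (mulr_gt0 B0 qe0) h1.
have [C2 C20 [C2x C2y]] := integral_kap_wt2 eA' (addr_gt0 Bq0 e0) h2.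
have [C3 C30 [C3x C3y]] := integral_kap_wt2 (addr_gt0 Aq0 e0) eB' h3.
exists e, (C1 + C2 + C3 + 1); split => //; first by rewrite ltr_wpDl ?addr_ge0.
move=> L L0.
have gen (f : X -> R) (g1 g2 g3 : X -> R) :
    measurable_fun [set: X] f -> measurable_fun [set: X] g1 ->
    measurable_fun [set: X] g2 -> measurable_fun [set: X] g3 ->
    (forall x, 0 <= f x) -> (forall x, 0 <= g1 x) -> (forall x, 0 <= g2 x) ->
    (forall x, 0 <= g3 x) ->
    (forall x, f x <= L `^ (- e) * (g1 x + g2 x + g3 x)) ->
    (\int[lam]_x (g1 x * wt x)%:E <= C1%:E)%E ->
    (\int[lam]_x (g2 x * wt x)%:E <= C2%:E)%E ->
    (\int[lam]_x (g3 x * wt x)%:E <= C3%:E)%E ->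
    (\int[lam]_x (f x * wt x)%:E <= (L `^ (- e) * (C1 + C2 + C3 + 1))%:E)%E.
  move=> mf mg1 mg2 mg3 f0 g10 g20 g30 fg i1 i2 i3.
  have mw := (nng_wt R n).1; have w0 (x : X) : 0 <= wt x by exact: powR_ge0.
  have mgw (g : X -> R) : measurable_fun [set: X] g -> measurable_fun [set: X] (fun x => (g x * wt x)%:E).
    by move=> mg; apply/measurable_EFinP; exact: measurable_funM.
  have gw0 (g : X -> R) : (forall x, 0 <= g x) -> forall x, (0 <= (g x * wt x)%:E)%E.
    by move=> g0 x; rewrite lee_fin mulr_ge0.
  apply: (@le_trans _ _ (\int[lam]_x ((L `^ (- e))%:E *
      ((g1 x * wt x)%:E + (g2 x * wt x)%:E + (g3 x * wt x)%:E)))%E).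
    apply: ge0_int_le.
    - exact: mgw.
    - apply: emeasurable_funM; first exact: measurable_cst.
      by apply: emeasurable_funD; [apply: emeasurable_funD|]; exact: mgw.
    - exact: gw0.
    - move=> x; rewrite -!EFinD -EFinM lee_fin -!mulrDl mulrA.
      by rewrite ler_wpM2r.
  rewrite ge0_intZ ?powR_ge0//; last 2 first.
  - by apply: emeasurable_funD; [apply: emeasurable_funD|]; exact: mgw.
  - by move=> x; rewrite !adde_ge0 ?gw0.
  rewrite EFinM; apply: lee_wpmul2l; first by rewrite lee_fin powR_ge0.
  rewrite ge0_intD; last 4 first.
  - by apply: emeasurable_funD; exact: mgw.
  - exact: mgw.
  - by move=> x; rewrite adde_ge0 ?gw0.
  - exact: gw0.
  rewrite ge0_intD; [|exact: mgw|exact: mgw|exact: gw0|exact: gw0].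
  rewrite !EFinD -[leLHS]adde0; apply: leeD; last by rewrite lee_fin.
  by apply: leeD => //; exact: leeD.
have mpow (f : X -> R) : measurable_fun [set: X] f -> measurable_fun [set: X] (fun x => f x `^ q).
  by move=> mf; exact: (measurableT_comp (measurable_powR _) mf).
have mk2 (g : X -> X -> R) y : kern g -> measurable_fun [set: X] (g ^~ y).
  by move=> [mg _]; exact: (measurableT_comp mg (pair2_measurable y)).
split=> [x|y].
  apply: (gen _ (kap (A * (q + e)) (B * (q + e)) x)
                (kap (A * q - e) (B * q + e) x) (kap (A * q + e) (B * q - e) x)) => //.
  - by apply: mpow; exact: measurable_kern (kern_kout L).
  - exact: measurable_kern (kern_kap n _ _).
  - exact: measurable_kern (kern_kap n _ _).
  - exact: measurable_kern (kern_kap n _ _).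
  - by move=> y; exact: powR_ge0.
  - by move=> y; exact: kap_ge0.
  - by move=> y; exact: kap_ge0.
  - by move=> y; exact: kap_ge0.
  - by move=> y; exact: kout_pointwise.
apply: (gen _ (kap (A * (q + e)) (B * (q + e)) ^~ y)
              (kap (A * q - e) (B * q + e) ^~ y) (kap (A * q + e) (B * q - e) ^~ y)) => //.
- by apply: mpow; exact: mk2 (kern_kout L).
- exact: mk2 (kern_kap n _ _).
- exact: mk2 (kern_kap n _ _).
- exact: mk2 (kern_kap n _ _).
- by move=> x; exact: powR_ge0.
- by move=> x; exact: kap_ge0.
- by move=> x; exact: kap_ge0.
- by move=> x; exact: kap_ge0.
- by move=> x; exact: kout_pointwise.
Qed.

Lemma sw_bounded : exists C : R, forall u, nng u -> (sqint lam u <= 1)%E ->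
  (energy lam r K u <= C%:E)%E.
Proof.
have AqBq : A * q + B * q < nr by rewrite -mulrDl mulrC.
have [C C0 [Cx Cy]] := integral_kap_wt2 (mulr_gt0 A0 q0) (mulr_gt0 B0 q0) AqBq.
exists (C `^ (r / 2 + 1)) => u nu u1.
apply: (schur_young r2 qE C0 (kern_kap n A B) (nng_wt R n) _ _ nu u1) => [x|y].
  by under eq_integral do rewrite kap_powR.
by under eq_integral do rewrite kap_powR.
Qed.

Lemma sw_subE L : (fun x y => K x y - wkern r wt (kin L) x y) = wkern r wt (kout L).
Proof.
apply/funext => x; apply/funext => y; rewrite /sw_kernel /wkern /kin /kout.
by rewrite -mulrBr -[in X in X - _](mulr1 (k x y)) -mulrBr.
Qed.

Lemma kout_energy_small (eta : R) : 0 < eta -> exists2 L, 0 < L &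
  forall u, nng u -> (sqint lam u <= 1)%E ->
    (energy lam r (wkern r wt (kout L)) u <= eta%:E)%E.
Proof.
move=> eta0; have [e [C [e0 C0 CP]]] := kout_bound.
have s0 : 0 < r / 2 + 1 by rewrite addr_gt0// divr_gt0.
pose h := eta `^ (r / 2 + 1)^-1.
have h0 : 0 < h by rewrite powR_gt0.
(* Chosen so that the row and column bound L^-e C equals h, for which [schur_young] yields h^(r/2+1)
   = eta. *)
pose L := (h / C) `^ (- e^-1).
have hC0 : 0 < h / C by rewrite divr_gt0.
have L0 : 0 < L by rewrite powR_gt0.
have LC : L `^ (- e) * C = h.
  by rewrite /L -powRrM mulrNN mulVf ?gt_eqF// powRr1 ?(ltW hC0)// divfK ?gt_eqF.
have [Cx Cy] := CP L L0; rewrite LC in Cx Cy.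
exists L => // u nu u1.
have -> : eta = h `^ (r / 2 + 1).
  by rewrite /h -powRrM mulVf ?gt_eqF// powRr1// ltW.
exact: (schur_young r2 qE (ltW h0) (kern_kout L) (nng_wt R n) Cx Cy nu u1).
Qed.

Lemma L2_annwt (L N : R) : 0 < L -> 0 <= N ->
  L2 lam (fun y => ann L N y * wt y `^ 2^-1).
Proof.
move=> L0 N0; split.
  apply: measurable_funM; first exact: measurable_ann.
  exact: (measurableT_comp (measurable_powR _) (nng_wt R n).1).
apply: (@le_lt_trans _ _ ((2 * L ^+ 2) ^+ n)%:E); last by rewrite ltry.
apply: le_trans (integral_ann_wt L0 N0).
rewrite le_eqVlt; apply/orP; left; apply/eqP; apply: eq_integral => y _.
rewrite exprMn ann_sqr -[_ `^ _ ^+ 2]powR_mulrn ?powR_ge0// -powRrM mulVf//.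
by rewrite powRr1// powR_ge0.
Qed.

Lemma kin_annwt_le L x y : 0 < L -> wkern r wt (kin L) x y <=
  (wt x `^ r^-1 * L) * (ann L (enorm x) y * wt y `^ 2^-1).
Proof.
move=> L0; rewrite /wkern.
have -> : wt x `^ r^-1 * L * (ann L (enorm x) y * wt y `^ 2^-1) =
  wt x `^ r^-1 * wt y `^ 2^-1 * (L * ann L (enorm x) y).
  by rewrite [X in _ * X = _]mulrC mulrACA.
by rewrite ler_wpM2l ?mulr_ge0 ?powR_ge0// kin_le// ltW.
Qed.

Lemma L2_kin L x : 0 < L -> L2 lam (wkern r wt (kin L) x).
Proof.
move=> L0; have kk := kern_wkern r (nng_wt R n) (kern_kin L).
split; first exact: measurable_kern.
have lb := L2Z (wt x `^ r^-1 * L) (L2_annwt L0 (enorm_ge0 x)).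
apply: le_lt_trans lb.2; apply: ge0_int_le.
- by apply: measurable_sqr; exact: measurable_kern.
- by apply: measurable_sqr; exact: lb.1.
- by move=> y; rewrite lee_fin sqr_ge0.
- move=> y; rewrite lee_fin lerXn2r ?nnegrE//; last exact: kin_annwt_le.
    exact: kk.2.
  by rewrite !mulr_ge0 ?powR_ge0 ?ann_ge0// ltW.
Qed.

(** Writing u = |y|^(-n/2) f, [op] of this kernel integrates f over the annulus around |x| with
    respect to dy/|y|^n. *)
Definition annk (L : R) (x y : X) : R := ann L (enorm x) y * wt y `^ 2^-1.

Lemma kern_annk L : kern (annk L).
Proof.
split=> [|x y]; last by rewrite mulr_ge0 ?ann_ge0 ?powR_ge0.
have m1 : measurable_fun [set: X * X] (fun z => enorm z.1).
  exact: (measurableT_comp (@measurable_enorm R n) measurable_fst).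
have m2 : measurable_fun [set: X * X] (fun z => enorm z.2).
  exact: (measurableT_comp (@measurable_enorm R n) measurable_snd).
apply: measurable_funM; last first.
  exact: (measurableT_comp (measurable_powR _) (measurableT_comp (nng_wt R n).1 measurable_snd)).
by apply: measurable_funM; apply: measurable_natr_le => //; exact: measurable_funM.
Qed.

(* Interpolates [L^r] between [L^2] and the sup bound on the local averages. *)
Lemma kin_energy_le (L delta : R) (u : X -> R) : 0 < L -> 0 < delta ->
  nng u -> (sqint lam u <= 1)%E ->
  (forall x, enorm x != 0 -> (op lam (annk L) u x <= delta%:E)%E) ->
  (energy lam r (wkern r wt (kin L)) u <=
    (L `^ r * delta `^ (r - 2) * (2 * L ^+ 2) ^+ n * (2 * L ^+ 2) ^+ n)%:E)%E.
Proof.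
move=> L0 delta0 nu u1 ud.
set M := (2 * L ^+ 2) ^+ n.
have M0 : 0 < M by rewrite exprn_gt0// mulr_gt0// exprn_gt0.
have kk := kern_wkern r (nng_wt R n) (kern_kin L).
have ka := kern_annk L.
have [mu u0] := nu.
have mu2 : measurable_fun [set: X] (fun y => u y ^+ 2) by exact: measurable_funX.
have mw := (nng_wt R n).1; have w0 (x : X) : 0 <= wt x by exact: powR_ge0.
have mann (z : X) : measurable_fun [set: X] (fun y => ann L (enorm z) y) by exact: measurable_ann.
pose V (x : X) : \bar R := (\int[lam]_y (ann L (enorm x) y * u y ^+ 2)%:E)%E.
have V0 (x : X) : (0 <= V x)%E.
  by apply: integral_ge0 => y _; rewrite lee_fin mulr_ge0 ?ann_ge0 ?sqr_ge0.
(* Cauchy-Schwarz on the annulus, whose mass for dy/|y|^n is at most M. *)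
have WV x : (op lam (annk L) u x <= (M `^ 2^-1)%:E * V x `^ 2^-1)%E.
  have h01 : 0 < 2^-1 :> R /\ 2^-1 < 1 :> R by split; lra.
  move/andP in h01.
  have := @ge0_hoelder _ _ _ lam (fun y => ann L (enorm x) y * wt y)
     (fun y => ann L (enorm x) y * u y ^+ 2) 2^-1 h01.
  move=> /(_ (measurable_funM (mann x) mw) (measurable_funM (mann x) mu2)).
  move=> /(_ (fun y => mulr_ge0 (ann_ge0 _ _ y) (w0 y))
             (fun y => mulr_ge0 (ann_ge0 _ _ y) (sqr_ge0 _))) h.
  have he : 1 - 2^-1 = 2^-1 :> R by field.
  rewrite he in h.
  apply: (@le_trans _ _ ((\int[lam]_y (ann L (enorm x) y * wt y)%:E) `^ 2^-1 * V x `^ 2^-1)%E).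
    apply: le_trans h; rewrite le_eqVlt; apply/orP; left; apply/eqP.
    apply: eq_integral => y _; congr EFin; rewrite /annk.
    have uE : (u y ^+ 2) `^ 2^-1 = u y by rewrite -powR_mulrn// -powRrM mulfV// powRr1.
    have aE : ann L (enorm x) y `^ 2^-1 * ann L (enorm x) y `^ 2^-1 = ann L (enorm x) y.
      by rewrite -expr2 -powR_mulrn ?powR_ge0// -powRrM mulVf// powRr1// ann_ge0.
    rewrite (powRM _ (ann_ge0 _ _ y) (w0 y)) (powRM _ (ann_ge0 _ _ y) (sqr_ge0 (u y))) uE.
    rewrite -[in LHS]aE.
    by move: (ann L (enorm x) y `^ 2^-1) (wt y `^ 2^-1) (u y) => p1 p2 p3; ring.
  apply: lee_wpmul2r; first exact: poweR_ge0.
  rewrite -poweR_EFin; apply: lee_poweR => //.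
    by apply: integral_ge0 => y _; rewrite lee_fin mulr_ge0 ?ann_ge0.
  exact: integral_ann_wt (enorm_ge0 x).
have c0 : 0 <= L `^ r * delta `^ (r - 2) * M by rewrite !mulr_ge0 ?powR_ge0 ?(ltW M0).
have opW x : (op lam (wkern r wt (kin L)) u x <=
    (wt x `^ r^-1 * L)%:E * op lam (annk L) u x)%E.
  rewrite -(ge0_intZ lam (measurable_kernu x ka nu)); last 2 first.
  - by rewrite mulr_ge0 ?powR_ge0// ltW.
  - by move=> y; exact: kernu_ge0.
  apply: ge0_int_le.
  - exact: measurable_kernu.
  - by apply: emeasurable_funM; [exact: measurable_cst|exact: measurable_kernu].
  - by move=> y; exact: kernu_ge0.
  - by move=> y; rewrite -EFinM lee_fin mulrA ler_wpM2r//; exact: kin_annwt_le.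
have step x : (op lam (wkern r wt (kin L)) u x `^ r <=
    (L `^ r * delta `^ (r - 2) * M)%:E * ((wt x)%:E * V x))%E.
  have o0 : (0 <= op lam (wkern r wt (kin L)) u x)%E by exact: op_ge0.
  have rhs0 : (0 <= (L `^ r * delta `^ (r - 2) * M)%:E * ((wt x)%:E * V x))%E.
    by rewrite mule_ge0 ?lee_fin// mule_ge0 ?lee_fin.
  have [x0|x0] := eqVneq (enorm x) 0.
    have wx : wt x = 0 by rewrite /wt x0 powR0// oppr_eq0 gt_eqF.
    have := opW x; rewrite wx powR0 ?mul0r ?mul0e ?invr_eq0 ?gt_eqF// => ole.
    have -> : op lam (wkern r wt (kin L)) u x = 0%E by apply/le_anti/andP.
    by rewrite poweR0r ?mule0 ?gt_eqF.
  have W0 : (0 <= op lam (annk L) u x)%E by exact: op_ge0.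
  have Wfin : op lam (annk L) u x \is a fin_num.
    by rewrite ge0_fin_numE//; apply: le_lt_trans (ud x x0) _; rewrite ltry.
  have := WV x; have := ud x x0; have := opW x; move: W0.
  rewrite -[op lam (annk L) u x]fineK//; set w := fine _.
  rewrite !lee_fin -EFinM => w_ge0 h1 h2 h3.
  apply: (@le_trans _ _ ((wt x * L `^ r) * w `^ r)%:E).
    apply: le_trans (lee_poweR (ltW r0) o0 h1) _.
    rewrite poweR_EFin lee_fin !powRM ?mulr_ge0 ?powR_ge0 ?(ltW L0)//.
    by rewrite -powRrM mulVf ?gt_eqF// powRr1.
  (* Of the r powers, r - 2 are spent on the uniform bound delta; the remaining square is summable
     in x through [WV]. *)
  have wr : w `^ r <= delta `^ (r - 2) * w ^+ 2.
    have -> : w `^ r = w `^ (r - 2) * w ^+ 2.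
      rewrite -[w ^+ 2]powR_mulrn// -powRD ?subrK//.
      by apply/implyP => /eqP h; move: r0; rewrite h ltxx.
    rewrite ler_wpM2r ?sqr_ge0//; apply: ge0_ler_powR; rewrite ?nnegrE ?(ltW delta0)//.
    by rewrite subr_ge0 ltW.
  have w2 : ((w ^+ 2)%:E <= M%:E * V x)%E.
    have h4 : ((w%:E) `^ 2 <= ((M `^ 2^-1)%:E * V x `^ 2^-1) `^ 2)%E.
      by apply: lee_poweR.
    move: h4; rewrite poweR_EFin powR_mulrn// poweRM ?lee_fin ?powR_ge0 ?poweR_ge0//.
    by rewrite poweR_EFin -powRrM -poweRrM mulVf// powRr1 ?(ltW M0)// poweRe1.
  apply: (@le_trans _ _ ((wt x * L `^ r * delta `^ (r - 2))%:E * (w ^+ 2)%:E)%E).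
    by rewrite -EFinM lee_fin -[leRHS]mulrA ler_wpM2l ?mulr_ge0 ?powR_ge0.
  apply: (@le_trans _ _ ((wt x * L `^ r * delta `^ (r - 2))%:E * (M%:E * V x))%E).
    by apply: lee_wpmul2l => //; rewrite lee_fin !mulr_ge0 ?powR_ge0.
  rewrite !muleA -!EFinM le_eqVlt; apply/orP; left; apply/eqP.
  congr (_ * _)%E; congr EFin.
  by move: (wt x) (L `^ r) (delta `^ (r - 2)) => p1 p2 p3; ring.
have mV : measurable_fun [set: X] V.
  apply: (@measurable_fun_fubini_tonelli_F _ _ X X R lam
    (fun z => (ann L (enorm z.1) z.2 * u z.2 ^+ 2)%:E)).
    apply/measurable_EFinP; apply: measurable_funM; last first.
      exact: (measurableT_comp mu2 measurable_snd).
    have m1 : measurable_fun [set: X * X] (fun z => enorm z.1).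
      exact: (measurableT_comp (@measurable_enorm R n) measurable_fst).
    have m2 : measurable_fun [set: X * X] (fun z => enorm z.2).
      exact: (measurableT_comp (@measurable_enorm R n) measurable_snd).
    by apply: measurable_funM; apply: measurable_natr_le => //; exact: measurable_funM.
  by move=> z; rewrite lee_fin mulr_ge0 ?ann_ge0 ?sqr_ge0.
have mwV : measurable_fun [set: X] (fun x => (wt x)%:E * V x)%E.
  by apply: emeasurable_funM => //; exact/measurable_EFinP.
have wV0 x : (0 <= (wt x)%:E * V x)%E by rewrite mule_ge0 ?lee_fin.
apply: (@le_trans _ _ (\int[lam]_x ((L `^ r * delta `^ (r - 2) * M)%:E * ((wt x)%:E * V x)))%E).
  apply: ge0_int_le => //.
  - exact: measurable_op_pow.
  - by apply: emeasurable_funM; [exact: measurable_cst|].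
  - by move=> x; exact: poweR_ge0.
rewrite (ge0_intZ lam mwV c0 wV0) [leRHS]EFinM; apply: lee_wpmul2l => //.
pose H (z : X * X) : \bar R := (wt z.1 * (ann L (enorm z.1) z.2 * u z.2 ^+ 2))%:E.
have H0 z : (0 <= H z)%E by rewrite lee_fin !mulr_ge0 ?ann_ge0 ?sqr_ge0.
have mH : measurable_fun [set: X * X] H.
  apply/measurable_EFinP; apply: measurable_funM.
    exact: (measurableT_comp mw measurable_fst).
  apply: measurable_funM; last exact: (measurableT_comp mu2 measurable_snd).
  have m1 : measurable_fun [set: X * X] (fun z => enorm z.1).
    exact: (measurableT_comp (@measurable_enorm R n) measurable_fst).
  have m2 : measurable_fun [set: X * X] (fun z => enorm z.2).
    exact: (measurableT_comp (@measurable_enorm R n) measurable_snd).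
  by apply: measurable_funM; apply: measurable_natr_le => //; exact: measurable_funM.
have -> : (\int[lam]_x ((wt x)%:E * V x) = \int[lam]_x \int[lam]_y H (x, y))%E.
  apply: eq_integral => x _; rewrite /H /= -ge0_intZ//.
  - by apply/measurable_EFinP; exact: measurable_funM.
  - by move=> y; rewrite lee_fin mulr_ge0 ?ann_ge0 ?sqr_ge0.
rewrite fubini_tonelli//.
apply: (@le_trans _ _ (\int[lam]_y (M%:E * (u y ^+ 2)%:E))%E).
  apply: ge0_int_le => //.
  - exact: measurable_fun_fubini_tonelli_G.
  - by apply: emeasurable_funM; [exact: measurable_cst|exact/measurable_EFinP].
  - by move=> y; apply: integral_ge0.
  move=> y; rewrite /H/=.
  (* After exchanging the integrals, the symmetry of [ann] makes the inner one the mass of the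
     annulus around |y|; this is the second factor M. *)
  have -> : (\int[lam]_x (wt x * (ann L (enorm x) y * u y ^+ 2))%:E =
      (u y ^+ 2)%:E * \int[lam]_x (ann L (enorm y) x * wt x)%:E)%E.
    rewrite -ge0_intZ ?sqr_ge0//.
    - apply: eq_integral => x _; rewrite -EFinM (annC L y x); congr EFin.
      by move: (wt x) (ann L (enorm x) y) (u y ^+ 2) => p1 p2 p3; ring.
    - by apply/measurable_EFinP; exact: measurable_funM.
    - by move=> x; rewrite lee_fin mulr_ge0 ?ann_ge0.
  rewrite muleC; apply: lee_wpmul2r; first by rewrite lee_fin sqr_ge0.
  exact: integral_ann_wt (enorm_ge0 y).
rewrite ge0_intZ ?(ltW M0)//; last 2 first.
- exact: measurable_sqr.
- by move=> y; rewrite lee_fin sqr_ge0.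
by rewrite -[leRHS]mule1; apply: lee_wpmul2l => //; rewrite lee_fin ltW.
Qed.

End stein_weiss_kernel.

(** * Dilation invariance of norm and energy *)

Section dilation.
Variables (R : realType) (n : nat).
Local Notation X := (euclid R n).
Local Notation lam := (lebesgue_tuple R n).
Local Notation nr := (n%:R : R).
Variables (A B r rho : R).
Hypothesis r0 : 0 < r.
Hypothesis rho0 : 0 < rho.
Let rho_ge0 : 0 <= rho := ltW rho0.
Local Notation K := (@sw_kernel R n A B r).

Lemma integral_dilate (F : X -> \bar R) :
  measurable_fun [set: X] F -> (forall x, (0 <= F x)%E) ->
  (\int[lam]_x F x = (rho `^ nr)%:E * \int[lam]_x F (dilate rho x))%E.
Proof. by move=> mF F0; rewrite powR_mulrn//; exact: integral_affine. Qed.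

Definition rescale (u : X -> R) (y : X) : R := rho `^ (nr / 2) * u (dilate rho y).

Lemma nng_comp_dilate (u : X -> R) : nng u -> nng (fun y => u (dilate rho y)).
Proof.
move=> [mu u0]; split=> [|y //].
exact: (measurableT_comp mu (measurable_dilate rho)).
Qed.

Lemma nng_rescale (u : X -> R) : nng u -> nng (rescale u).
Proof. by move=> nu; apply: nngZ; [exact: powR_ge0|exact: nng_comp_dilate]. Qed.

Lemma sqint_rescale (u : X -> R) : nng u -> sqint lam (rescale u) = sqint lam u.
Proof.
move=> nu; rewrite /sqint [RHS]integral_dilate; last 2 first.
- exact: measurable_sqr nu.1.
- by move=> x; rewrite lee_fin sqr_ge0.
rewrite -ge0_intZ ?powR_ge0//.
- apply: eq_integral => y _; rewrite -EFinM /rescale exprMn; congr (_ * _)%:E.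
  by rewrite -powR_mulrn ?powR_ge0// -powRrM divfK.
- by apply: measurable_sqr; exact: (nng_comp_dilate nu).1.
- by move=> y; rewrite lee_fin sqr_ge0.
Qed.

Lemma kap_dilate (x y : X) : kap A B (dilate rho x) (dilate rho y) = kap A B x y.
Proof.
rewrite /kap !enorm_dilate// edist_dilate//.
rewrite !powRM ?enorm_ge0 ?edist_ge0// powRN powRD_gt0//.
have a0 : rho `^ A != 0 by rewrite gt_eqF// powR_gt0.
have b0 : rho `^ B != 0 by rewrite gt_eqF// powR_gt0.
move: a0 b0; move: (rho `^ A) (rho `^ B) (enorm x `^ A) (enorm y `^ B) (edist x y `^ _).
by move=> a b c d e a0 b0; field; rewrite a0 b0.
Qed.

Lemma wt_dilate (x : X) : wt (dilate rho x) = rho `^ (- nr) * wt x.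
Proof. by rewrite /wt enorm_dilate// powRM// enorm_ge0. Qed.

Lemma sw_dilate (x y : X) : K (dilate rho x) (dilate rho y) =
  rho `^ (- nr / r) * rho `^ (- nr / 2) * K x y.
Proof.
have e1 (t p : R) : 0 <= t -> (rho `^ (- nr) * t) `^ p = rho `^ (- nr * p) * t `^ p.
  by move=> t0; rewrite powRM ?powR_ge0// -powRrM.
rewrite /sw_kernel /wkern kap_dilate !wt_dilate !e1 ?powR_ge0//.
by rewrite [X in X * _ = _]mulrACA -[LHS]mulrA.
Qed.

Lemma op_rescale (u : X -> R) (x : X) : nng u ->
  op lam K (rescale u) x = ((rho `^ (nr / r))%:E * op lam K u (dilate rho x))%E.
Proof.
move=> nu; have kK := kern_sw n A B r.
rewrite opZ ?powR_ge0//; last exact: nng_comp_dilate.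
rewrite [in RHS]/op [in RHS]integral_dilate; last 2 first.
- exact: (measurable_kernu _ kK nu).
- by move=> y; exact: (kernu_ge0 _ y kK nu).
under [in RHS]eq_integral => y _ do rewrite sw_dilate -[X in X%:E]mulrA EFinM.
rewrite ge0_intZ ?mulr_ge0 ?powR_ge0//; last 2 first.
- exact: (measurable_kernu x kK (nng_comp_dilate nu)).
- by move=> y; exact: (kernu_ge0 x y kK (nng_comp_dilate nu)).
rewrite !muleA -!EFinM /op; congr (_%:E * _)%E.
rewrite !mulNr !powRN.
have a0 : rho `^ (nr / r) != 0 by rewrite gt_eqF// powR_gt0.
have b0 : rho `^ (nr / 2) != 0 by rewrite gt_eqF// powR_gt0.
have -> : rho `^ nr = rho `^ (nr / 2) * rho `^ (nr / 2).
  by rewrite -powRD_gt0// -splitr.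
move: a0 b0; move: (rho `^ (nr / r)) (rho `^ (nr / 2)) => a b a0 b0.
by field; rewrite a0 b0.
Qed.

Lemma energy_rescale (u : X -> R) : nng u ->
  energy lam r K (rescale u) = energy lam r K u.
Proof.
move=> nu; have kK := kern_sw n A B r.
rewrite [RHS]integral_dilate; last 2 first.
- exact: measurable_op_pow.
- by move=> x; exact: poweR_ge0.
rewrite -ge0_intZ ?powR_ge0//.
- apply: eq_integral => x _; rewrite op_rescale// poweRM ?lee_fin ?powR_ge0 ?op_ge0//.
  by rewrite poweR_EFin -powRrM divfK// gt_eqF.
- exact: (measurableT_comp (measurable_op_pow lam r kK nu) (measurable_dilate rho)).
- by move=> x; exact: poweR_ge0.
Qed.

(** Rescaling by |x| carries the annulus around |x| to the one around 1, so one fixed function of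
    L^2 tests the mass of every rescaled u. *)
Lemma op_annk_rescale (L : R) (u : X -> R) (x : X) : enorm x = rho -> nng u ->
  op lam (annk L) u x = (\int[lam]_y (ann L 1 y * wt y `^ 2^-1 * rescale u y)%:E)%E.
Proof.
move=> xrho nu; rewrite /op [LHS]integral_dilate; last 2 first.
- exact: (measurable_kernu x (kern_annk n L) nu).
- by move=> y; exact: (kernu_ge0 x y (kern_annk n L) nu).
rewrite -ge0_intZ ?powR_ge0//.
- apply: eq_integral => y _; rewrite -EFinM; congr EFin.
  rewrite /annk /ann xrho enorm_dilate// wt_dilate mulrCA [L * rho]mulrC.
  rewrite [L * (rho * _)]mulrCA -[X in (X <= rho * (L * _))%R]mulr1 !ler_pM2l// mulr1.
  rewrite powRM ?powR_ge0// -powRrM /rescale.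
  have -> : rho `^ nr = rho `^ (nr / 2) * rho `^ (nr / 2).
    by rewrite -powRD_gt0// -splitr.
  rewrite mulNr powRN.
  have b0 : rho `^ (nr / 2) != 0 by rewrite gt_eqF// powR_gt0.
  move: b0; move: (rho `^ (nr / 2)) (wt y `^ 2^-1) (u (dilate rho y)) => b c e b0.
  by field.
- apply/measurable_EFinP; apply: measurable_funM; last exact: (nng_comp_dilate nu).1.
  exact: (measurableT_comp (measurable_kern x (kern_annk n L)) (measurable_dilate rho)).
- move=> y; rewrite lee_fin mulr_ge0//; first exact: (kern_annk n L).2.
  exact: (nng_comp_dilate nu).2.
Qed.

End dilation.

(** * Verification of the abstract hypotheses for the Stein-Weiss kernel *)

Section stein_weiss_maximizer.
Variables (R : realType) (n : nat).
Hypothesis n_gt0 : (0 < n)%N.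
Local Notation X := (euclid R n).
Local Notation lam := (lebesgue_tuple R n).
Local Notation nr := (n%:R : R).
Variables (A B r q : R).
Hypothesis A0 : 0 < A.
Hypothesis B0 : 0 < B.
Hypothesis r2 : 2 < r.
Hypothesis qE : q^-1 = 2^-1 + r^-1.
Hypothesis qAB : q * (A + B) < nr.
Let r0 : 0 < r. Proof. exact: lt_trans r2. Qed.
Local Notation K := (@sw_kernel R n A B r).
Local Notation Kin L := (wkern r (@wt R n) (kin A B L)).

Lemma kin_sw_le (L : R) (x y : X) : Kin L x y <= K x y.
Proof.
rewrite /sw_kernel /wkern ler_wpM2l ?mulr_ge0 ?powR_ge0// /kin ler_piMr ?kap_ge0//.
by case: (dom01 A B L x y) => ->.
Qed.

Lemma sw_truncation (eta : R) : 0 < eta -> exists2 L : R, 0 < L &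
  forall u, nng u -> (sqint lam u <= 1)%E ->
    (energy lam r (fun x y => K x y - Kin L x y)%R u <= eta%:E)%E.
Proof.
move=> eta0; have [L L0 LP] := kout_energy_small A0 B0 r2 qE qAB eta0.
have E := sw_subE n A B r L.
exists L; [exact: L0|move=> u nu u1].
exact: (eq_ind_r (fun k => (energy lam r k u <= eta%:E)%E) (LP u nu u1) E).
Qed.

Lemma sw_nonvanishing (e : R) : 0 < e -> exists b (delta : R),
  [/\ L2 lam b, 0 < delta & forall u, nng u -> (sqint lam u <= 1)%E ->
    (e%:E <= energy lam r K u)%E -> exists u',
    [/\ nng u', (sqint lam u' <= 1)%E, energy lam r K u' = energy lam r K u
      & delta <= ip lam b u']].
Proof.
move=> e0; have [D D0 DP] := powRD_le r0 (ltr01 : 0 < 1 :> R).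
have t0 : 0 < e / 2 / D by rewrite !divr_gt0.
have [L L0 tail] := sw_truncation t0.
pose Q := L `^ r * (2 * L ^+ 2) ^+ n * (2 * L ^+ 2) ^+ n.
have Q0 : 0 < Q by rewrite !mulr_gt0 ?powR_gt0 ?exprn_gt0 ?mulr_gt0 ?exprn_gt0.
have r20 : 0 < r - 2 by rewrite subr_gt0.
(* If all local averages were at most delta, the truncated energy would be at most e/8.
   [energy_split] with eta = 1 would then bound the full energy by 2 e/8 + D (e/2/D) = 3e/4, less
   than e. *)
pose delta := (e / 8 / Q) `^ (r - 2)^-1.
have d0 : 0 < delta by rewrite powR_gt0// !divr_gt0.
have lb := L2_annwt n_gt0 L0 (ler01 : 0 <= 1 :> R).
exists (fun y => ann L 1 y * wt y `^ 2^-1), delta; split => // u nu u1 eu.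
have lu : L2 lam u by exact: nng_L2 nu u1.
have kK := kern_sw n A B r.
have kKin : kern (Kin L) := kern_wkern r (nng_wt R n) (kern_kin n A B L).
have [x [x0 xd]] : exists x, enorm x != 0 /\ (delta%:E < op lam (annk L) u x)%E.
  apply: contrapT => nex.
  have all_le x : enorm x != 0 -> (op lam (annk L) u x <= delta%:E)%E.
    by move=> x0; rewrite leNgt; apply/negP => lt; apply: nex; exists x.
  have h1 := kin_energy_le n_gt0 A B r2 L0 d0 nu u1 all_le.
  have QE : L `^ r * delta `^ (r - 2) * (2 * L ^+ 2) ^+ n * (2 * L ^+ 2) ^+ n = e / 8.
    have -> : delta `^ (r - 2) = e / 8 / Q.
      by rewrite /delta -powRrM mulVf ?gt_eqF// powRr1// ltW// !divr_gt0.
    transitivity (Q * (e / 8 / Q)); last by rewrite mulrC divfK// gt_eqF.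
    rewrite /Q; move: (L `^ r) ((2 * L ^+ 2) ^+ n) (e / 8 / _) => p1 p2 p3; ring.
  rewrite QE in h1.
  have h2 := energy_split r0 ler01 D0 DP kK kKin (kin_sw_le L)
    (fun x => L2_kin n_gt0 A B r x L0) nu lu.
  have h3 : (D%:E * energy lam r (fun x y => K x y - Kin L x y)%R u <= (e / 2)%:E)%E.
    apply: (@le_trans _ _ (D%:E * (e / 2 / D)%:E)%E).
      by apply: lee_wpmul2l; [rewrite lee_fin ltW|exact: tail].
    by rewrite -EFinM mulrC divfK// gt_eqF.
  have h4 : ((1 + 1)%:E * energy lam r (Kin L) u <= (e / 4)%:E)%E.
    apply: (@le_trans _ _ ((1 + 1)%:E * (e / 8)%:E)%E).
      by apply: lee_wpmul2l => //; rewrite lee_fin.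
    by rewrite -EFinM lee_fin; lra.
  have := le_trans eu (le_trans h2 (leeD h4 h3)).
  by rewrite -EFinD lee_fin; lra.
have rho0 : 0 < enorm x by rewrite lt0r x0 enorm_ge0.
exists (rescale (enorm x) u); split.
- exact: nng_rescale.
- by rewrite sqint_rescale.
- exact: energy_rescale.
have nu' := nng_rescale (enorm x) nu.
have lu' : L2 lam (rescale (enorm x) u).
  by apply: (nng_L2 (c := 1) nu'); rewrite sqint_rescale.
rewrite -lee_fin; apply: le_trans (ltW xd) _.
rewrite (op_annk_rescale rho0 L erefl nu).
rewrite -(opE (k := fun _ => (fun y => ann L 1 y * wt y `^ 2^-1)) (x := x) lb lu').
exact: lexx.
Qed.

Lemma unit_box : exists u0 : X -> R, nng u0 /\ sqint lam u0 = 1%E.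
Proof.
pose box : set X := [set x | forall i, `[0, 1]%classic (tnth x i : R)].
have mbox : measurable box.
  rewrite (_ : box = \bigcap_(i in [set: 'I_n])
      ((fun x : X => tnth x i : measurableTypeR R) @^-1` `[0, 1]%classic)).
    apply: fin_bigcap_measurable => // i _; rewrite -[X in measurable X]setTI.
    by apply: measurable_tnth => //; exact: measurable_itv.
  by apply/seteqP; split=> x /= h i; [move=> _|]; exact: h.
exists \1_box; split; first by split => //; exact: measurable_indic.
rewrite /sqint (_ : (fun x => _) = EFin \o \1_box); last first.
  apply/funext => x /=; congr EFin; rewrite indicE.
  by case: (x \in box); rewrite ?expr1n ?expr0n.
rewrite integral_indic// setIT.
apply: (etrans (@lebesgue_tuple_box R n (fun=> `[0, 1]%classic) _)).
  by move=> i; exact: measurable_itv.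
rewrite big1// => i _; rewrite lebesgue_measure_itv/= lte_fin ltr01.
by rewrite sube0.
Qed.

Lemma sw_maximizer : exists g, [/\ nng g, sqint lam g = 1%E &
  forall f, nng f -> (sqint lam f <= 1)%E ->
    (energy lam r K f <= energy lam r K g)%E].
Proof.
have [C CP] := sw_bounded A0 B0 r2 qE qAB.
apply: (@maximizer_exists _ _ _ lam r C K r2 (kern_sw n A B r) CP).
- move=> eta /sw_truncation[L L0 tail]; exists (Kin L); split => //.
  + exact: kern_wkern (nng_wt R n) (kern_kin n A B L).
  + exact: kin_sw_le.
  + by move=> x; exact: L2_kin.
- exact: sw_nonvanishing.
- exact: unit_box.
Qed.

End stein_weiss_maximizer.

(** * The weighted Riesz potential *)

Section weighted_riesz.
Variables (R : realType) (n : nat).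
Hypothesis n_gt0 : (0 < n)%N.
Local Notation X := (euclid R n).
Local Notation lam := (lebesgue_tuple R n).
Local Notation nr := (n%:R : R).

(** The identities between powers of the norm can fail at the origin, where powers take conventional
    values; integrals are therefore compared off this null set. *)
Lemma ae_enorm_neq0 : {ae lam, forall x : X, enorm x != 0}.
Proof.
exists (eball 0); split; first exact: measurable_eball.
  apply/le_anti/andP; split; last exact: measure_ge0.
  apply: le_trans (lebesgue_ball_le _ _) _ => //.
  by rewrite mulr0 expr0n (gtn_eqF n_gt0).
move=> x /= /negP; rewrite negbK => /eqP x0.
by rewrite /eball/= x0.
Qed.

Lemma eq_integral_off0 (F G : X -> \bar R) :
  measurable_fun [set: X] F -> measurable_fun [set: X] G ->
  (forall x, (0 <= F x)%E) -> (forall x, (0 <= G x)%E) ->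
  (forall x, enorm x != 0 -> F x = G x) ->
  (\int[lam]_x F x = \int[lam]_x G x)%E.
Proof.
move=> mF mG F0 G0 FG; apply: ge0_ae_eq_integral => //.
have := ae_enorm_neq0; apply: filterS => x /FG E _.
exact: E.
Qed.

Variables (s r alpha gamma : R).
Hypothesis r0 : 0 < r.
Local Notation A := (gamma + nr / r).
Local Notation B := (nr / 2 - alpha).
Hypothesis ABs : A + B = nr - s.
Hypothesis B_gt0 : 0 < B.
Local Notation K := (@sw_kernel R n A B r).

Definition weighted (f : X -> R) (y : X) : R := enorm y `^ alpha * `|f y|.

Lemma nng_weighted (f : X -> R) : measurable_fun [set: X] f -> nng (weighted f).
Proof.
move=> mf; split=> [|y]; last by rewrite mulr_ge0 ?powR_ge0.
apply: measurable_funM; last exact: measurableT_comp.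
exact: (measurableT_comp (measurable_powR _) (@measurable_enorm R n)).
Qed.

Lemma wnorm2E (f : X -> R) :
  (wnorm alpha 2 (EFin \o f) = sqint lam (weighted f) `^ 2^-1)%E.
Proof.
rewrite /wnorm unlock; congr poweR; apply: eq_integral => x _ /=.
rewrite powR_mulrn// /weighted normrM.
by rewrite (ger0_norm (powR_ge0 _ _)).
Qed.

Definition potential (f : X -> R) (x : X) : \bar R :=
  (\int[lam]_y (f y / edist x y `^ (nr - s))%:E)%E.

Lemma measurable_riesz_kernel (f : X -> R) : measurable_fun [set: X] f ->
  measurable_fun [set: X * X] (fun z => f z.2 / edist z.1 z.2 `^ (nr - s)).
Proof.
move=> mf; rewrite (_ : (fun z => _) =
    fun z : X * X => f z.2 * edist z.1 z.2 `^ (- (nr - s))); last first.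
  by apply/funext => z; rewrite powRN.
apply: measurable_funM; first exact: (measurableT_comp mf measurable_snd).
exact: (measurableT_comp (measurable_powR _) (@measurable_edist R n)).
Qed.

(** Since f may change sign, Tonelli is applied to the positive and negative parts of the integrand
    separately. *)
Lemma measurable_potential (f : X -> R) : measurable_fun [set: X] f ->
  measurable_fun [set: X] (potential f).
Proof.
move=> mf; pose h (z : X * X) : \bar R := (f z.2 / edist z.1 z.2 `^ (nr - s))%:E.
have mh : measurable_fun [set: X * X] h.
  by apply/measurable_EFinP; exact: measurable_riesz_kernel.
rewrite (_ : potential f =
    (fun x => fubini_F lam (h^\+)%E x - fubini_F lam (h^\-)%E x)%E).
  apply: emeasurable_funB; apply: measurable_fun_fubini_tonelli_F => //.
  - exact: measurable_funepos.
  - exact: measurable_funeneg.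
apply/funext => x; rewrite /potential integralE.
by congr (_ - _)%E; apply: eq_integral => y _; rewrite ?funeposE ?funenegE.
Qed.

Lemma potential_abs_op (f : X -> R) (x : X) : measurable_fun [set: X] f ->
  enorm x != 0 ->
  ((enorm x `^ gamma)%:E * potential (fun y => `|f y|)%R x = op lam K (weighted f) x)%E.
Proof.
move=> mf x0; have xp : 0 < enorm x by rewrite lt0r x0 enorm_ge0.
have mk : measurable_fun [set: X] (fun y => `|f y| / edist x y `^ (nr - s)).
  have mabs : measurable_fun [set: X] (fun y => `|f y|) by exact: measurableT_comp.
  exact: (measurableT_comp (measurable_riesz_kernel mabs) (pair1_measurable x)).
have kK := kern_sw n A B r.
have nw := nng_weighted mf.
rewrite -ge0_intZ ?powR_ge0//; last 2 first.
- exact/measurable_EFinP.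
- by move=> y; rewrite lee_fin divr_ge0 ?powR_ge0.
apply: eq_integral_off0.
- by apply: emeasurable_funM; [exact: measurable_cst|exact/measurable_EFinP].
- exact: measurable_kernu.
- by move=> y; rewrite mule_ge0 ?lee_fin ?divr_ge0 ?powR_ge0.
- by move=> y; exact: kernu_ge0.
move=> y y0; have yp : 0 < enorm y by rewrite lt0r y0 enorm_ge0.
rewrite -EFinM; congr EFin; rewrite /sw_kernel /wkern /kap /weighted /wt ABs.
rewrite -!powRrM [edist x y `^ (- _)]powRN.
have -> : enorm x `^ gamma = enorm x `^ (- nr * r^-1) * enorm x `^ A.
  by rewrite -powRD_gt0//; congr powR; ring.
have y1 : enorm y `^ (- nr * 2^-1) * enorm y `^ B * enorm y `^ alpha = 1.
  by rewrite -!powRD_gt0// (_ : _ + _ + _ = 0) ?powRr0//; ring.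
rewrite -[LHS]mulr1 -[X in _ * X = _]y1.
move: (enorm x `^ (- nr * r^-1)) (enorm x `^ A) (enorm y `^ (- nr * 2^-1))
  (enorm y `^ B) (enorm y `^ alpha) (edist x y `^ _) => a b c d p e.
by ring.
Qed.

Lemma sw_eq0r (x y : X) : enorm y = 0 -> K x y = 0.
Proof. by move=> y0; rewrite /sw_kernel /wkern /kap y0 (powR0 (lt0r_neq0 B_gt0)) !mulr0. Qed.

Definition unweighted (g : X -> R) (y : X) : R := enorm y `^ (- alpha) * g y.

Lemma measurable_unweighted (g : X -> R) : nng g ->
  measurable_fun [set: X] (unweighted g).
Proof.
move=> [mg _]; apply: measurable_funM => //.
exact: (measurableT_comp (measurable_powR _) (@measurable_enorm R n)).
Qed.

Lemma weightedK (g : X -> R) (y : X) : nng g -> enorm y != 0 ->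
  weighted (unweighted g) y = g y.
Proof.
move=> [_ g0] y0; have yp : 0 < enorm y by rewrite lt0r y0 enorm_ge0.
rewrite /weighted /unweighted ger0_norm ?mulr_ge0 ?powR_ge0// mulrA.
by rewrite -powRD_gt0// subrr powRr0 mul1r.
Qed.

Lemma wnorm2_unweighted (g : X -> R) : nng g ->
  (wnorm alpha 2 (EFin \o unweighted g) = sqint lam g `^ 2^-1)%E.
Proof.
move=> ng; rewrite wnorm2E; congr poweR; apply: eq_integral_off0.
- by apply: measurable_sqr; exact: (nng_weighted (measurable_unweighted ng)).1.
- exact: measurable_sqr ng.1.
- by move=> x; rewrite lee_fin sqr_ge0.
- by move=> x; rewrite lee_fin sqr_ge0.
- by move=> x x0; rewrite weightedK.
Qed.

Lemma op_unweighted (g : X -> R) (x : X) : nng g ->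
  op lam K (weighted (unweighted g)) x = op lam K g x.
Proof.
move=> ng; apply: eq_integral => y _; congr EFin.
have [y0|y0] := eqVneq (enorm y) 0; first by rewrite sw_eq0r ?mul0r.
by rewrite weightedK.
Qed.

Lemma measurable_wnorm_integrand (f : X -> R) (c : R) : measurable_fun [set: X] f ->
  measurable_fun [set: X] (fun x =>
    `|(enorm x `^ gamma)%:E * (c%:E * potential f x)| `^ r)%E.
Proof.
move=> mf; have mc : measurable_fun [set: X] (fun x =>
    (enorm x `^ gamma)%:E * (c%:E * potential f x))%E.
  apply: emeasurable_funM.
    apply/measurable_EFinP.
    exact: (measurableT_comp (measurable_powR _) (@measurable_enorm R n)).
  by apply: emeasurable_funM; [exact: measurable_cst|exact: measurable_potential].
have ma : measurable_fun [set: X] (fun x =>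
    `|(enorm x `^ gamma)%:E * (c%:E * potential f x)|)%E.
  have ta : measurable_fun [set: \bar R] abse by exact: abse_measurable.
  exact: (measurableT_comp ta mc).
exact: (measurableT_comp (measurable_poweR _) ma).
Qed.

Lemma energyZ_poweR (c : R) (u : X -> R) : nng u ->
  (\int[lam]_x ((`|c|%:E * op lam K u x) `^ r) = (`|c| `^ r)%:E * energy lam r K u)%E.
Proof.
move=> nu; rewrite -(ge0_intZ lam (measurable_op_pow lam r (kern_sw n A B r) nu)).
- apply: eq_integral => x _; rewrite poweRM ?lee_fin ?op_ge0//; exact: kern_sw.
- exact: powR_ge0.
- by move=> x; exact: poweR_ge0.
Qed.

(** Passing to |f| can only increase the potential. For a nonnegative function this step is an
    equality, which gives [wnorm_riesz_unweighted]; the same factor |c| occurs in both. *)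
Lemma wnorm_riesz_le (f : X -> R) : measurable_fun [set: X] f ->
  (wnorm gamma r (riesz s f) <=
   `|riesz_const n s|%:E * (energy lam r K (weighted f)) `^ r^-1)%E.
Proof.
move=> mf; set c := riesz_const n s.
have nw := nng_weighted mf.
have -> : (`|c|%:E * (energy lam r K (weighted f)) `^ r^-1 =
    (\int[lam]_x ((`|c|%:E * op lam K (weighted f) x) `^ r)) `^ r^-1)%E.
  rewrite energyZ_poweR// poweRM ?lee_fin ?powR_ge0//; last first.
    by apply: integral_ge0 => x _; exact: poweR_ge0.
  by rewrite poweR_EFin -powRrM mulfV ?gt_eqF// powRr1.
rewrite /wnorm unlock; apply: lee_poweR.
- by rewrite invr_ge0 ltW.
- by apply: integral_ge0 => x _; exact: poweR_ge0.
apply: ae_ge0_le_integral => //.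
- by move=> x _; exact: poweR_ge0.
- exact: measurable_wnorm_integrand.
- by move=> x _; exact: poweR_ge0.
- apply: (measurableT_comp (measurable_poweR _)).
  by apply: emeasurable_funM; [exact: measurable_cst|apply: measurable_op => //; exact: kern_sw].
have := ae_enorm_neq0; apply: filterS => x x0 _.
apply: lee_poweR; [exact: ltW|exact: abse_ge0|].
rewrite !abseM/= -(potential_abs_op mf x0) (ger0_norm (powR_ge0 _ _)) muleCA.
apply: lee_wpmul2l; first by rewrite lee_fin.
apply: lee_wpmul2l; first by rewrite lee_fin powR_ge0.
apply: le_trans (le_abse_integral _ _ _) _ => //.
  apply/measurable_EFinP.
  exact: (measurableT_comp (measurable_riesz_kernel mf) (pair1_measurable x)).
rewrite le_eqVlt; apply/orP; left; apply/eqP; apply: eq_integral => y _ /=.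
by rewrite normrM normfV (ger0_norm (powR_ge0 _ _)).
Qed.

Lemma wnorm_riesz_unweighted (g : X -> R) : nng g ->
  (wnorm gamma r (riesz s (unweighted g)) =
   `|riesz_const n s|%:E * (energy lam r K g) `^ r^-1)%E.
Proof.
move=> ng; set c := riesz_const n s.
have mu := measurable_unweighted ng.
have -> : (`|c|%:E * (energy lam r K g) `^ r^-1 =
    (\int[lam]_x ((`|c|%:E * op lam K g x) `^ r)) `^ r^-1)%E.
  rewrite energyZ_poweR// poweRM ?lee_fin ?powR_ge0//; last first.
    by apply: integral_ge0 => x _; exact: poweR_ge0.
  by rewrite poweR_EFin -powRrM mulfV ?gt_eqF// powRr1.
rewrite /wnorm unlock; congr poweR; apply: eq_integral_off0.
- exact: measurable_wnorm_integrand.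
- apply: (measurableT_comp (measurable_poweR _)).
  by apply: emeasurable_funM; [exact: measurable_cst|apply: measurable_op => //; exact: kern_sw].
- by move=> x; exact: poweR_ge0.
- by move=> x; exact: poweR_ge0.
move=> x x0; congr poweR.
rewrite -(op_unweighted x ng) -(potential_abs_op mu x0).
rewrite !abseM/= (ger0_norm (powR_ge0 _ _)) muleCA; congr (_ * (_ * _))%E.
have u0 y : 0 <= unweighted g y by rewrite mulr_ge0 ?powR_ge0//; exact: ng.2.
rewrite gee0_abs.
  by apply: eq_integral => y _; rewrite (ger0_norm (u0 y)).
by apply: integral_ge0 => y _; rewrite lee_fin divr_ge0 ?powR_ge0.
Qed.

Lemma ae_eq0_sqint0 (f : X -> R) : measurable_fun [set: X] f ->
  sqint lam (weighted f) = 0%E <-> {ae lam, forall x, f x = 0}.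
Proof.
move=> mf; have mw := (nng_weighted mf).1.
have m2 : measurable_fun [set: X] (fun x => (weighted f x ^+ 2)%:E).
  exact: measurable_sqr.
split=> [E|f0].
  have : ae_eq lam setT (fun x => (weighted f x ^+ 2)%:E) (cst 0%E).
    apply/(ae_eq_integral_abs lam measurableT m2).
    by rewrite -[RHS]E; apply: eq_integral => x _; rewrite gee0_abs// lee_fin sqr_ge0.
  move=> h; have := ae_enorm_neq0; move: h; apply: filterS2 => x /(_ I) + x0.
  have xp : 0 < enorm x by rewrite lt0r x0 enorm_ge0.
  move=> [] /eqP; rewrite sqrf_eq0 mulf_eq0 (gt_eqF (powR_gt0 _ xp)) normr_eq0.
  by move/eqP.
rewrite /sqint -[RHS](integral0 lam setT); apply: ge0_ae_eq_integral => //.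
  by move=> x _; rewrite lee_fin sqr_ge0.
by move: f0; apply: filterS => x fx _; rewrite /weighted fx normr0 mulr0 expr0n.
Qed.

End weighted_riesz.

Theorem theorem5p1 (R : realType) (n : nat) (s r alpha gamma : R)
    (hn : (2 <= n)%N)
    (hs0 : 0 < s) (hsn : s < n%:R / 2)
    (hr : 2 < r)
    (ha0 : 0 < alpha) (han : alpha < n%:R / 2)
    (hg : - (n%:R / r) < gamma) (hga : gamma < alpha)
    (hscal : 1 / r - 1 / 2 = (alpha - gamma - s) / n%:R) :
  exists g : euclid R n -> R,
    [/\ wL2 alpha g, nonzero g &
        wnorm gamma r (riesz s g) =
        (best_const n s r alpha gamma * wnorm alpha 2 (EFin \o g))%E].
Proof.
have n_gt0 : (0 < n)%N by exact: leq_trans hn.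
have nr0 : 0 < n%:R :> R by rewrite ltr0n.
have r0 : 0 < r by exact: lt_trans hr.
pose A := gamma + n%:R / r; pose B := n%:R / 2 - alpha.
have A0 : 0 < A by rewrite /A -[gamma]opprK addrC subr_gt0 ltrNl.
have B0 : 0 < B by rewrite subr_gt0.
(* This is the scaling relation multiplied by n. *)
have ABs : A + B = n%:R - s.
  have : n%:R * (1 / r - 1 / 2) = alpha - gamma - s.
    by rewrite hscal mulrC divfK// gt_eqF.
  rewrite /A /B mulrBr !mul1r.
  by move: (n%:R / r) => p; lra.
have r'0 : 0 < r^-1 by rewrite invr_gt0.
pose q := (2^-1 + r^-1)^-1.
have q'0 : 0 < 2^-1 + r^-1 :> R by rewrite addr_gt0.
have qE : q^-1 = 2^-1 + r^-1 by rewrite invrK.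
(* Here gamma < alpha enters, through A + B = n (1/2 + 1/r) - (alpha - gamma). *)
have qAB : q * (A + B) < n%:R.
  rewrite /q mulrC ltr_pdivrMr// /A /B mulrDr.
  by move: (n%:R / r) (n%:R / 2 : R) => a b; lra.
have [g [ng g1 gmax]] := sw_maximizer n_gt0 A0 B0 hr qE qAB.
pose c := riesz_const n s.
pose E := energy (lebesgue_tuple R n) r (sw_kernel A B r).
pose P := (`|c|%:E * E g `^ r^-1)%E.
have mu := measurable_unweighted alpha ng.
have wu : wnorm alpha 2 (EFin \o unweighted alpha g) = 1%E.
  by rewrite wnorm2_unweighted// g1 poweR_EFin powR1.
have uL2 : wL2 alpha (unweighted alpha g) by split=> //; rewrite wu ltry.
have un0 : nonzero (unweighted alpha g).
  move=> /(ae_eq0_sqint0 n_gt0 alpha mu) u0.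
  move: wu; rewrite wnorm2E u0 poweR_EFin powR0// => -[] /eqP.
  by rewrite eq_sym oner_eq0.
have rieszu : wnorm gamma r (riesz s (unweighted alpha g)) = P.
  exact: wnorm_riesz_unweighted.
exists (unweighted alpha g); split=> //.
rewrite rieszu wu mule1; apply/le_anti/andP; split.
  apply: ereal_sup_ubound; exists (unweighted alpha g) => //.
  by rewrite rieszu wu inve1 mule1.
apply: ge_ereal_sup => _ [f [[mf foo] f0] <-].
have nw := nng_weighted alpha mf.
pose w := weighted alpha f.
have w0 : sqint (lebesgue_tuple R n) w != 0%E.
  by apply/eqP => /(ae_eq0_sqint0 n_gt0 alpha mf).
have wge0 : (0 <= sqint (lebesgue_tuple R n) w)%E.
  by apply: integral_ge0 => x _; rewrite lee_fin sqr_ge0.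
move: foo; rewrite wnorm2E -/w.
case Ew : (sqint _ w) w0 wge0 => [m||]//; last first.
  by rewrite poweRyr// invr_neq0.
rewrite lee_fin eqe poweR_EFin => m0 mge0 _.
have mp : 0 < m by rewrite lt0r m0.
(* v is the weighted norm of the competitor f; dividing by it gives a unit vector, to which the
   maximality of g applies, and homogeneity restores the factor v. *)
set v := m `^ 2^-1; have vp : 0 < v by rewrite powR_gt0.
have v2 : v ^+ 2 = m by rewrite -powR_mulrn ?powR_ge0// -powRrM mulVf// powRr1.
rewrite inver gt_eqF// lee_pdivrMr//.
apply: le_trans (wnorm_riesz_le n_gt0 r0 ABs mf) _.
rewrite -muleA; apply: lee_wpmul2l => //.
have nv : nng (fun x => v^-1 * w x)%R by apply: nngZ => //; rewrite invr_ge0 ltW.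
have -> : weighted alpha f = (fun x => v * (v^-1 * w x))%R.
  by apply/funext => x; rewrite mulVKf// gt_eqF.
have Ev : (E (fun x => v^-1 * w x)%R <= E g)%E.
  apply: gmax => //; rewrite sqintZ; last exact: nw.1.
  by rewrite Ew exprVn v2 -EFinM mulVf.
rewrite energyZ//; last 2 first.
- exact: ltW.
- exact: kern_sw.
have E0 u : (0 <= E u)%E by apply: integral_ge0 => x _; exact: poweR_ge0.
rewrite poweRM ?E0 ?lee_fin ?powR_ge0// poweR_EFin -powRrM mulfV ?gt_eqF//.
rewrite (powRr1 (ltW vp)) muleC.
apply: lee_wpmul2r; first by rewrite lee_fin ltW.
by apply: lee_poweR => //; exact: ltW.
Qed.
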